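(* Let $(E,\phi)$ be a uniformizable Anderson $A$-module over $L$ with $A$-motive $\mathcal M$, $r=\mathrm{rk}(\mathcal M)$, and $\mathfrak p\neq0$ a prime ideal of $A$ such that $\mathcal M$ is free at $\mathfrak p$. Let $\mathbf m=(m_1,\dots,m_r)^{\mathsf T}$ be an $(A\otimes L)_{(\mathfrak p)}$-basis of $\mathcal M_{(\mathfrak p)}$, $\Theta$ the matrix with $\tau(\mathbf m)=\Theta\mathbf m$, $\Upsilon\in\mathrm{GL}_r(\mathbb T_{(\mathfrak p)})$ a rigid analytic trivialization (i.e. $\tau(\Upsilon\mathbf m)=\Upsilon\mathbf m$), and $\Psi=\Upsilon^{-1}$, so $\tau(\Psi)=\Theta\Psi$. Then for every $\gamma\in\mathrm{Gal}(L^{\mathrm{sep}}/L)$, the matrix $\Upsilon\cdot\gamma(\Upsilon)^{-1}\in\mathrm{GL}_r(A_\mathfrak p)$ (computed in $\mathrm{GL}_r((A\otimes\mathbb C_\infty)_\mathfrak p)$ via $\mathbb T_{(\mathfrak p)}\hookrightarrow(A\otimes\mathbb C_\infty)_\mathfrak p$) lies in $\Gamma_\Psi(K_\mathfrak p)\subseteq\mathrm{GL}_r(K_\mathfrak p)$. That is, the image of the $\mathfrak p$-adic Galois representation $\gamma\mapsto\Upsilon\gamma(\Upsilon)^{-1}$ lies in $\Gamma_\Psi(K_\mathfrak p)$.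
   Context: $\mathbb F_q$ finite field, $C$ smooth projective geometrically irreducible curve over $\mathbb F_q$, $\infty\in C$ closed point, $A=H^0(C\setminus\{\infty\},\mathcal O_C)$, $K=\mathrm{Frac}(A)$, $\mathbb C_\infty$ the completion at a place above $\infty$ of an algebraic closure of $K$. Unlabeled tensors over $\mathbb F_q$. $K\subseteq L\subseteq\mathbb C_\infty$, $\ell:K\to L$ inclusion, $L^{\mathrm{sep}}$ the separable closure of $L$ in $\mathbb C_\infty$. Anderson $A$-module $(E,\phi)$ over $L$: $E\cong\mathbb G_{a,L}^d$ as $\mathbb F_q$-vector space schemes, $\phi:A\to\mathrm{End}_{\mathbb F_q\text{-v.s.}}(E)$ ring homomorphism with $d\phi_a-\ell(a)$ nilpotent on $\mathrm{Lie}\,E$; uniformizable means the exponential (unique $\mathbb F_q$-linear $\exp_E:\mathrm{Lie}\,E\to E(\mathbb C_\infty)$ with $\phi_a\exp_E=\exp_Ed\phi_a$, $d\exp_E=\mathrm{id}$) is surjective. $A$-motive $\mathcal M=\mathrm{Hom}_{\mathbb F_q\text{-v.s.}}(E,\mathbb G_{a,L})$ ($A\otimes L$-module via $m\mapsto m\circ\phi_a$ and scalars on $\mathbb G_{a,L}$, with $\tau$-semilinear $m\mapsto\mathrm{Frob}_q\circ m$, $\tau(a\otimes l)=a\otimes l^q$); $\mathrm{rk}(\mathcal M)=\dim_{Q}Q\otimes_{A\otimes L}\mathcal M$ with $Q=\mathrm{Quot}(A\otimes L)$. For a domain $S\supseteq A$, $S_{(\mathfrak p)}=\bigcap_{\mathfrak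 q\supseteq\mathfrak pS}S_\mathfrak q$; $\mathcal M_{(\mathfrak p)}=(A\otimes L)_{(\mathfrak p)}\otimes\mathcal M$, and $\mathcal M$ is free at $\mathfrak p$ if this is free finitely generated. $\mathbb T$ is the Gauss-norm completion of $A\otimes\mathbb C_\infty$ (a domain, $\tau$ extended continuously), $\mathbb L=\mathrm{Quot}(\mathbb T)$; $(A\otimes F)_\mathfrak p=\varprojlim_n(A/\mathfrak p^{n+1})\otimes F$, and $\mathbb T_{(\mathfrak p)}$ embeds naturally in $(A\otimes\mathbb C_\infty)_\mathfrak p$. $A_\mathfrak p$ is the $\mathfrak p$-adic completion, $K_\mathfrak p=\mathrm{Quot}(A_\mathfrak p)$. $\mathrm{Gal}(L^{\mathrm{sep}}/L)$ acts on $(A\otimes L^{\mathrm{sep}})_\mathfrak p$ via the second factor (continuously), entrywise on matrices; the entries of $\Upsilon$ lie in $(A\otimes L^{\mathrm{sep}})_\mathfrak p$. Difference Galois group: let $P=Q[\Psi,\det(\Psi)^{-1}]\subseteq\mathbb L$ with $\tau$ restricted from $\mathbb L$; for a $K$-algebra $\mathsf A$, $\Gamma_\Psi(\mathsf A)=\{\alpha\in\mathrm{Aut}_{Q\otimes_K\mathsf A}(P\otimes_K\mathsf A):(\tau\otimes\mathrm{id})\circ\alpha=\alpha\circ(\tau\otimes\mathrm{id})\}$, embedded into $\mathrm{GL}_r(\mathsf A)$ by $\alpha\mapsto\Psi^{-1}\alpha(\Psi)$. Equivalently, with $I=\{h\in Q[Y_{ij},\det(Y)^{-1}]:h(\Psi)=0\}$,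 a matrix $C\in\mathrm{GL}_r(\mathsf A)$ lies in $\Gamma_\Psi(\mathsf A)$ iff $h(\Psi\otimes C)=0$ in $P\otimes_K\mathsf A$ for all $h\in I$, where $\Psi\otimes C=(\sum_l\Psi_{il}\otimes C_{lj})_{ij}$. *)

(* Defs.v *)
From HB Require Import structures.
From mathcomp Require Import all_boot all_order all_algebra all_field.
From mathcomp Require Import boolp reals.
From mathcomp Require Import mpoly.

Set Implicit Arguments.
Unset Strict Implicit.
Unset Printing Implicit Defensive.

Import Order.TTheory GRing.Theory Num.Theory.
Local Open Scope ring_scope.

Record subr (U : comNzRingType) (S : subringClosed U) :=
  Subr { subr_val :> U; _ : subr_val \in S }.

HB.instance Definition _ U S := [isSub for @subr_val U S].
HB.instance Definition _ U S := [Choice of @subr U S by <:].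
HB.instance Definition _ U S := [SubChoice_isSubComNzRing of @subr U S by <:].

Section SubrLift.
Variables (V U : comNzRingType) (S : subringClosed U) (f : {rmorphism V -> U}).
Hypothesis fS : forall x, f x \in S.

Definition subr_lift (x : V) : subr S := Subr (fS x).

Fact subr_lift_zmod_morphism : zmod_morphism subr_lift.
Proof. by move=> x y; apply: val_inj; rewrite /= rmorphB. Qed.

Fact subr_lift_monoid_morphism : monoid_morphism subr_lift.
Proof.
by split=> [|x y]; apply: val_inj; rewrite /= (rmorph1, rmorphM).
Qed.

HB.instance Definition _ :=
  GRing.isZmodMorphism.Build V (subr S) subr_lift subr_lift_zmod_morphism.
HB.instance Definition _ :=
  GRing.isMonoidMorphism.Build V (subr S) subr_lift subr_lift_monoid_morphism.
End SubrLift.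

Section Generated.
Variables (U : comNzRingType) (G : U -> Prop).

Definition gen_pred : {pred U} := fun x =>
  `[< forall S : subringClosed U, (forall g, G g -> g \in S) -> x \in S >].

Fact gen_subring_closed : subring_closed gen_pred.
Proof.
split=> [|x y /asboolP Sx /asboolP Sy|x y /asboolP Sx /asboolP Sy];
  apply/asboolP => S GS; first exact: rpred1.
- by rewrite rpredB ?Sx ?Sy.
- by rewrite rpredM ?Sx ?Sy.
Qed.

HB.instance Definition _ :=
  GRing.isSubringClosed.Build U gen_pred gen_subring_closed.

Lemma gen_predP g : G g -> g \in gen_pred.
Proof. by move=> Gg; apply/asboolP => S; apply. Qed.
End Generated.

(* Canonical objects (tensor products, completions, inverse limits, the
   extensions of tau, the natural embeddings) are given by arbitrary data with
   the property that characterizes them up to unique isomorphism; that A (x) L,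
   the Tate algebra and A_p are domains is recorded in their types. *)

(* [T], with [a (x) b := i a * j b], is the tensor product over [k] of the
   [k]-algebras [A] and [B] with structure maps [f] and [g]: it is universal
   for the [k]-bilinear maps on [A * B]. *)
Definition is_tensor (k A B T : comNzRingType) (f : k -> A) (g : k -> B)
    (i : {rmorphism A -> T}) (j : {rmorphism B -> T}) : Prop :=
  (forall c, i (f c) = j (g c)) /\
  forall (W : lmodType k) (beta : A -> B -> W),
    (forall a a' b, beta (a + a') b = beta a b + beta a' b) ->
    (forall a b b', beta a (b + b') = beta a b + beta a b') ->
    (forall c a b, beta (f c * a) b = c *: beta a b) ->
    (forall c a b, beta a (g c * b) = c *: beta a b) ->
    let lifts (h : T -> W) :=
      [/\ forall x y, h (x + y) = h x + h y,
          forall c x, h (i (f c) * x) = c *: h x &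
          forall a b, h (i a * j b) = beta a b] in
    (exists h, lifts h) /\ (forall h h', lifts h -> lifts h' -> h =1 h').

(* [N], with [b : M -> N], is [S (x)_R M] for the ring homomorphism [f]. *)
Definition is_base_change (R S : comNzRingType) (f : R -> S)
    (M : lmodType R) (N : lmodType S) (b : M -> N) : Prop :=
  let semilinear (W : lmodType S) (g : M -> W) :=
    (forall x y, g (x + y) = g x + g y) /\
    (forall c x, g (c *: x) = f c *: g x) in
  semilinear N b /\
  forall (W : lmodType S) (g : M -> W), semilinear W g ->
    (exists h : {linear N -> W}, forall x, h (b x) = g x) /\
    (forall h h' : {linear N -> W},
       (forall x, h (b x) = g x) -> (forall x, h' (b x) = g x) -> h =1 h').

Definition is_basis (R : comNzRingType) (N : lmodType R) (r : nat)
    (m : 'I_r -> N) : Prop :=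
  forall x, exists! c : {ffun 'I_r -> R}, x = \sum_i c i *: m i.

Definition free_fg (R : comNzRingType) (N : lmodType R) : Prop :=
  exists r (m : 'I_r -> N), is_basis m.

Section Localization.
Variables (A : comNzRingType) (S : idomainType) (i : A -> S).
Variable (p : prime_idealr A).

(* S_(p), the intersection of the S_q over the prime ideals q of S containing
   pS, inside Quot(S). *)
Definition loc_pred : {pred {fraction S}} := fun f =>
  `[< forall q : prime_idealr S, (forall a, a \in p -> i a \in q) ->
      exists x y : S, y \notin q /\ f = tofrac x / tofrac y >].

Lemma frac_neq0 (q : prime_idealr S) (y : S) : y \notin q -> tofrac y != 0.
Proof.
by move=> yq; rewrite tofrac_eq0; apply: contraNneq yq => ->; rewrite idealr0.
Qed.

Fact loc_subring_closed : subring_closed loc_pred.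
Proof.
split=> [|f g /asboolP Sf /asboolP Sg|f g /asboolP Sf /asboolP Sg];
  apply/asboolP => q pq.
- by exists 1, 1; rewrite idealr1 tofrac1 divr1.
- have [x [y [yq ->]]] := Sf q pq; have [z [t [tq ->]]] := Sg q pq.
  exists (x * t - z * y), (y * t); rewrite prime_idealrM negb_or yq tq.
  split=> //; rewrite tofracB !tofracM.
  by rewrite -mulNr addf_div ?(frac_neq0 yq) ?(frac_neq0 tq) // mulNr.
- have [x [y [yq ->]]] := Sf q pq; have [z [t [tq ->]]] := Sg q pq.
  exists (x * z), (y * t); rewrite prime_idealrM negb_or yq tq.
  by split=> //; rewrite !tofracM mulf_div.
Qed.

HB.instance Definition _ :=
  GRing.isSubringClosed.Build {fraction S} loc_pred loc_subring_closed.

Definition loc : comNzRingType := subr loc_pred.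

Fact tofrac_loc (x : S) : tofrac x \in loc_pred.
Proof.
by apply/asboolP => q _; exists x, 1; rewrite idealr1 tofrac1 divr1.
Qed.

Definition to_loc : {rmorphism S -> loc} := subr_lift tofrac_loc.
End Localization.

Section IdealPower.
Variables (A : comNzRingType) (p : prime_idealr A).

(* [in_ipow n] is the ideal p^(n+1). *)
Fixpoint in_ipow (n : nat) (x : A) : Prop :=
  if n is n'.+1 then
    exists s : seq (A * A),
      (forall u, u \in s -> u.1 \in p /\ in_ipow n' u.2) /\
      x = \sum_(u <- s) u.1 * u.2
  else x \in p.

Definition ipow (n : nat) : {pred A} := fun x => `[< in_ipow n x >].

Fact in_ipow0 n : in_ipow n 0.
Proof.
case: n => [|n]; first exact: idealr0.
by exists [::]; split=> //; rewrite big_nil.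
Qed.

Fact in_ipowD n x y : in_ipow n x -> in_ipow n y -> in_ipow n (x + y).
Proof.
case: n => [|n] /=; first exact: rpredD.
move=> [s [sp ->]] [t [tp ->]]; exists (s ++ t); rewrite big_cat; split=> // u.
by rewrite mem_cat => /orP[/sp|/tp].
Qed.

Fact in_ipowM n a x : in_ipow n x -> in_ipow n (a * x).
Proof.
case: n => [|n] /=; first exact: idealMr.
move=> [s [sp ->]]; exists [seq (a * u.1, u.2) | u <- s]; split.
  by move=> _ /mapP[u /sp[up un] ->]; split=> //; apply: idealMr.
by rewrite big_map mulr_sumr; apply: eq_bigr => u _; rewrite mulrA.
Qed.

Fact in_ipow_sub n x : in_ipow n x -> x \in p.
Proof.
case: n => [|n] //= [s [sp ->]]; rewrite big_seq.
by apply: rpred_sum => u /sp[up _]; rewrite mulrC idealMr.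
Qed.

Fact ipow_idealr_closed n : idealr_closed (ipow n).
Proof.
split; first exact/asboolP/in_ipow0.
  by apply/asboolP => /in_ipow_sub; rewrite idealr1.
move=> a x y /asboolP px /asboolP py; apply/asboolP.
exact: in_ipowD (in_ipowM a px) py.
Qed.

HB.instance Definition _ n := isIdealr.Build A (ipow n) (ipow_idealr_closed n).

(* [quo n] is A/p^(n+1). *)
Definition quo (n : nat) : comNzRingType := {ideal_quot (ipow n)}.
Definition to_quo (n : nat) (a : A) : quo n := \pi_({ideal_quot (ipow n)})%qT a.

Fact to_quo_zmod_morphism n : zmod_morphism (to_quo n).
Proof. by move=> x y; rewrite /to_quo rmorphB. Qed.

Fact to_quo_monoid_morphism n : monoid_morphism (to_quo n).
Proof. by split=> [|x y]; rewrite /to_quo (rmorph1, rmorphM). Qed.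

HB.instance Definition _ n :=
  GRing.isZmodMorphism.Build A (quo n) (to_quo n) (to_quo_zmod_morphism n).
HB.instance Definition _ n :=
  GRing.isMonoidMorphism.Build A (quo n) (to_quo n) (to_quo_monoid_morphism n).
End IdealPower.

Definition is_invlim (T : nat -> comNzRingType)
    (tr : forall n, {rmorphism T n.+1 -> T n})
    (Z : comNzRingType) (pr : forall n, {rmorphism Z -> T n}) : Prop :=
  (forall n z, tr n (pr n.+1 z) = pr n z) /\
  forall x : forall n, T n, (forall n, tr n (x n.+1) = x n) ->
    exists! z, forall n, pr n z = x n.

Section Norms.
Variable R : realType.

Definition is_norm (X : comNzRingType) (N : X -> R) : Prop :=
  [/\ forall x, 0 <= N x, forall x, N x = 0 <-> x = 0,
      forall x y, N (x - y) <= Num.max (N x) (N y) &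
      forall x y, N (x * y) <= N x * N y].

Definition is_abs (X : fieldType) (N : X -> R) : Prop :=
  is_norm N /\ forall x y, N (x * y) = N x * N y.

Definition ncvg (X : comNzRingType) (N : X -> R) (u : nat -> X) (l : X) : Prop :=
  forall e : R, 0 < e -> exists n0, forall n, (n0 <= n)%N -> N (u n - l) < e.

Definition is_completion (X Y : comNzRingType) (NX : X -> R) (NY : Y -> R)
    (i : {rmorphism X -> Y}) : Prop :=
  [/\ is_norm NY,
      forall x, NY (i x) = NX x,
      forall y (e : R), 0 < e -> exists x, NY (y - i x) < e &
      forall u : nat -> Y,
        (forall e : R, 0 < e -> exists n0, forall m n,
           (n0 <= m)%N -> (n0 <= n)%N -> NY (u m - u n) < e) ->
        exists l, ncvg NY u l].

Definition is_continuous (X Y : comNzRingType) (NX : X -> R) (NY : Y -> R)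
    (f : X -> Y) : Prop :=
  forall (x : X) (e : R), 0 < e ->
    exists2 d : R, 0 < d & forall y, NX (y - x) < d -> NY (f y - f x) < e.

(* The Gauss norm of T = B (x)_F C, for F a finite field: the maximum of the
   |c_i| for sum_i b_i (x) c_i with (b_i) linearly independent over F. *)
Definition is_gauss_norm (F : finFieldType) (B T : comNzRingType) (C : fieldType)
    (FB : F -> B) (absC : C -> R) (i : B -> T) (j : C -> T) (N : T -> R) : Prop :=
  forall (n : nat) (b : 'I_n -> B) (c : 'I_n -> C),
    (forall x : 'I_n -> F, \sum_k FB (x k) * b k = 0 -> forall k, x k = 0) ->
    N (\sum_k i (b k) * j (c k)) = \big[Num.max/0]_k absC (c k).
End Norms.

(* Closed points of the smooth projective curve with function field K over F
   are encoded by their local rings: the valuation rings O of K, different from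
   K, that contain F. *)
Definition is_place (F K : fieldType) (FK : F -> K) (O : K -> Prop) : Prop :=
  [/\ (forall c, O (FK c)),
      (forall x y, O x -> O y -> O (x - y) /\ O (x * y)),
      (forall x, O x \/ O x^-1) &
      exists x, ~ O x].

(* [K] is a finite extension of F(t), with t transcendental over [F]. *)
Definition is_function_field (F K : fieldType) (FK : {rmorphism F -> K}) : Prop :=
  exists t : K, ~ algebraicOver FK t /\
  exists n (b : 'I_n -> K), forall x, exists u v : 'I_n -> {poly F},
    (forall k, v k != 0) /\
    x = \sum_k (map_poly FK (u k)).[t] / (map_poly FK (v k)).[t] * b k.

(* A smooth projective geometrically irreducible curve over a finite field,
   given by its function field, with a closed point [Oinf]. As a finite field is
   perfect, geometric irreducibility means that [Fq] is algebraically closed in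
   [KK]. *)
Record curve := Curve {
  Fq : finFieldType;
  KK : fieldType;
  FqK : {rmorphism Fq -> KK};
  KK_function_field : is_function_field FqK;
  KK_geom_irr : forall x, algebraicOver FqK x -> exists c, x = FqK c;
  Oinf : KK -> Prop;
  Oinf_place : is_place FqK Oinf }.

Section CoordinateRing.
Variable X : curve.

Definition AA_pred : {pred KK X} := fun x =>
  `[< forall O, is_place (FqK X) O -> ~ (forall y, O y <-> Oinf y) -> O x >].

Fact AA_subring_closed : subring_closed AA_pred.
Proof.
split=> [|x y /asboolP Ax /asboolP Ay|x y /asboolP Ax /asboolP Ay];
  apply/asboolP => O pO nO.
- by case: pO => /(_ 1); rewrite rmorph1.
- by case: (pO) => _ /(_ x y (Ax O pO nO) (Ay O pO nO))[].
- by case: (pO) => _ /(_ x y (Ax O pO nO) (Ay O pO nO))[].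
Qed.

HB.instance Definition _ :=
  GRing.isSubringClosed.Build (KK X) AA_pred AA_subring_closed.

(* A = H^0(C \ {oo}, O_C) *)
Definition AA : comNzRingType := subr AA_pred.

Fact FqK_AA c : FqK X c \in AA_pred.
Proof. by apply/asboolP => O []. Qed.

Definition FqA : {rmorphism Fq X -> AA} := subr_lift FqK_AA.
End CoordinateRing.

Definition is_alg_closure (K Kb : fieldType) (i : {rmorphism K -> Kb}) : Prop :=
  (forall x, algebraicOver i x) /\ GRing.closed_field_axiom Kb.

Record coefficients (X : curve) := Coefficients {
  RR : realType;
  CC : fieldType;
  absC : CC -> RR;
  KC : {rmorphism KK X -> CC};
  absC_abs : is_abs absC;
  absC_inf : forall x, Oinf x <-> absC (KC x) <= 1;
  CC_completion : exists (Kb : fieldType) (KKb : {rmorphism KK X -> Kb})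
      (KbC : {rmorphism Kb -> CC}),
    [/\ is_alg_closure KKb, forall x, KbC (KKb x) = KC x &
        is_completion (absC \o KbC) absC KbC];
  LL : fieldType;
  KL : {rmorphism KK X -> LL};
  LC : {rmorphism LL -> CC};
  LC_KL : forall x, LC (KL x) = KC x;
  Lsep : fieldType;
  LLsep : {rmorphism LL -> Lsep};
  LsepC : {rmorphism Lsep -> CC};
  LsepC_LLsep : forall x, LsepC (LLsep x) = LC x;
  Lsep_separable : forall z : CC, (exists x, LsepC x = z) <->
    exists P : {poly LL}, separable_poly P /\ root (map_poly LC P) z }.

Section ConstantFields.
Variables (X : curve) (Y : coefficients X).

Definition FqL (c : Fq X) : LL Y := KL Y (FqK X c).
Definition FqLsep (c : Fq X) : Lsep Y := LLsep Y (FqL c).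
Definition FqC (c : Fq X) : CC Y := KC Y (FqK X c).
Definition q := #|Fq X|.

Definition in_Gal (gamma : {rmorphism Lsep Y -> Lsep Y}) : Prop :=
  bijective gamma /\ forall x, gamma (LLsep Y x) = LLsep Y x.
End ConstantFields.

Arguments q : clear implicits.

Record tate (X : curve) (Y : coefficients X) := Tate {
  AL : idomainType;
  AL_l : {rmorphism AA X -> AL};
  AL_r : {rmorphism LL Y -> AL};
  AL_tensor : is_tensor (@FqA X) (@FqL X Y) AL_l AL_r;
  tauAL : {rmorphism AL -> AL};
  tauALE : forall a l, tauAL (AL_l a * AL_r l) = AL_l a * AL_r (l ^+ q X);
  AC : comNzRingType;
  AC_l : {rmorphism AA X -> AC};
  AC_r : {rmorphism CC Y -> AC};
  AC_tensor : is_tensor (@FqA X) (@FqC X Y) AC_l AC_r;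
  normAC : AC -> RR Y;
  normAC_gauss : is_gauss_norm (@FqA X) (@absC X Y) AC_l AC_r normAC;
  TT : idomainType;
  normT : TT -> RR Y;
  ACT : {rmorphism AC -> TT};
  TT_completion : is_completion normAC normT ACT;
  tauT : {rmorphism TT -> TT};
  tauTE : forall a c,
    tauT (ACT (AC_l a * AC_r c)) = ACT (AC_l a * AC_r (c ^+ q X));
  tauT_continuous : is_continuous normT normT tauT;
  ALT : {rmorphism AL -> TT};
  ALTE : forall a l, ALT (AL_l a * AL_r l) = ACT (AC_l a * AC_r (LC Y l));
  ALTF : {rmorphism {fraction AL} -> {fraction TT}};
  ALTFE : forall x, ALTF (tofrac x) = tofrac (ALT x);
  tauTF : {rmorphism {fraction TT} -> {fraction TT}};
  tauTFE : forall x, tauTF (tofrac x) = tofrac (tauT x);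
  KQ : {rmorphism KK X -> {fraction AL}};
  KQE : forall a : AA X, KQ (val a) = tofrac (AL_l a) }.

Arguments AL_l {X Y} _.
Arguments AL_r {X Y} _.
Arguments AC_l {X Y} _.
Arguments AC_r {X Y} _.

(* The morphism of schemes G_a^d -> G_a given by [f] is a morphism of F-vector
   space schemes (expressed on points). *)
Definition Fq_linear (F L : fieldType) (FL : F -> L) (d : nat)
    (f : {mpoly L[d]}) : Prop :=
  forall (S : comNzRingType) (g : {rmorphism L -> S}) (x y : 'I_d -> S),
    mmap g (fun k => x k + y k) f = mmap g x f + mmap g y f /\
    forall c : F, mmap g (fun k => g (FL c) * x k) f = g (FL c) * mmap g x f.

(* The F_q-vector space scheme E is identified with G_a^d by a choice of
   coordinates; [phi a] lists the components of phi_a. *)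
Record anderson_module (X : curve) (Y : coefficients X) := AndersonModule {
  dimE : nat;
  phi : AA X -> dimE.-tuple {mpoly (LL Y)[dimE]};
  phi_linear : forall a k, Fq_linear (@FqL X Y) (tnth (phi a) k);
  phi1 : forall k, tnth (phi 1) k = 'X_k;
  phiD : forall a b k, tnth (phi (a + b)) k = tnth (phi a) k + tnth (phi b) k;
  phiM : forall a b k, tnth (phi (a * b)) k = tnth (phi a) k \mPo phi b;
  lie : AA X -> 'M[LL Y]_dimE :=
    fun a => \matrix_(k, j) (tnth (phi a) k)@_U_(j);
  lie_nilpotent : forall a,
    exists n, (lie a - (KL Y (val a))%:M) ^+ n = 0 }.

Arguments phi {X Y} _ _.
Arguments lie {X Y} _ _.

Section Uniformizable.
Variables (X : curve) (Y : coefficients X) (E : anderson_module Y).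
Local Notation d := (dimE E).

Definition phiC (a : AA X) (v : 'cV[CC Y]_d) : 'cV[CC Y]_d :=
  \col_k mmap (LC Y) (fun j => v j 0) (tnth (phi E a) k).

(* An exponential is an everywhere convergent F_q-linear power series
   z |-> sum_i e_i z^(q^i) with linear term e_0 = 1. *)
Definition is_exponential (ex : 'cV[CC Y]_d -> 'cV[CC Y]_d) : Prop :=
  exists e : nat -> 'M[CC Y]_d,
    [/\ e 0%N = 1%:M,
        forall z k, ncvg (@absC X Y)
          (fun n => (\sum_(i < n) e i *m map_mx (fun x => x ^+ (q X ^ i)) z) k 0)
          (ex z k 0) &
        forall a z, phiC a (ex z) = ex (map_mx (LC Y) (lie E a) *m z)].

Definition uniformizable : Prop :=
  exists ex, is_exponential ex /\ forall v, exists z, ex z = v.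
End Uniformizable.

(* [mot_hom] identifies [mot] with Hom_{F_q-v.s.}(E, G_a). *)
Record motive (X : curve) (Y : coefficients X) (Z : tate Y)
    (E : anderson_module Y) := Motive {
  mot : lmodType (AL Z);
  mot_hom : mot -> {mpoly (LL Y)[dimE E]};
  mot_hom_inj : injective mot_hom;
  mot_homP : forall f, (exists m, mot_hom m = f) <-> Fq_linear (@FqL X Y) f;
  mot_homD : forall m n, mot_hom (m + n) = mot_hom m + mot_hom n;
  mot_homZ : forall a l m, mot_hom ((AL_l Z a * AL_r Z l) *: m) =
    l *: (mot_hom m \mPo phi E a);
  tauM : mot -> mot;
  tauME : forall m, mot_hom (tauM m) = mot_hom m ^+ q X }.

Arguments mot {X Y Z E} _.
Arguments tauM {X Y Z E} _ _.

Definition has_rank (R : idomainType) (M : lmodType R) (r : nat) : Prop :=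
  exists (V : vectType {fraction R}) (b : M -> V),
    is_base_change (@FracField.tofrac R) b /\ \dim {:V} = r.

Section AtPrime.
Variables (X : curve) (Y : coefficients X) (Z : tate Y).
Variable p : prime_idealr (AA X).

Definition ALp := loc (AL_l Z) p.
Definition TTp := loc (ACT Z \o AC_l Z) p.

Record loc_maps := LocMaps {
  tauALp : {rmorphism ALp -> ALp};
  tauALpE : forall x, tauALp (to_loc _ p x) = to_loc _ p (tauAL Z x);
  tauTTp : {rmorphism TTp -> TTp};
  tauTTpE : forall x, tauTTp (to_loc _ p x) = to_loc _ p (tauT Z x);
  ALpTTp : {rmorphism ALp -> TTp};
  ALpTTpE : forall x, ALpTTp (to_loc _ p x) = to_loc _ p (ALT Z x) }.

(* M_(p) = (A (x) L)_(p) (x) M and T_(p) (x) M, with their tau *)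
Record loc_motive (W : loc_maps) (E : anderson_module Y) (M : motive Z E) :=
  LocMotive {
    motp : lmodType ALp;
    to_motp : mot M -> motp;
    motp_base_change : is_base_change (to_loc (AL_l Z) p) to_motp;
    tau_motp : motp -> motp;
    tau_motpD : forall x y, tau_motp (x + y) = tau_motp x + tau_motp y;
    tau_motpZ : forall c x, tau_motp (c *: x) = tauALp W c *: tau_motp x;
    tau_motpE : forall x, tau_motp (to_motp x) = to_motp (tauM M x);
    motT : lmodType TTp;
    to_motT : motp -> motT;
    motT_base_change : is_base_change (ALpTTp W) to_motT;
    tau_motT : motT -> motT;
    tau_motTD : forall x y, tau_motT (x + y) = tau_motT x + tau_motT y;
    tau_motTZ : forall c x, tau_motT (c *: x) = tauTTp W c *: tau_motT x;
    tau_motTE : forall x, tau_motT (to_motT x) = to_motT (tau_motp x) }.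

(* (A (x) F)_p, the inverse limit of the (A/p^(n+1)) (x) F *)
Record padic (F : fieldType) (FqF : Fq X -> F) := Padic {
  pT : nat -> comNzRingType;
  pT_l : forall n, {rmorphism quo p n -> pT n};
  pT_r : forall n, {rmorphism F -> pT n};
  pT_tensor : forall n,
    is_tensor (fun c => to_quo p n (FqA X c)) FqF (pT_l n) (pT_r n);
  pT_tr : forall n, {rmorphism pT n.+1 -> pT n};
  pT_trE : forall n a x,
    pT_tr n (pT_l n.+1 (to_quo p n.+1 a) * pT_r n.+1 x) =
    pT_l n (to_quo p n a) * pT_r n x;
  pZ : comUnitRingType;
  pZ_pr : forall n, {rmorphism pZ -> pT n};
  pZ_lim : is_invlim pT_tr pZ_pr }.

Arguments pT_l {F FqF} _ _.
Arguments pT_r {F FqF} _ _.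
Arguments pZ_pr {F FqF} _ _.

(* [g] is induced by [s : F1 -> F2] on the second factor. *)
Definition padic_induced (F1 F2 : fieldType) (f1 : Fq X -> F1) (f2 : Fq X -> F2)
    (P1 : padic f1) (P2 : padic f2) (s : F1 -> F2) (g : pZ P1 -> pZ P2) : Prop :=
  forall n, exists gn : {rmorphism pT P1 n -> pT P2 n},
    (forall b x, gn (pT_l P1 n b * pT_r P1 n x) = pT_l P2 n b * pT_r P2 n (s x)) /\
    forall z, pZ_pr P2 n (g z) = gn (pZ_pr P1 n z).

Record completions := Completions {
  Ap : idomainType;
  Ap_tr : forall n, {rmorphism quo p n.+1 -> quo p n};
  Ap_trE : forall n a, Ap_tr n (to_quo p n.+1 a) = to_quo p n a;
  Ap_pr : forall n, {rmorphism Ap -> quo p n};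
  Ap_lim : is_invlim Ap_tr Ap_pr;
  AAp : {rmorphism AA X -> Ap};
  AApE : forall n a, Ap_pr n (AAp a) = to_quo p n a;
  KKp : {rmorphism KK X -> {fraction Ap}};
  KKpE : forall a : AA X, KKp (val a) = tofrac (AAp a);
  pLsep : padic (@FqLsep X Y);
  pC : padic (@FqC X Y);
  ApC : {rmorphism Ap -> pZ pC};
  ApCE : forall n z, pZ_pr pC n (ApC z) = pT_l pC n (Ap_pr n z);
  pLsepC : {rmorphism pZ pLsep -> pZ pC};
  pLsepC_induced : padic_induced (LsepC Y) pLsepC;
  (* The natural embedding of T_(p). It is determined by its values on
     A (x) C_oo and continuity, as A (x) C_oo is dense in T and T_(p) is
     contained in Quot(T). *)
  TTpC : {rmorphism TTp -> pZ pC};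
  TTpCE : forall n a c,
    pZ_pr pC n (TTpC (to_loc _ p (ACT Z (AC_l Z a * AC_r Z c)))) =
    pT_l pC n (to_quo p n a) * pT_r pC n c;
  TTpC_continuous : forall n, exists N : pT pC n -> RR Y,
    is_gauss_norm (fun c => to_quo p n (FqA X c)) (@absC X Y)
      (pT_l pC n) (pT_r pC n) N /\
    is_continuous (@normT _ _ Z) N
      (fun t => pZ_pr pC n (TTpC (to_loc _ p t)));
  TTpC_inj : injective TTpC }.
End AtPrime.

Section Galois.
Variables (X : curve) (Y : coefficients X) (Z : tate Y) (r : nat).
Variable Psi : 'M[{fraction (TT Z)}]_r.

Definition PV_gen (y : {fraction (TT Z)}) : Prop :=
  [\/ exists x, y = ALTF Z x, exists i j, y = Psi i j | y = (\det Psi)^-1].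

(* P = Q[Psi, det(Psi)^-1] *)
Definition PV : comNzRingType := subr (gen_pred PV_gen).

Fact ALTF_PV x : ALTF Z x \in gen_pred PV_gen.
Proof. by apply: gen_predP; apply: Or31; exists x. Qed.

Fact Psi_PV i j : Psi i j \in gen_pred PV_gen.
Proof. by apply: gen_predP; apply: Or32; exists i, j. Qed.

Definition QPV : {rmorphism {fraction (AL Z)} -> PV} := subr_lift ALTF_PV.
Definition PsiPV : 'M[PV]_r := \matrix_(i, j) Subr (Psi_PV i j).

(* [C] = Psi^-1 alpha(Psi) for some alpha in Gamma_Psi(S), with [S] a
   K-algebra; [T] is P (x)_K S and [tauPS] is tau (x) id. As [i] and [j]
   generate [T], alpha is (Q (x)_K S)-linear iff it fixes Q and S. *)
Definition in_Gamma (S : comUnitRingType) (KS : {rmorphism KK X -> S})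
    (C : 'M[S]_r) : Prop :=
  C \in unitmx /\
  forall (T : comNzRingType) (i : {rmorphism PV -> T}) (j : {rmorphism S -> T}),
    is_tensor (QPV \o KQ Z) KS i j ->
    exists (tauP : {rmorphism PV -> PV}) (tauPS alpha : {rmorphism T -> T}),
      [/\ forall x, val (tauP x) = tauTF Z (val x),
          forall x c, tauPS (i x * j c) = i (tauP x) * j c,
          bijective alpha &
          [/\ forall x, alpha (i (QPV x)) = i (QPV x),
              forall c, alpha (j c) = j c,
              forall t, tauPS (alpha t) = alpha (tauPS t) &
              map_mx (alpha \o i) PsiPV = map_mx i PsiPV *m map_mx j C]].
End Galois.

(* Main.v *)
(* Idea. Put A_n = A/p^(n+1). Modulo each power of p, the equation
   Ups = tau(Ups) Theta becomes a system x = B x^(q) over L, whose solutions are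
   separable over L; hence Ups descends to a matrix over (A (x) Lsep)_p, and
   C = Ups gamma(Ups)^-1 is tau-invariant, hence has entries in A_p.
   As Psi C = gamma(Psi), every relation over A (x) L satisfied by Psi is
   satisfied by Psi C in (A (x) C_oo)_p. To carry it back to P (x)_K K_p, one
   needs the multiplication map T_(p) (x)_A A_p -> (A (x) C_oo)_p to be
   injective; this is a computation with Gauss norms, see TTC_indep. The inverse
   automorphism is obtained by exchanging the roles of id and gamma. That tau
   fixes K requires K = Frac(A), which holds as soon as A has a nonconstant
   element, such as a nonzero element of p. *)
From HB Require Import structures.
Require Import Defs.
From mathcomp Require Import all_boot all_order all_algebra all_field.
From mathcomp Require Import boolp reals.
From mathcomp Require Import mpoly.
From mathcomp Require Import zify ring.
From mathcomp Require classical_sets.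

Set Implicit Arguments.
Unset Strict Implicit.
Unset Printing Implicit Defensive.

Import Order.TTheory GRing.Theory Num.Theory.
Local Open Scope ring_scope.

(** * Generated subrings and tensor products *)

(** [P] is a generated subring of Quot(T), with no presentation on which alpha could be defined, and
    elements of Q need not lie in T_(p), so they need not have an image in (A (x) C_oo)_p. So alpha
    is built as a graph: x in [P] is written xi / d with d in A (x) L and xi in T_(p), xi is lifted
    to (A (x) Lsep)_p, the place where gamma acts, and alpha(x) is the t for which t d corresponds
    to the conjugate of xi under the multiplication map. Single-valuedness of this graph is what the
    injectivity results are for: that of the multiplication map and that of (A (x) Lsep)_p -> (A (x)
    C_oo)_p. Both have the same source. A family of A/p^(n+1) independent over Fq stays independent
    over C_oo, as a Gauss norm is the maximum of the coefficients on such a family. Hence the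
    computations take place at finite level, in coordinates on finite Fq-independent families, and
    relations are compared coefficient by coefficient. *)

Section GeneratedInduction.
Variables (U : comNzRingType) (P : U -> Prop).
Hypotheses (P1 : P 1) (PB : forall x y, P x -> P y -> P (x - y)).
Hypothesis PM : forall x y, P x -> P y -> P (x * y).

Definition ring_pred : {pred U} := fun x => `[< P x >].

Fact ring_pred_closed : subring_closed ring_pred.
Proof.
split=> [|x y /asboolP Px /asboolP Py|x y /asboolP Px /asboolP Py].
- exact/asboolP.
- exact/asboolP/PB.
- exact/asboolP/PM.
Qed.

HB.instance Definition _ :=
  GRing.isSubringClosed.Build U ring_pred ring_pred_closed.

Lemma gen_ind (G : U -> Prop) : (forall x, G x -> P x) ->
  forall x, x \in gen_pred G -> P x.
Proof.
by move=> GP x /asboolP Gx; apply/asboolP/(Gx ring_pred) => y /GP Py;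
  apply/asboolP.
Qed.
End GeneratedInduction.

Section FunctionalRelation.
Variables (R S : comNzRingType) (H : R -> S -> Prop).
Hypotheses (H_total : forall x, exists y, H x y).
Hypothesis H_zero : forall y, H 0 y -> y = 0.
Hypothesis H1 : H 1 1.
Hypothesis HB : forall x x' y y', H x x' -> H y y' -> H (x - y) (x' - y').
Hypothesis HM : forall x x' y y', H x x' -> H y y' -> H (x * y) (x' * y').

(** Subtracting two values at the same element gives a value at 0, so additivity and [H_zero] make
    the relation single-valued. This defines morphisms out of rings known only by generators, or
    into inverse limits. *)
Lemma rmorph_of_rel : exists f : {rmorphism R -> S}, forall x y, H x y -> f x = y.
Proof.
pose f x := projT1 (cid (H_total x)).
have fP x : H x (f x) by rewrite /f; case: cid.
have f_eq x y : H x y -> f x = y.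
  by move=> Hxy; apply: subr0_eq; apply: H_zero; rewrite -(subrr x); apply: HB.
have fB : zmod_morphism f by move=> x y; apply: f_eq; apply: HB.
have fM : monoid_morphism f.
  by split=> [|x y]; apply: f_eq => //; apply: HM.
pose mA := GRing.isZmodMorphism.Build R S f fB.
pose mM := GRing.isMonoidMorphism.Build R S f fM.
pose F : {rmorphism R -> S} := HB.pack f mA mM.
by exists F.
Qed.
End FunctionalRelation.

Section AlgebraModule.
Variables (k R : comNzRingType) (f : {rmorphism k -> R}).

(** The universal property in [is_tensor] speaks of k-modules. This is [R] as a module through [f];
    the morphism is an argument of the type so that different structure maps give different
    modules. *)
Definition alg_mod of {rmorphism k -> R} : Type := R.
HB.instance Definition _ := GRing.Zmodule.on (alg_mod f).
Definition alg_scale (c : k) (x : alg_mod f) : alg_mod f := f c * (x : R).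

Fact alg_scaleA a b v : alg_scale a (alg_scale b v) = alg_scale (a * b) v.
Proof. by rewrite /alg_scale rmorphM mulrA. Qed.
Fact alg_scale1 : left_id 1 alg_scale.
Proof. by move=> v; rewrite /alg_scale rmorph1 mul1r. Qed.
Fact alg_scaleDr : right_distributive alg_scale +%R.
Proof. by move=> a u v; apply: mulrDr. Qed.
Fact alg_scaleDl v : {morph alg_scale^~ v : a b / a + b}.
Proof. by move=> a b; rewrite /alg_scale rmorphD mulrDl. Qed.

HB.instance Definition _ := GRing.Zmodule_isLmodule.Build k (alg_mod f)
  alg_scaleA alg_scale1 alg_scaleDr alg_scaleDl.
End AlgebraModule.

Section Tensor.
Variables (k A B T : comNzRingType) (f : {rmorphism k -> A}) (g : {rmorphism k -> B}).
Variables (i : {rmorphism A -> T}) (j : {rmorphism B -> T}).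
Hypothesis Tt : is_tensor f g i j.

Definition pure_sum (x : T) : Prop :=
  exists s : seq (A * B), x = \sum_(u <- s) i u.1 * j u.2.

Definition pure_pred : {pred T} := fun x => `[< pure_sum x >].

Fact pure_pred_closed : subring_closed pure_pred.
Proof.
split=> [|x y /asboolP[s ->] /asboolP[t ->]|x y /asboolP[s ->] /asboolP[t ->]];
  apply/asboolP.
- by exists [:: (1, 1)]; rewrite big_seq1 !rmorph1 mulr1.
- exists (s ++ [seq (- u.1, u.2) | u <- t]); rewrite big_cat big_map -sumrN.
  by congr (_ + _); apply: eq_bigr => u _; rewrite rmorphN mulNr.
- exists [seq (u.1 * v.1, u.2 * v.2) | u <- s, v <- t].
  rewrite big_allpairs_dep mulr_suml; apply: eq_bigr => u _; rewrite mulr_sumr.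
  by apply: eq_bigr => v _; rewrite !rmorphM mulrACA.
Qed.

HB.instance Definition _ :=
  GRing.isSubringClosed.Build T pure_pred pure_pred_closed.

Fact pure_in a b : i a * j b \in pure_pred.
Proof. by apply/asboolP; exists [:: (a, b)]; rewrite big_seq1. Qed.

Fact pure_inl c : i (f c) \in pure_pred.
Proof. by rewrite -[i _]mulr1 -(rmorph1 j) pure_in. Qed.

(** Sums of pure tensors form a subring, to which the bilinear map (a, b) -> a (x) b lifts. Followed
    by the inclusion, the lift agrees with the identity on pure tensors, so uniqueness in the
    universal property makes it the identity. *)
Lemma tensor_span x : pure_sum x.
Proof.
have [ifg univ] := Tt.
pose fS := subr_lift (f := i \o f) pure_inl.
pose W := alg_mod fS.
pose beta a b : W := Subr (pure_in a b).
have vE (a b : subr pure_pred) : subr_val a = subr_val b -> a = b.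
  by move=> ?; apply: val_inj.
have [] := univ W beta; rewrite /beta.
- by move=> a a' b; apply: vE; rewrite /= rmorphD mulrDl.
- by move=> a b b'; apply: vE; rewrite /= rmorphD mulrDr.
- by move=> c a b; apply: vE; rewrite /= rmorphM mulrA.
- by move=> c a b; apply: vE; rewrite /= rmorphM -ifg mulrCA.
move=> [h [hD hZ hP]] _.
have [] := univ (alg_mod (i \o f)) (fun a b => i a * j b).
- by move=> a a' b; rewrite rmorphD mulrDl.
- by move=> a b b'; rewrite rmorphD mulrDr.
- by move=> c a b; rewrite rmorphM -mulrA.
- by move=> c a b; rewrite rmorphM -ifg mulrCA.
move=> _ uniq; have -> : x = subr_val (h x).
  apply: (uniq id (fun y => subr_val (h y))); split=> //.
  - by move=> y z; rewrite hD.
  - by move=> c y; rewrite hZ.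
  - by move=> a b; rewrite hP.
by case: (h x) => y /= /asboolP.
Qed.

Lemma tensor_ind (P : T -> Prop) : (forall a b, P (i a * j b)) ->
  (forall x y, P x -> P y -> P (x + y)) -> forall x, P x.
Proof.
move=> Pp PD x; have [s ->] := tensor_span x; elim/big_ind: _ => //.
by have := Pp 0 0; rewrite !rmorph0 mulr0.
Qed.

Lemma tensor_hom_eq (S : comNzRingType) (u v : {rmorphism T -> S}) :
  (forall a, u (i a) = v (i a)) -> (forall b, u (j b) = v (j b)) -> u =1 v.
Proof.
move=> ui vj; elim/tensor_ind => [a b|x y ex ey]; first by rewrite !rmorphM ui vj.
by rewrite !rmorphD ex ey.
Qed.

(** The universal property gives only a linear map; multiplicativity follows from additivity and the
    values on pure tensors, which span. *)
Lemma tensor_lift (S : comNzRingType) (u : {rmorphism A -> S})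
    (v : {rmorphism B -> S}) : (forall c, u (f c) = v (g c)) ->
  exists h : {rmorphism T -> S}, forall a b, h (i a * j b) = u a * v b.
Proof.
move=> uv; have [ifg univ] := Tt.
have [] := univ (alg_mod (u \o f)) (fun a b => u a * v b).
- by move=> a a' b; rewrite rmorphD mulrDl.
- by move=> a b b'; rewrite rmorphD mulrDr.
- by move=> c a b; rewrite rmorphM -mulrA.
- by move=> c a b; rewrite rmorphM -uv mulrCA.
move=> [h [hD _ hP]] _.
have h0 : h 0 = 0 by apply: (addrI (h 0)); rewrite -hD !addr0.
have hB : zmod_morphism (h : T -> S).
  by move=> x y; apply: (@addIr S (h y)); rewrite subrK; have := hD (x - y) y;
    rewrite subrK => ->.
have hM : monoid_morphism (h : T -> S).
  split; first by rewrite -[1]mulr1 -{1}(rmorph1 i) -(rmorph1 j) hP !rmorph1 mulr1.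
  elim/tensor_ind => [a b|x y hx hy] z; last by rewrite mulrDl !hD hx hy mulrDl.
  elim/tensor_ind: z => [a' b'|x y hx hy].
    by rewrite mulrACA -!rmorphM !hP !rmorphM mulrACA.
  by rewrite mulrDr !hD hx hy mulrDr.
pose mA := GRing.isZmodMorphism.Build T S h hB.
pose mM := GRing.isMonoidMorphism.Build T S h hM.
pose F : {rmorphism T -> S} := HB.pack (h : T -> S) mA mM.
by exists F.
Qed.

Lemma tensor_liftE (S : comNzRingType) (u : {rmorphism A -> S})
    (v : {rmorphism B -> S}) : (forall c, u (f c) = v (g c)) ->
  exists h : {rmorphism T -> S},
    (forall a, h (i a) = u a) /\ (forall b, h (j b) = v b).
Proof.
move=> uv; have [h hP] := tensor_lift uv; exists h; split=> x.
  by have := hP x 1; rewrite !rmorph1 !mulr1.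
by have := hP 1 x; rewrite !rmorph1 !mul1r.
Qed.
End Tensor.

(** * Gauss norms *)

Section Independence.
Variables (F : finFieldType) (B : comNzRingType) (FB : {rmorphism F -> B}).

Definition indep (I : finType) (b : I -> B) : Prop :=
  forall x : I -> F, \sum_k FB (x k) * b k = 0 -> forall k, x k = 0.

Definition in_span (I : finType) (b : I -> B) (a : B) : Prop :=
  exists y : I -> F, a = \sum_k FB (y k) * b k.

Lemma indep_span (s : seq B) :
  exists m (e : 'I_m -> B), indep e /\ forall b, b \in s -> in_span e b.
Proof.
elim: s => [|b s [m [e [eI es]]]].
  by exists 0%N, (fun=> 0); split=> // x _ [].
case: (pselect (in_span e b)) => [be|nbe].
  by exists m, e; split=> // a; rewrite inE => /predU1P[->|/es].
pose e' (k : 'I_m.+1) := oapp e b (unlift ord0 k).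
have e'E (x : 'I_m.+1 -> F) : \sum_k FB (x k) * e' k =
    FB (x ord0) * b + \sum_k FB (x (lift ord0 k)) * e k.
  rewrite big_ord_recl /e' unlift_none; congr (_ + _).
  by apply: eq_bigr => k _; rewrite liftK.
exists m.+1, e'; split=> [x|a].
  rewrite e'E => x0; have xz : x ord0 = 0.
    apply/eqP/negP => /negP nz; apply: nbe.
    exists (fun k => - (x ord0)^-1 * x (lift ord0 k)).
    under eq_bigr do rewrite rmorphM -mulrA.
    rewrite -mulr_sumr rmorphN mulNr -mulrN.
    move: x0 => /eqP; rewrite addrC addr_eq0 => /eqP ->.
    by rewrite opprK mulrA -rmorphM mulVf // rmorph1 mul1r.
  move: x0; rewrite xz rmorph0 mul0r add0r => /eI xl k.
  by case: (unliftP ord0 k) => [k' ->|->].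
rewrite inE => /predU1P[->|/es[y ->]].
  exists (fun k => (k == ord0)%:R); rewrite e'E eqxx rmorph1 mul1r big1 ?addr0 //.
  by move=> k _; rewrite eq_sym (negbTE (neq_lift _ _)) rmorph0 mul0r.
exists (fun k => oapp y 0 (unlift ord0 k)).
rewrite e'E unlift_none rmorph0 mul0r add0r.
by apply: eq_bigr => k _; rewrite liftK.
Qed.

Variables (C T : comNzRingType) (FC : {rmorphism F -> C}).
Variables (i : {rmorphism B -> T}) (j : {rmorphism C -> T}).
Hypothesis ij : forall c, i (FB c) = j (FC c).

Lemma tensor_coord m (e : 'I_m -> B) (s : seq (B * C)) :
    (forall u, u \in s -> in_span e u.1) ->
  exists x : 'I_m -> C,
    \sum_(u <- s) i u.1 * j u.2 = \sum_k i (e k) * j (x k).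
Proof.
elim: s => [|u s IH] es.
  exists (fun=> 0); rewrite big_nil big1 // => k _; by rewrite rmorph0 mulr0.
have [x xP] := IH (fun v vs => es v (mem_behead (s := u :: s) vs)).
have [y yP] := es u (mem_head _ _).
exists (fun k => FC (y k) * u.2 + x k); rewrite big_cons xP yP.
rewrite raddf_sum mulr_suml -big_split; apply: eq_bigr => k _ /=.
by rewrite rmorphD !rmorphM mulrDr ij; congr (_ + _); rewrite mulrCA -!mulrA.
Qed.

(** One [F]-independent family serves for finitely many tensors at once. Only [F]-combinations of
    the given coefficients are formed, so tensors with coefficients in a subfield get coordinates in
    that subfield. *)
Lemma joint_coord (I : finType) (s : I -> seq (B * C)) (D : seq B) :
  exists m (e : 'I_m -> B) (x : I -> 'I_m -> C),
    [/\ indep e, forall b, b \in D -> in_span e b &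
        forall a, \sum_(u <- s a) i u.1 * j u.2 = \sum_k i (e k) * j (x a k)].
Proof.
pose E := D ++ flatten [seq [seq u.1 | u <- s a] | a <- enum I].
have [m [e [eI eE]]] := indep_span E.
have sE a u : u \in s a -> in_span e u.1.
  move=> us; apply: eE; rewrite mem_cat; apply/orP; right.
  apply/flattenP; exists [seq v.1 | v <- s a]; last exact: map_f.
  by apply: map_f; rewrite mem_enum.
have /choice[x xP] := fun a => tensor_coord (sE a).
by exists m, e, x; split=> // b bD; apply: eE; rewrite mem_cat bD.
Qed.
End Independence.

Section GaussNorm.
Variables (R : realType) (F : finFieldType) (B T : comNzRingType) (C : fieldType).
Variables (FB : {rmorphism F -> B}) (FC : {rmorphism F -> C}) (absC : C -> R).
Variables (i : {rmorphism B -> T}) (j : {rmorphism C -> T}) (N : T -> R).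
Hypotheses (Tt : is_tensor FB FC i j) (absCP : is_abs absC).
Hypothesis NG : is_gauss_norm FB absC i j N.

Let ij c : i (FB c) = j (FC c). Proof. by case: Tt. Qed.

Lemma abs_ge0 c : 0 <= absC c. Proof. by have [[]] := absCP. Qed.
Lemma abs_eq0 c : absC c = 0 <-> c = 0. Proof. by have [[]] := absCP. Qed.
Lemma abs0 : absC 0 = 0. Proof. exact/abs_eq0. Qed.
Lemma absM c c' : absC (c * c') = absC c * absC c'.
Proof. by have [] := absCP. Qed.
Lemma absB c c' : absC (c - c') <= Num.max (absC c) (absC c').
Proof. by have [[]] := absCP. Qed.
Lemma abs1 : absC 1 = 1.
Proof.
have /eqP : absC 1 * absC 1 = absC 1 by rewrite -absM mulr1.
rewrite -subr_eq0 -{3}[absC 1]mulr1 -mulrBr mulf_eq0 subr_eq0 => /orP[|/eqP //].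
by move=> /eqP/abs_eq0/eqP; rewrite oner_eq0.
Qed.
Lemma absN c : absC (- c) = absC c.
Proof.
have le c' : absC (- c') <= absC c'.
  by rewrite -sub0r; apply: le_trans (absB _ _) _; rewrite abs0 ge_max abs_ge0 lexx.
by apply/eqP; rewrite eq_le le -{1}[c]opprK le.
Qed.
Lemma absD c c' : absC (c + c') <= Num.max (absC c) (absC c').
Proof. by rewrite -{1}[c']opprK -(absN c'); apply: absB. Qed.
Lemma absX c n : absC (c ^+ n) = absC c ^+ n.
Proof. by elim: n => [|n IH]; rewrite ?expr0 ?abs1 // !exprS absM IH. Qed.

(** |y|^q = |y| excludes |y| > 1. *)
Lemma abs_Fq y : absC (FC y) <= 1.
Proof.
have yq : absC (FC y) ^+ #|F| = absC (FC y) by rewrite -absX -rmorphXn /= expf_card.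
rewrite leNgt; apply/negP => y1; suff : absC (FC y) < absC (FC y) by rewrite ltxx.
rewrite -[X in _ < X]yq -[X in X < _]expr1.
by rewrite ltr_eXn2l // card_finRing_gt1.
Qed.

Lemma abs_sum (I : finType) (c : I -> C) (M : R) : 0 <= M ->
  (forall k, absC (c k) <= M) -> absC (\sum_k c k) <= M.
Proof.
move=> M0 cM; elim/big_ind: _ => [|x y xM yM|//]; first by rewrite abs0.
by apply: le_trans (absD _ _) _; rewrite ge_max xM.
Qed.

Lemma gaussE (I : finType) (b : I -> B) (c : I -> C) : indep FB b ->
  N (\sum_k i (b k) * j (c k)) = \big[Num.max/0]_k absC (c k).
Proof.
move=> bI; rewrite (reindex (@enum_val I (mem I))) /=; last first.
  exact/onW_bij/enum_val_bij.
rewrite [RHS](reindex (@enum_val I (mem I))) /=; last first.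
  exact/onW_bij/enum_val_bij.
apply: NG => x x0 k.
rewrite -[k]enum_valK -[enum_rank _]/((fun a => enum_rank a) (enum_val k)).
apply: (bI (fun a => x (enum_rank a))); rewrite -[RHS]x0.
rewrite (reindex (@enum_val I (mem I))) /=; last exact/onW_bij/enum_val_bij.
by apply: eq_bigr => l _; rewrite enum_valK.
Qed.

Lemma gauss0 : N 0 = 0.
Proof.
have := @NG 0%N (fun=> 0) (fun=> 0); rewrite !big_ord0; apply.
by move=> x _ [].
Qed.

Lemma gauss_indep0 (I : finType) (b : I -> B) (c : I -> C) : indep FB b ->
  \sum_k i (b k) * j (c k) = 0 -> forall k, c k = 0.
Proof.
move=> bI s0 k; apply/abs_eq0/eqP; rewrite eq_le abs_ge0 andbT.
by rewrite -gauss0 -s0 gaussE // le_bigmax.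
Qed.

Lemma gauss_rep (I : finType) (z : I -> T) :
  exists m (e : 'I_m -> B) (x : I -> 'I_m -> C),
    indep FB e /\ forall a, z a = \sum_k i (e k) * j (x a k).
Proof.
have /choice[s sP] := fun a => tensor_span Tt (z a).
have [m [e [x [eI _ ex]]]] := joint_coord ij s [::].
by exists m, e, x; split=> // a; rewrite sP ex.
Qed.

Lemma gauss_rep1 z : exists m (e : 'I_m -> B) (x : 'I_m -> C),
  indep FB e /\ z = \sum_k i (e k) * j (x k).
Proof.
by have [m [e [x [eI ex]]]] := gauss_rep (fun _ : unit => z);
  exists m, e, (x tt); split=> //; apply: ex tt.
Qed.

Lemma gauss_ge0 z : 0 <= N z.
Proof.
by have [m [e [x [eI ->]]]] := gauss_rep1 z; rewrite gaussE // bigmax_ge_id.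
Qed.

Lemma gauss_eq0 z : N z = 0 -> z = 0.
Proof.
have [m [e [x [eI ->]]]] := gauss_rep1 z; rewrite gaussE // => N0.
rewrite big1 // => k _; suff -> : x k = 0 by rewrite rmorph0 mulr0.
apply/abs_eq0/eqP; rewrite eq_le abs_ge0 andbT -N0; exact: le_bigmax.
Qed.

Lemma gaussB z z' : N (z - z') <= Num.max (N z) (N z').
Proof.
have [m [e [x [eI ex]]]] := gauss_rep (fun b : bool => if b then z else z').
have /= -> := ex true; have /= -> := ex false.
have -> : \sum_k i (e k) * j (x true k) - \sum_k i (e k) * j (x false k) =
    \sum_k i (e k) * j (x true k - x false k).
  by rewrite -sumrB; apply: eq_bigr => k _; rewrite rmorphB mulrBr.
rewrite !gaussE //; apply/bigmax_leP; split=> [|k _].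
  by rewrite le_max bigmax_ge_id.
by apply: le_trans (absB _ _) _; rewrite ge_max !le_max !le_bigmax orbT.
Qed.

Lemma gaussD z z' : N (z + z') <= Num.max (N z) (N z').
Proof.
have NN : N (- z') <= N z'.
  by rewrite -sub0r; apply: le_trans (gaussB _ _) _; rewrite gauss0 ge_max gauss_ge0 lexx.
rewrite -[z']opprK; apply: le_trans (gaussB _ _) _.
by rewrite opprK ge_max !le_max lexx /= NN orbT.
Qed.

(** Without independence the maximum is only an upper bound: the d_k are expanded on an independent
    family, and the new coefficients are combinations of the c_k with scalars of absolute value at
    most 1. *)
Lemma gauss_le (I : finType) (d : I -> B) (c : I -> C) (M : R) : 0 <= M ->
  (forall k, absC (c k) <= M) -> N (\sum_k i (d k) * j (c k)) <= M.
Proof.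
move=> M0 cM; have [m [e [eI eE]]] := indep_span FB [seq d k | k <- enum I].
have dE k : in_span FB e (d k) by apply: eE; apply: map_f; rewrite mem_enum.
have [y yE] := choice dE.
have -> : \sum_k i (d k) * j (c k) =
    \sum_l i (e l) * j (\sum_k FC (y k l) * c k).
  under [RHS]eq_bigr do rewrite raddf_sum mulr_sumr.
  rewrite exchange_big; apply: eq_bigr => k _ /=.
  rewrite yE raddf_sum mulr_suml; apply: eq_bigr => l _ /=.
  by rewrite !rmorphM ij mulrCA mulrA.
rewrite gaussE //; apply/bigmax_leP; split=> // l _.
apply: abs_sum => // k; rewrite absM; apply: le_trans (cM k).
by rewrite ler_piMl ?abs_ge0 ?abs_Fq.
Qed.

Lemma gaussMl b z : N (i b * z) <= N z.
Proof.
have [m [e [x [eI ->]]]] := gauss_rep1 z.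
rewrite mulr_sumr; under eq_bigr do rewrite mulrA -rmorphM.
apply: gauss_le => [|k]; first by rewrite gauss_ge0.
by rewrite gaussE // le_bigmax.
Qed.

Lemma gauss_sum (I : finType) (z : I -> T) (M : R) : 0 <= M ->
  (forall k, N (z k) <= M) -> N (\sum_k z k) <= M.
Proof.
move=> M0 zM; elim/big_ind: _ => [|x y xM yM|//]; first by rewrite gauss0.
by apply: le_trans (gaussD _ _) _; rewrite ge_max xM.
Qed.

Lemma gauss_inj b : i b = 0 -> b = 0.
Proof.
move=> b0; apply/eqP/negP => /negP nb.
have bI : indep FB (fun _ : 'I_1 => b).
  move=> x; rewrite big_ord1 => xb k; rewrite (ord1 k).
  apply/eqP/negP => /negP nx; move/negP: nb; apply; apply/eqP.
  by rewrite -[b]mul1r -(rmorph1 FB) -(mulVf nx) rmorphM -mulrA xb mulr0.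
have := @gauss_indep0 _ _ (fun=> 1) bI.
by rewrite big_ord1 b0 mul0r => /(_ erefl ord0)/eqP; rewrite oner_eq0.
Qed.
End GaussNorm.

(** * Frobenius systems and separability *)

Section Frobenius.
Variable F : finFieldType.

Lemma frob_card : exists p n, [/\ p \in [pchar F], #|F| = (p ^ n)%N & (0 < n)%N].
Proof.
have [p p_pr pF] := finPcharP F; exists p.
have [n qE] : exists n, #|F| = (p ^ n)%N.
  by eexists; apply: (card_pprimeChar pF).
exists n; split=> //; case: n qE => // qE.
by have := card_finRing_gt1 F; rewrite qE.
Qed.

Lemma frob_nat0 (R : nzRingType) (f : {rmorphism F -> R}) n : (0 < n)%N ->
  ((#|F| ^ n)%N)%:R = 0 :> R.
Proof.
move=> n0; have [p [m [pF qE m0]]] := frob_card.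
rewrite -(rmorph_nat f) qE -expnM natrX (pcharf0 pF) expr0n.
by rewrite muln_eq0 -!leqn0 leqNgt m0 leqNgt n0 rmorph0.
Qed.

Lemma frobenius (R : comNzRingType) (f : {rmorphism F -> R}) :
  exists s : {rmorphism R -> R}, forall x, s x = x ^+ #|F|.
Proof.
pose s (x : R) := x ^+ #|F|.
have sD x y : s (x + y) = s x + s y.
  rewrite /s exprDn_pchar //; have [p [n [pF -> _]]] := frob_card.
  by rewrite pnatX pnatE ?(pcharf_prime pF) // (rmorph_pchar f pF).
have sB : zmod_morphism s.
  by move=> x y; apply: (addIr (s y)); rewrite -sD !subrK.
have sM : monoid_morphism s.
  by split=> [|x y]; rewrite /s ?expr1n // exprMn.
pose mA := GRing.isZmodMorphism.Build R R s sB.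
pose mM := GRing.isMonoidMorphism.Build R R s sM.
pose S : {rmorphism R -> R} := HB.pack s mA mM.
by exists S.
Qed.

Lemma frob_fixed (C : idomainType) (f : {rmorphism F -> C}) (c : C) :
  c ^+ #|F| = c -> exists y, c = f y.
Proof.
move=> cq; have /(congr1 (fun P => (map_poly f P).[c])) := finField_genPoly F.
rewrite rmorphB /= map_polyXn map_polyX !hornerE cq subrr.
rewrite rmorph_prod horner_prod => /esym/eqP; rewrite prodf_seq_eq0.
case/hasP=> y _ /=; rewrite rmorphB /= map_polyX map_polyC !hornerE subr_eq0.
by move/eqP; exists y.
Qed.
End Frobenius.

Section SeparableSolutions.
Variables (F : finFieldType) (L C : fieldType).
Variables (FL : {rmorphism F -> L}) (LC : {rmorphism L -> C}).
Local Notation q := #|F|.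
Local Notation frobmx := (map_mx (fun c => c ^+ q)).

(** If c D = 0 then c y = c D y^(q) = 0, with y^(q) the entrywise power, so D is invertible and
    y^(q) = D^-1 y. Hence each y_i^(q^s) is an L-linear form c_s in y, and the first dependence
    among the c_s gives an additive polynomial over L vanishing at y_i. Minimality makes its linear
    coefficient nonzero, so its derivative is a nonzero constant. *)
Lemma sep_solutions_indep k (y : 'cV[C]_k) (D : 'M[L]_k) :
    y = map_mx LC D *m frobmx y ->
    (forall c : 'rV[L]_k, map_mx LC c *m y = 0 -> c = 0) ->
  forall i, exists2 P : {poly L}, separable_poly P & root (map_poly LC P) (y i 0).
Proof.
move=> yD yI i.
have [phi phiE] := frobenius FL.
have [phiC phiCE] := frobenius (LC \o FL).
have frobE m n (A : 'M[C]_(m, n)) : frobmx A = map_mx phiC A.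
  by apply/matrixP => a b; rewrite !mxE phiCE.
have phiLC m n (A : 'M[L]_(m, n)) : map_mx phiC (map_mx LC A) = map_mx LC (map_mx phi A).
  by apply/matrixP => a b; rewrite !mxE phiCE phiE rmorphXn.
have Dunit : D \in unitmx.
  rewrite -row_free_unit; apply: inj_row_free => c cD; apply: yI.
  by rewrite yD mulmxA -map_mxM cD map_mx0 mul0mx.
have yq : map_mx phiC y = map_mx LC (invmx D) *m y.
  by rewrite {2}yD mulmxA -map_mxM mulVmx // map_mx1 mul1mx frobE.
pose c s : 'rV[L]_k := iter s (fun c => map_mx phi c *m invmx D) (delta_mx 0 i).
have cy s : map_mx LC (c s) *m y = (y i 0 ^+ (q ^ s))%:M.
  elim: s => [|s IH] /=.
    rewrite map_delta_mx -rowE expr1; apply/matrixP => a b.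
    by rewrite !ord1 !mxE.
  rewrite map_mxM -mulmxA -yq -phiLC -map_mxM IH map_scalar_mx /= phiCE.
  by rewrite -exprM expnSr.
pose R m : 'M[L]_(m, k) := \matrix_(s < m) c s.
have exR : exists m, ~~ row_free (R m).
  exists k.+1; rewrite /row_free neq_ltn.
  by rewrite (leq_ltn_trans (rank_leq_col _)).
case: (ex_minnP exR) => [[|m] nfree min_m].
  by case/negP: nfree; rewrite /row_free eqn_leq rank_leq_row.
have free_m : row_free (R m) by apply: contraT => /min_m; rewrite ltnn.
have [a /sub_kermxP aR a0] : exists2 a : 'rV_m.+1, (a <= kermx (R m.+1))%MS & a != 0.
  by apply/rowV0Pn; rewrite kermx_eq0.
have aRs : \sum_(s < m.+1) a 0 s *: c s = 0.
  move: aR; rewrite mulmx_sum_row => aR; rewrite -[RHS]aR.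
  by apply: eq_bigr => s _; rewrite rowK.
(* If a_0 = 0, then c_(s+1) = c_s^(q) D^-1 turns the relation into one among the Frobenius images of
   c_0, ..., c_(m-1); Frobenius preserves the rank of [R m], so these rows are independent. *)
have a00 : a 0 0 != 0.
  apply: contraNneq a0 => a00; move: aRs; rewrite big_ord_recl a00 scale0r add0r.
  pose a' : 'rV_m := \row_s a 0 (lift ord0 s).
  have -> : \sum_(s < m) a 0 (lift ord0 s) *: c (lift ord0 s) =
      a' *m map_mx phi (R m) *m invmx D.
    rewrite (mulmx_sum_row a') mulmx_suml; apply: eq_bigr => s _.
    by rewrite -map_row rowK mxE -scalemxAl.
  move/(congr1 (mulmx^~ D)); rewrite mulmxKV // mul0mx => a'0.
  have /(row_free_inj (A := map_mx phi (R m))) : row_free (map_mx phi (R m)).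
    by rewrite row_free_map.
  move/(_ _ a' 0); rewrite mul0mx => /(_ a'0) a'z.
  apply/eqP/rowP => s; rewrite mxE; case: (unliftP ord0 s) => [s' ->|->//].
  by have /rowP/(_ s') := a'z; rewrite !mxE.
exists (\sum_(s < m.+1) a 0 s *: 'X^(q ^ s)).
  rewrite unlock; suff -> : (\sum_(s < m.+1) a 0 s *: 'X^(q ^ s))^`() =
      a 0 0 *: 1 by rewrite coprimepZr // coprimep1.
  rewrite raddf_sum /= big_ord_recl /= big1 ?addr0 => [|s _].
    by rewrite derivZ derivXn expn0 expr0 mulr1n.
  rewrite /= derivZ derivXn -mulr_natr (frob_nat0 (polyC \o FL)) //.
  by rewrite mulr0 scaler0.
rewrite /root rmorph_sum horner_sum; apply/eqP.
transitivity ((\sum_(s < m.+1) LC (a 0 s) *: (map_mx LC (c s) *m y)) 0 0).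
  rewrite summxE; apply: eq_bigr => s _ /=.
  by rewrite map_polyZ map_polyXn hornerZ hornerXn cy !mxE eqxx mulr1n.
under eq_bigr do rewrite scalemxAl -map_mxZ.
by rewrite -mulmx_suml -map_mx_sum aRs map_mx0 mul0mx mxE.
Qed.

Variables (Ls : fieldType) (LLs : {rmorphism L -> Ls}) (LsC : {rmorphism Ls -> C}).
Hypothesis LsCE : forall x, LsC (LLs x) = LC x.
Hypothesis Ls_sep : forall z (P : {poly L}), separable_poly P ->
  root (map_poly LC P) z -> exists x, LsC x = z.

(* Among the matrices fixing [x], one of minimal rank replaces [x] by a vector
   with linearly independent entries over [L]. *)
Lemma sep_solutions_mx n (x : 'cV[C]_n) (B : 'M[L]_n) :
  x = map_mx LC B *m frobmx x -> forall i, exists s, LsC s = x i 0.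
Proof.
move=> xB.
pose rk m := `[< exists2 A : 'M[L]_n, map_mx LC A *m x = x & \rank A = m >].
have exA : exists m, rk m.
  exists (\rank (1%:M : 'M[L]_n)); apply/asboolP; exists 1%:M => //.
  by rewrite map_mx1 mul1mx.
case: (ex_minnP exA) => k /asboolP[A xA rA] min_k.
have [cb [rb cbrb]] : exists (cb : 'M_(n, \rank A)) (rb : 'M_(\rank A, n)), cb *m rb = A.
  by exists (col_base A), (row_base A); apply: mulmx_base.
pose y := map_mx LC rb *m x.
have xy : x = map_mx LC cb *m y.
  by rewrite mulmxA -map_mxM cbrb xA.
have [phiC phiCE] := frobenius (LC \o FL).
have [phi phiE] := frobenius FL.
have frobE m m' (D : 'M[C]_(m, m')) : frobmx D = map_mx phiC D.
  by apply/matrixP => a b; rewrite !mxE phiCE.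
have phiLC m m' (D : 'M[L]_(m, m')) : map_mx phiC (map_mx LC D) = map_mx LC (map_mx phi D).
  by apply/matrixP => a b; rewrite !mxE phiCE phiE rmorphXn.
have yD : y = map_mx LC (rb *m B *m map_mx phi cb) *m frobmx y.
  have xq : map_mx phiC (map_mx LC cb) *m map_mx phiC y = map_mx phiC x.
    by rewrite -map_mxM -xy.
  by rewrite !map_mxM -!mulmxA -phiLC frobE xq -frobE -xB.
have yI (c : 'rV[L]_(\rank A)) : map_mx LC c *m y = 0 -> c = 0.
  move=> cy; apply/eqP; apply/negP => /negP c0.
  have /row_freeP[d cd] : row_free c by rewrite /row_free rank_rV c0.
  (* As c y = 0, [P] fixes y, so cb P rb still fixes x; but P d = 0 with d nonzero makes [P]
     singular, which lowers the rank against the choice of [A]. *)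
  pose P : 'M_(\rank A) := 1%:M - d *m c.
  have Pd : P *m d = 0 by rewrite mulmxBl mul1mx -mulmxA cd mulmx1 subrr.
  have rP : (\rank P < \rank A)%N.
    rewrite ltn_neqAle rank_leq_row andbT; apply: contraNneq c0 => rP.
    have /row_freeP[P' P'P] : row_free P^T.
      by rewrite /row_free mxrank_tr rP.
    have : P'^T *m P *m d = 0 by rewrite -mulmxA Pd mulmx0.
    rewrite -[P]trmxK -trmx_mul P'P trmx1 mul1mx => d0.
    move: cd; rewrite d0 mulmx0 => /matrixP/(_ 0 0); rewrite !mxE eqxx.
    by move/eqP; rewrite eq_sym oner_eq0.
  have rk1 : (\rank (cb *m P *m rb) < \rank A)%N.
    exact: leq_ltn_trans (leq_trans (mxrankM_maxl _ _) (mxrankM_maxr _ _)) rP.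
  suff /min_k : rk (\rank (cb *m P *m rb)) by rewrite -rA leqNgt rk1.
  apply/asboolP; exists (cb *m P *m rb) => //.
  rewrite !map_mxM -!mulmxA -/y map_mxB map_mx1 mulmxBl mul1mx map_mxM -mulmxA cy.
  by rewrite mulmx0 subr0 -xy.
have ys j : exists s, LsC s = y j 0.
  by have [P sP rP] := sep_solutions_indep yD yI j; apply: Ls_sep rP.
have /choice[s sE] := ys.
move=> i.
exists (\sum_j LLs (cb i j) * s j).
rewrite xy mxE rmorph_sum; apply: eq_bigr => j _.
by rewrite rmorphM LsCE sE; congr (_ * _); rewrite mxE.
Qed.

Lemma sep_solutions (I : finType) (x : I -> C) (B : I -> I -> L) :
  (forall a, x a = \sum_b LC (B a b) * x b ^+ q) ->
  forall a, exists s, LsC s = x a.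
Proof.
move=> xB a; pose X : 'cV_#|I| := \col_k x (enum_val k).
pose BB : 'M_#|I| := \matrix_(k, l) B (enum_val k) (enum_val l).
have XB : X = map_mx LC BB *m frobmx X.
  apply/colP => k; rewrite !mxE xB (reindex (@enum_val I (mem I))) /=.
    by apply: eq_bigr => l _; rewrite !mxE.
  exact/onW_bij/enum_val_bij.
have [s sE] := sep_solutions_mx XB (enum_rank a).
by exists s; rewrite sE mxE enum_rankK.
Qed.
End SeparableSolutions.

(** * Completions of A (x) F at p *)

Section InverseLimit.
Variables (T : nat -> comNzRingType) (tr : forall n, {rmorphism T n.+1 -> T n}).
Variables (V : comNzRingType) (pr : forall n, {rmorphism V -> T n}).
Hypothesis Vlim : is_invlim tr pr.

Lemma invlim_eq z z' : (forall n, pr n z = pr n z') -> z = z'.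
Proof.
move=> zz'; have [trP /(_ (fun n => pr n z'))] := Vlim.
by move=> /(_ (fun n => trP n z'))[w [_ uw]]; rewrite -(uw z) // -(uw z').
Qed.

Lemma invlim_lift (V' : comNzRingType) (h : forall n, {rmorphism V' -> T n}) :
    (forall n z, tr n (h n.+1 z) = h n z) ->
  exists g : {rmorphism V' -> V}, forall n z, pr n (g z) = h n z.
Proof.
move=> hT; have ex z : exists w, forall n, pr n w = h n z.
  have [_ /(_ (fun n => h n z) (fun n => hT n z))[w [wP _]]] := Vlim.
  by exists w.
have [|||||g gP] := @rmorph_of_rel V' V (fun z w => forall n, pr n w = h n z).
- exact: ex.
- by move=> w w0; apply: invlim_eq => n; rewrite w0 !rmorph0.
- by move=> n; rewrite !rmorph1.
- by move=> x x' y y' xx' yy' n; rewrite !rmorphB xx' yy'.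
- by move=> x x' y y' xx' yy' n; rewrite !rmorphM xx' yy'.
exists g => n z; have [w wP] := ex z; by rewrite (gP z w wP) wP.
Qed.

Lemma invlim_le0 m n z : (n <= m)%N -> pr m z = 0 -> pr n z = 0.
Proof.
have [trP _] := Vlim.
move=> /subnK <-; elim: (m - n)%N => // d IH; rewrite addSn => z0.
by apply: IH; rewrite -trP z0 rmorph0.
Qed.
End InverseLimit.

HB.instance Definition _ (X : curve) (Y : coefficients X) :=
  GRing.RMorphism.copy (@FqL X Y) (KL Y \o FqK X).
HB.instance Definition _ (X : curve) (Y : coefficients X) :=
  GRing.RMorphism.copy (@FqLsep X Y) (LLsep Y \o @FqL X Y).
HB.instance Definition _ (X : curve) (Y : coefficients X) :=
  GRing.RMorphism.copy (@FqC X Y) (KC Y \o FqK X).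

Arguments pT_l {X p F FqF} _ _.
Arguments pT_r {X p F FqF} _ _.
Arguments pT_tr {X p F FqF} _ _.
Arguments pZ_pr {X p F FqF} _ _.

Lemma to_quo_surj (A : comNzRingType) (p : prime_idealr A) n (b : quo p n) :
  exists a, b = to_quo p n a.
Proof. by exists (repr b); rewrite /to_quo reprK. Qed.

Section PadicMaps.
Variables (X : curve) (p : prime_idealr (AA X)).
Local Notation Fq := (Fq X).

Section OneField.
Variables (F : fieldType) (f : {rmorphism Fq -> F}) (P : @padic X p F f).

Definition FqQuo n : {rmorphism Fq -> quo p n} := to_quo p n \o FqA X.

Lemma pT_is_tensor n : is_tensor (FqQuo n) f (pT_l P n) (pT_r P n).
Proof. exact: pT_tensor. Qed.

Lemma pT_compat n c : pT_l P n (FqQuo n c) = pT_r P n (f c).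
Proof. by case: (pT_is_tensor n). Qed.
End OneField.

Section TwoFields.
Variables (F1 F2 : fieldType) (f1 : {rmorphism Fq -> F1}) (f2 : {rmorphism Fq -> F2}).
Variables (P1 : @padic X p F1 f1) (P2 : @padic X p F2 f2).

Lemma pT_tr_nat (s : F1 -> F2) n (g : {rmorphism pT P1 n -> pT P2 n})
    (g' : {rmorphism pT P1 n.+1 -> pT P2 n.+1}) :
    (forall b x, g (pT_l P1 n b * pT_r P1 n x) = pT_l P2 n b * pT_r P2 n (s x)) ->
    (forall b x, g' (pT_l P1 n.+1 b * pT_r P1 n.+1 x) =
       pT_l P2 n.+1 b * pT_r P2 n.+1 (s x)) ->
  forall z, pT_tr P2 n (g' z) = g (pT_tr P1 n z).
Proof.
move=> gE g'E; elim/(tensor_ind (pT_is_tensor P1 n.+1)) => [b x|x y ex ey].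
  by have [a ->] := to_quo_surj b; rewrite g'E !pT_trE gE.
by rewrite !rmorphD ex ey.
Qed.

Lemma padic_lift (s : {rmorphism F1 -> F2}) : (forall c, s (f1 c) = f2 c) ->
  exists g : {rmorphism pZ P1 -> pZ P2}, padic_induced s g.
Proof.
move=> sf; have ex n : exists gn : {rmorphism pT P1 n -> pT P2 n},
    forall b x, gn (pT_l P1 n b * pT_r P1 n x) = pT_l P2 n b * pT_r P2 n (s x).
  apply: (tensor_lift (pT_is_tensor P1 n) (u := pT_l P2 n) (v := pT_r P2 n \o s)).
  by move=> c; rewrite /= sf; apply: pT_compat.
pose gn n := projT1 (cid (ex n)).
have gnE n b x : gn n (pT_l P1 n b * pT_r P1 n x) = pT_l P2 n b * pT_r P2 n (s x).
  by rewrite /gn; case: cid.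
have [|g gP] := invlim_lift (pZ_lim P2) (h := fun n => gn n \o pZ_pr P1 n).
  move=> n z; rewrite /= (pT_tr_nat (gnE n) (gnE n.+1)).
  by have [-> _] := pZ_lim P1.
by exists g => n; exists (gn n).
Qed.

Lemma padic_induced_eq (s s' : F1 -> F2) (g g' : pZ P1 -> pZ P2) : s =1 s' ->
  padic_induced s g -> padic_induced s' g' -> g =1 g'.
Proof.
move=> ss' gs gs' z; apply: (invlim_eq (pZ_lim P2)) => n.
have [gn [gnE ->]] := gs n; have [gn' [gnE' ->]] := gs' n.
elim/(tensor_ind (pT_is_tensor P1 n)): (pZ_pr P1 n z) => [b x|x y ex ey].
  by rewrite gnE gnE' ss'.
by rewrite !rmorphD ex ey.
Qed.
End TwoFields.

Lemma padic_induced_comp (F1 F2 F3 : fieldType) (f1 : {rmorphism Fq -> F1})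
    (f2 : {rmorphism Fq -> F2}) (f3 : {rmorphism Fq -> F3})
    (P1 : @padic X p F1 f1) (P2 : @padic X p F2 f2) (P3 : @padic X p F3 f3)
    (s : F1 -> F2) (s' : F2 -> F3) (g : pZ P1 -> pZ P2) (g' : pZ P2 -> pZ P3) :
  padic_induced s g -> padic_induced s' g' -> padic_induced (s' \o s) (g' \o g).
Proof.
move=> gs gs' n; have [gn [gnE gP]] := gs n; have [gn' [gnE' gP']] := gs' n.
exists (gn' \o gn); split=> [b x|z] /=; first by rewrite gnE gnE'.
by rewrite gP' gP.
Qed.

Section Normed.
Variables (R : realType) (C : fieldType) (absC : C -> R) (fC : {rmorphism Fq -> C}).
Variables (PC : @padic X p C fC).
Hypothesis absP : is_abs absC.
Hypothesis PN : forall n, exists N : pT PC n -> R,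
  is_gauss_norm (FqQuo n) absC (pT_l PC n) (pT_r PC n) N.

Lemma pT_indep0 n (I : finType) (b : I -> quo p n) (c : I -> C) :
  indep (FqQuo n) b -> \sum_k pT_l PC n (b k) * pT_r PC n (c k) = 0 ->
  forall k, c k = 0.
Proof.
by have [N NP] := PN n; apply: (gauss_indep0 absP NP).
Qed.

Lemma pT_l_inj n : injective (pT_l PC n).
Proof.
have [N NP] := PN n => b b' bb'; apply/subr0_eq/(gauss_inj absP NP).
by rewrite rmorphB bb' subrr.
Qed.

Variables (F : fieldType) (f : {rmorphism Fq -> F}) (P : @padic X p F f).
Variable s : {rmorphism F -> C}.

(** In coordinates on an Fq-independent family of A/p^(n+1), the image vanishes only if the images
    of all coefficients do, by the Gauss norm on the target, and [s] is injective as a morphism of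
    fields. *)
Lemma pT_map_inj n (g : {rmorphism pT P n -> pT PC n}) :
    (forall b x, g (pT_l P n b * pT_r P n x) = pT_l PC n b * pT_r PC n (s x)) ->
  injective g.
Proof.
move=> gE; suff g0 z : g z = 0 -> z = 0.
  by move=> x y xy; apply/subr0_eq/g0; rewrite rmorphB xy subrr.
have [u ->] := tensor_span (pT_is_tensor P n) z.
have [m [e [x [eI _ /(_ tt) ->]]]] :=
  joint_coord (pT_compat P n) (fun _ : unit => u) [::].
rewrite rmorph_sum; under eq_bigr do rewrite gE.
move=> /(pT_indep0 eI) sx0; rewrite big1 // => k _.
have /eqP := sx0 k; rewrite fmorph_eq0 => /eqP ->; by rewrite rmorph0 mulr0.
Qed.

Lemma padic_inj (g : pZ P -> pZ PC) : padic_induced s g -> injective g.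
Proof.
move=> gs x y xy; apply: (invlim_eq (pZ_lim P)) => n.
have [gn [gnE gP]] := gs n; apply: (pT_map_inj gnE); by rewrite -!gP xy.
Qed.

(** The element is defined over [F]. Representatives are chosen at each level separately, so that
    the condition can be checked one power of p at a time; their compatibility comes back in
    [rational_lift] from injectivity. *)
Definition rational (z : pZ PC) : Prop := forall n, exists u : seq (quo p n * F),
  pZ_pr PC n z = \sum_(v <- u) pT_l PC n v.1 * pT_r PC n (s v.2).

Lemma rational_lift (g : pZ P -> pZ PC) : padic_induced s g ->
  forall z, rational z -> exists w, g w = z.
Proof.
move=> gs z zr.
have gs' n : exists gn : {rmorphism pT P n -> pT PC n},
    (forall b x, gn (pT_l P n b * pT_r P n x) = pT_l PC n b * pT_r PC n (s x)) /\
    exists w, gn w = pZ_pr PC n z.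
  have [gn [gnE _]] := gs n; exists gn; split=> //; have [u ->] := zr n.
  exists (\sum_(v <- u) pT_l P n v.1 * pT_r P n v.2).
  by rewrite rmorph_sum; apply: eq_bigr => v _; rewrite gnE.
pose gn n := projT1 (cid (gs' n)).
have gnE n b x : gn n (pT_l P n b * pT_r P n x) = pT_l PC n b * pT_r PC n (s x).
  by rewrite /gn; case: cid => ? [].
have ex n : exists w, gn n w = pZ_pr PC n z by rewrite /gn; case: cid => ? [].
pose w n := projT1 (cid (ex n)).
have wE n : gn n (w n) = pZ_pr PC n z by rewrite /w; case: cid.
have [_ /(_ w)[|v [vP _]]] := pZ_lim P.
  move=> n; apply: (pT_map_inj (gnE n)).
  rewrite -(pT_tr_nat (gnE n) (gnE n.+1)) !wE.
  by have [-> _] := pZ_lim PC.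
exists v; apply: (invlim_eq (pZ_lim PC)) => n.
have [g' [g'E ->]] := gs n; rewrite -wE vP.
elim/(tensor_ind (pT_is_tensor P n)): (w n) => [b x|x y ex' ey].
  by rewrite g'E gnE.
by rewrite !rmorphD ex' ey.
Qed.
End Normed.

(** By injectivity at each level, z itself is a sum of pure tensors with coefficients from [L], on
    which gamma acts trivially. *)
Lemma rational_fixed (R : realType) (C : fieldType) (absC : C -> R)
    (fC : {rmorphism Fq -> C}) (PC : @padic X p C fC) (absP : is_abs absC)
    (PN : forall n, exists N : pT PC n -> R,
       is_gauss_norm (FqQuo n) absC (pT_l PC n) (pT_r PC n) N)
    (L F : fieldType) (f : {rmorphism Fq -> F}) (P : @padic X p F f)
    (s : {rmorphism F -> C}) (l : {rmorphism L -> F}) (h : pZ P -> pZ PC)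
    (gamma : F -> F) (g : pZ P -> pZ P) :
    padic_induced s h -> padic_induced gamma g ->
    (forall x, gamma (l x) = l x) ->
  forall z, rational (s \o l) (h z) -> g z = z.
Proof.
move=> hs gg gl z zr; apply: (invlim_eq (pZ_lim P)) => n.
have [gn [gnE ->]] := gg n; have [hn [hnE hP]] := hs n; have [u zu] := zr n.
have -> : pZ_pr P n z = \sum_(v <- u) pT_l P n v.1 * pT_r P n (l v.2).
  apply: (pT_map_inj absP PN hnE); rewrite -hP zu rmorph_sum.
  by apply: eq_bigr => v _; rewrite hnE.
by rewrite rmorph_sum; apply: eq_bigr => v _; rewrite gnE gl.
Qed.
End PadicMaps.

(** * Approximation in localizations *)

Section Krull.
Variable S : comNzRingType.

Definition is_ideal (J : S -> Prop) : Prop :=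
  [/\ J 0, forall x y, J x -> J y -> J (x + y) & forall a x, J x -> J (a * x)].

Lemma krull (J : S -> Prop) : is_ideal J -> ~ J 1 ->
  exists q : prime_idealr S, forall x, J x -> x \in q.
Proof.
move=> [J0 JD JM] J1.
pose T := {I : S -> Prop | [/\ is_ideal I, ~ I 1 & forall x, J x -> I x]}.
have t0 : T by exists J; split.
pose leT (I I' : T) : bool := `[< forall x, sval I x -> sval I' x >].
have [|||t Mmax] := @classical_sets.ZL_preorder T t0 leT.
- by move=> I; apply/asboolP.
- by move=> I1 I2 I3 /asboolP l1 /asboolP l2; apply/asboolP => x /l1/l2.
- move=> A Atot; case: (pselect (exists I, A I)) => [[I0 AI0]|nA]; last first.
    by exists t0 => I AI; case: nA; exists I.
  pose U x := exists2 I, A I & sval I x.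
  have UP : [/\ is_ideal U, ~ U 1 & forall x, J x -> U x].
    split; [split | |].
    - by exists I0 => //; case: (svalP I0) => [[]].
    - move=> x y [I AI Ix] [I' AI' I'y].
      have [/asboolP le|/asboolP le] := Atot I I' AI AI'.
        by exists I' => //; case: (svalP I') => [[_ D _] _ _]; apply: D => //; apply: le.
      by exists I => //; case: (svalP I) => [[_ D _] _ _]; apply: D => //; apply: le.
    - by move=> a x [I AI Ix]; exists I => //; case: (svalP I) => [[_ _ D] _ _]; apply: D.
    - by move=> [I AI I1]; case: (svalP I) => _ + _; apply.
    - by move=> x Jx; exists I0 => //; case: (svalP I0) => _ _; apply.
  by exists (exist _ U UP) => I AI; apply/asboolP => x Ix; exists I.
have [[M0 MD MM] M1 JM'] := svalP t; pose M := sval t.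
pose mpred : {pred S} := fun x => `[< M x >].
have mI : idealr_closed mpred.
  split; first exact/asboolP.
    by apply/negP => /asboolP.
  by move=> a x y /asboolP Mx /asboolP My; apply/asboolP/MD => //; apply: MM.
have mP : prime_idealr_closed mpred.
  move=> u v /asboolP Muv; apply/orP; case: (pselect (M u)) => Mu.
    by left; apply/asboolP.
  right; apply/asboolP.
  pose I x := exists m s, M m /\ x = m + u * s.
  case: (pselect (I 1)) => [[m [s [Mm e1]]]|I1].
    rewrite -[v]mulr1 e1 mulrDr; apply: MD; first exact: MM.
    by rewrite mulrA mulrC [v * u]mulrC; apply: MM.
  have IP : [/\ is_ideal I, ~ I 1 & forall x, J x -> I x].
    split=> //; last by move=> x /JM' Mx; exists x, 0; rewrite mulr0 addr0.
    split.
    - by exists 0, 0; rewrite mulr0 addr0.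
    - move=> x y [m [s [Mm ->]]] [m' [s' [Mm' ->]]]; exists (m + m'), (s + s').
      by split; [apply: MD | rewrite mulrDr addrACA].
    - move=> a x [m [s [Mm ->]]]; exists (a * m), (a * s).
      by split; [apply: MM | rewrite mulrDr mulrCA].
  have /asboolP le : leT (exist _ I IP) t.
    by apply: Mmax; apply/asboolP => x Mx; exists x, 0; rewrite mulr0 addr0.
  by case: Mu; apply: (le u); exists 0, 1; rewrite add0r mulr1.
pose mA := isIdealr.Build S mpred mI.
pose mB := isPrimeIdealrClosed.Build S mpred mP.
pose q : prime_idealr S := HB.pack mpred mA mB.
by exists q => x /JM' Mx; apply/asboolP.
Qed.
End Krull.

Section LocalApproximation.
Variables (A : comNzRingType) (S : idomainType) (i : {rmorphism A -> S}).
Variable p : prime_idealr A.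

Definition ipow_ext n (x : S) : Prop := exists s : seq (A * S),
  (forall u, u \in s -> in_ipow p n u.1) /\ x = \sum_(u <- s) i u.1 * u.2.

Lemma in_ipowX n a : a \in p -> in_ipow p n (a ^+ n.+1).
Proof.
move=> pa; elim: n => [|n IH] /=; first by rewrite expr1.
exists [:: (a, a ^+ n.+1)]; rewrite big_seq1 [a ^+ n.+2]exprS; split=> // u.
by rewrite inE => /eqP ->.
Qed.

(** The denominators of [f], taken modulo p^(n+1) S, form an ideal [J]. A prime ideal containing [J]
    would contain p, because it contains the powers a^(n+1), and would then miss some denominator of
    [f] by definition of S_(p). So 1 is in [J]: [f] is a fraction with denominator 1 modulo p^(n+1),
    and its reduction is that of its numerator. *)
Lemma loc_approx n (f : loc i p) : exists y z,
  tofrac y * val f = tofrac z /\ ipow_ext n (y - 1).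
Proof.
pose J x := exists y z, tofrac y * val f = tofrac z /\ ipow_ext n (y - x).
case: (pselect (J 1)) => // J1.
have [||q Jq] := @krull S J; [|by []|].
- split.
  + exists 0, 0; rewrite tofrac0 mul0r subrr; split=> //.
    by exists [::]; rewrite big_nil.
  + move=> x x' [y [z [yz [s [sp se]]]]] [y' [z' [yz' [s' [sp' se']]]]].
    exists (y + y'), (z + z'); rewrite !tofracD mulrDl yz yz'; split=> //.
    exists (s ++ s'); rewrite big_cat /= -se -se' opprD addrACA; split=> // u.
    by rewrite mem_cat => /orP[/sp|/sp'].
  + move=> a x [y [z [yz [s [sp se]]]]]; exists (a * y), (a * z).
    rewrite !tofracM -mulrA yz; split=> //.
    exists [seq (u.1, a * u.2) | u <- s]; split; first by move=> _ /mapP[u /sp ? ->].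
    rewrite big_map -mulrBr se mulr_sumr; apply: eq_bigr => u _; exact: mulrCA.
have pq a : a \in p -> i a \in q.
  move=> pa; have : i a ^+ n.+1 \in q.
    apply: Jq; exists 0, 0; rewrite tofrac0 mul0r; split=> //.
    exists [:: (a ^+ n.+1, -1)]; rewrite big_seq1 rmorphXn mulrN1 sub0r; split=> // u.
    by rewrite inE => /eqP ->; apply: in_ipowX.
  elim: n.+1 => [|k IH]; first by rewrite expr0 idealr1.
  by rewrite exprS prime_idealrM => /orP[|/IH].
have /asboolP/(_ q pq)[x [y [yq fE]]] := valP f.
have y0 : tofrac y != 0 by exact: frac_neq0 yq.
case/negP: yq; apply: Jq; exists y, x.
by rewrite fE mulrC divfK //; split=> //; exists [::]; rewrite big_nil subrr.
Qed.
End LocalApproximation.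

(** * K is the fraction field of A *)

Section AlgebraicDependence.
Variables (F : finFieldType) (K : fieldType) (FK : {rmorphism F -> K}).
Hypothesis FF : is_function_field FK.

Let ev (t : K) (u : {poly F}) : K := (map_poly FK u).[t].

Let evM t u v : ev t (u * v) = ev t u * ev t v.
Proof. by rewrite /ev rmorphM hornerM. Qed.
Let ev_sum t (I : finType) (u : I -> {poly F}) :
  ev t (\sum_k u k) = \sum_k ev t (u k).
Proof. by rewrite /ev rmorph_sum horner_sum. Qed.
Let evZ t c u : ev t (c *: u) = FK c * ev t u.
Proof. by rewrite /ev map_polyZ hornerZ. Qed.

Let ev_neq0 t u : ~ algebraicOver FK t -> u != 0 -> ev t u != 0.
Proof.
by move=> talg u0; apply: contra_not_neq talg => ut; exists u => //; apply/rootP.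
Qed.

Lemma common_denominator (I : finType) t n (b : 'I_n -> K) (y : I -> K) :
    ~ algebraicOver FK t ->
    (forall x, exists u v : 'I_n -> {poly F}, (forall k, v k != 0) /\
       x = \sum_k ev t (u k) / ev t (v k) * b k) ->
  exists D (u : I -> 'I_n -> {poly F}),
    D != 0 /\ forall a, ev t D * y a = \sum_k ev t (u a k) * b k.
Proof.
move=> talg span.
have /choice[u /choice[v uv]] := fun a => span (y a).
exists (\prod_a \prod_k v a k).
exists (fun a k => (\prod_(a' | a' != a) \prod_l v a' l) *
                   (\prod_(l | l != k) v a l) * u a k).
split=> [|a].
  by apply/prodf_neq0 => a _; apply/prodf_neq0 => k _; case: (uv a).
have [vn0 ya] := uv a.
rewrite [in LHS]ya mulr_sumr; apply: eq_bigr => k _.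
rewrite (bigD1 a) //= (bigD1 (P := xpredT) k) //= !evM.
by rewrite mulrA; congr (_ * _); field; apply: ev_neq0.
Qed.

Lemma algebraic_dependence (t x : K) : exists N (c : 'I_N * 'I_N -> F),
  (exists ij, c ij != 0) /\
  \sum_ij FK (c ij) * (t ^+ ij.1 * x ^+ ij.2) = 0.
Proof.
have [t0 [t0alg [n [b span]]]] := FF.
pose y (a : unit + ('I_n + 'I_n)) : K :=
  match a with inl _ => 1 | inr (inl k) => t * b k | inr (inr k) => x * b k end.
have [D [u [D0 uE]]] := common_denominator y t0alg span.
pose e := (size D + \max_a \max_k size (u a k))%N.
have De : (size D <= e.+1)%N by rewrite /e -addnS leq_addr.
have ue a k : (size (u a k) <= e.+1)%N.
  rewrite /e -addSn (leq_trans _ (leq_addl _ _)) //.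
  by apply: leq_trans (leq_bigmax a); apply: leq_trans (leq_bigmax k).
have size_step s (w w' : {poly F}) : (size w <= e * s + 1)%N -> (size w' <= e.+1)%N ->
    (size (w * w')%R <= e * s.+1 + 1)%N.
  move=> sw sw'; apply: leq_trans (size_polyMleq _ _) _.
  rewrite -subn1 leq_subLR; apply: leq_trans (leq_add sw sw') _.
  by rewrite mulnS; lia.
(* Coordinates of degree at most es. A factor D t or D x raises s by 1, and so does D alone, which
   pads all the t^i x^j to the same power of D. *)
pose V s z := exists2 w : 'I_n -> {poly F},
  (forall k, (size (w k) <= e * s + 1)%N) & z = \sum_k ev t0 (w k) * b k.
have V1 : V 1%N (ev t0 D).
  exists (u (inl tt)) => [k|]; last by rewrite -uE /= mulr1.
  by rewrite muln1 addn1 ue.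
have VD s z : V s z -> V s.+1 (ev t0 D * z).
  move=> [w ws ->]; exists (fun k => w k * D) => [k|]; first exact: size_step.
  by rewrite mulr_sumr; apply: eq_bigr => k _; rewrite evM mulrCA mulrA.
have Vmul (a : 'I_n -> unit + ('I_n + 'I_n)) r s z : (forall k, y (a k) = r * b k) ->
    V s z -> V s.+1 (ev t0 D * (r * z)).
  move=> ya [w ws ->]; exists (fun l => \sum_k w k * u (a k) l) => [l|].
    apply: leq_trans (size_sum _ _ _) _; apply/bigmax_leqP => k _.
    exact: size_step.
  transitivity (\sum_k ev t0 (w k) * (ev t0 D * y (a k))).
    by rewrite !mulr_sumr; apply: eq_bigr => k _; rewrite ya; ring.
  under [RHS]eq_bigr do rewrite ev_sum mulr_suml.
  rewrite exchange_big; apply: eq_bigr => k _ /=.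
  by rewrite uE mulr_sumr; apply: eq_bigr => l _; rewrite evM mulrA.
have Vt s z := @Vmul (fun k => inr (inl k)) t s z (fun k => erefl).
have Vx s z := @Vmul (fun k => inr (inr k)) x s z (fun k => erefl).
have Vtx i j : V (i + j).+1 (ev t0 D ^+ (i + j).+1 * (t ^+ i * x ^+ j)).
  elim: i => [|i IH].
    elim: j => [|j IH]; first by rewrite !expr0 !mulr1 expr1.
    have := Vx _ _ IH; congr V; rewrite add0n !exprS; ring.
  have := Vt _ _ IH; congr V; rewrite addSn !exprS; ring.
have VDn s d z : V s z -> V (s + d)%N (ev t0 D ^+ d * z).
  move=> Vz; elim: d => [|d IH]; first by rewrite addn0 mul1r.
  by rewrite addnS exprS -mulrA; apply: VD.
pose N := (n * (2 * e + 1) + 1)%N.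
pose M := (e * (2 * N) + 1)%N.
have Vij (ij : 'I_N * 'I_N) : V (2 * N)%N (ev t0 D ^+ (2 * N) * (t ^+ ij.1 * x ^+ ij.2)).
  have le : ((ij.1 + ij.2).+1 <= 2 * N)%N.
    by have := ltn_ord ij.1; have := ltn_ord ij.2; lia.
  rewrite -(subnKC le); have := VDn _ (2 * N - (ij.1 + ij.2).+1)%N _ (Vtx ij.1 ij.2).
  by rewrite mulrA -exprD addnC.
have [w wM wE] : exists2 w : 'I_N * 'I_N -> 'I_n -> {poly F},
    forall (ij : 'I_N * 'I_N) k, (size (w ij k) <= M)%N &
    forall ij : 'I_N * 'I_N,
      ev t0 D ^+ (2 * N) * (t ^+ ij.1 * x ^+ ij.2) = \sum_k ev t0 (w ij k) * b k.
  have /choice[w wP] : forall ij : 'I_N * 'I_N, exists w : 'I_n -> {poly F},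
      (forall k, (size (w k) <= M)%N) /\
      ev t0 D ^+ (2 * N) * (t ^+ ij.1 * x ^+ ij.2) = \sum_k ev t0 (w k) * b k.
    by move=> ij; have [w] := Vij ij; exists w.
  by exists w => ij; case: (wP ij).
pose phi (c : {ffun 'I_N * 'I_N -> F}) : {ffun 'I_n * 'I_M -> F} :=
  [ffun kl : 'I_n * 'I_M => \sum_ij c ij * (w ij kl.1)`_kl.2].
have [c [c' [cc' phi_eq]]] : exists c c', c != c' /\ phi c = phi c'.
  apply: contrapT => ninj.
  have /leq_card : injective phi.
    move=> c c' cc'; apply: contrapT => ne; apply: ninj.
    by exists c, c'; split=> //; apply/eqP.
  rewrite !card_ffun !card_prod !card_ord leqNgt => /negP; apply.
  by rewrite ltn_exp2l ?card_finRing_gt1 // /M /N; nia.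
exists N, (fun ij => c ij - c' ij); split.
  apply: contrapT => nc; case/eqP: cc'; apply/ffunP => ij.
  by apply: contrapT => /eqP; rewrite -subr_eq0 => ne; apply: nc; exists ij.
have w0 k : \sum_ij (c ij - c' ij) *: w ij k = 0.
  apply/polyP => l; rewrite coef0 coef_sum; case: (ltnP l M) => lM.
    have /ffunP/(_ (k, Ordinal lM)) := phi_eq; rewrite !ffunE /= => /eqP.
    rewrite -subr_eq0 -sumrB => /eqP eq0; rewrite -[RHS]eq0.
    by apply: eq_bigr => ij _; rewrite coefZ mulrBl.
  by apply: big1 => ij _; rewrite coefZ nth_default ?mulr0 // (leq_trans (wM _ _)).
have Dn0 : ev t0 D ^+ (2 * N) != 0 by rewrite expf_neq0 // ev_neq0.
apply: (mulfI Dn0); rewrite mulr0 mulr_sumr.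
under eq_bigr do rewrite mulrCA wE mulr_sumr.
rewrite exchange_big big1 // => k _ /=.
under eq_bigr do rewrite mulrA -evZ.
by rewrite -mulr_suml -ev_sum w0 /ev rmorph0 horner0 mul0r.
Qed.
End AlgebraicDependence.

Section FractionField.
Variables (X : curve) (a : AA X).
Hypothesis a_nonconst : forall c, a != FqA X c.

(* A nonconstant [a] in [A] is transcendental, so each [x] satisfies a polynomial
   equation with coefficients in [Fq[a]], a subring of [A]; multiplying [x] by
   the leading coefficient clears its poles away from infinity. *)
Lemma KK_frac (x : KK X) : exists b c : AA X, b != 0 /\ x * val b = val c.
Proof.
pose t : KK X := val a.
have talg : ~ algebraicOver (FqK X) t.
  move=> /KK_geom_irr[c tc]; case/eqP: (a_nonconst c); apply: val_inj; exact: tc.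
have [N [c [[[i0 j0] c0] cE]]] := algebraic_dependence (@KK_function_field X) t x.
pose pj (j : 'I_N) : {poly Fq X} := \poly_(i < N) (if insub i is Some i' then c (i', j) else 0).
pose qj (j : 'I_N) : KK X := \sum_(i < N) FqK X (c (i, j)) * t ^+ i.
have qjE j : qj j = (map_poly (FqK X) (pj j)).[t].
  rewrite /qj /pj poly_def rmorph_sum horner_sum; apply: eq_bigr => i _.
  by rewrite valK /= map_polyZ map_polyXn hornerZ hornerXn.
have qj0 : qj j0 != 0.
  rewrite qjE; apply/negP => /eqP r0; apply: talg; exists (pj j0); last exact/rootP.
  apply: contraNneq c0 => p0; have := coef_poly N
    (fun i => if insub i is Some i' then c (i', j0) else 0) i0.
  by rewrite -/(pj j0) p0 coef0 ltn_ord valK => <-.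
pose Q : {poly KK X} := \poly_(j < N) (if insub j is Some j' then qj j' else 0).
have Qj (j : 'I_N) : Q`_j = qj j by rewrite coef_poly ltn_ord valK.
have Q0 : Q != 0 by apply: contraNneq qj0 => Q0; rewrite -Qj Q0 coef0.
have Qx : Q.[x] = 0.
  have {}cE : \sum_(i < N) \sum_(j < N) FqK X (c (i, j)) * (t ^+ i * x ^+ j) = 0.
    by rewrite pair_bigA -[RHS]cE; apply: eq_bigr => -[i j].
  rewrite horner_poly -[RHS]cE.
  rewrite exchange_big; apply: eq_bigr => j _; rewrite valK mulr_suml.
  by apply: eq_bigr => i _; rewrite mulrA.
have QA j : Q`_j \in @AA_pred X.
  rewrite coef_poly; case: ltnP => _; last exact: rpred0.
  case: insub => [j'|]; last exact: rpred0.
  by apply: rpred_sum => i _; rewrite rpredM ?FqK_AA // rpredX //; apply: valP.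
have lcA : lead_coef Q * x \in @AA_pred X.
  apply/asboolP => O pO nO.
  have QO j : O Q`_j by have /asboolP := QA j; apply.
  have [OF Oring Oval _] := pO.
  have O1 : O 1 by rewrite -(rmorph1 (FqK X)).
  have OM y z : O y -> O z -> O (y * z) by move=> Oy Oz; case: (Oring y z).
  have O0 : O 0 by rewrite -(subrr 1); case: (Oring 1 1).
  have ON y : O y -> O (- y) by move=> Oy; rewrite -sub0r; case: (Oring 0 y).
  have OD y z : O y -> O z -> O (y + z).
    by move=> Oy /ON Oz; rewrite -[z]opprK; case: (Oring y (- z)).
  case: (Oval x) => Ox; first by apply: OM => //; rewrite lead_coefE.
  case: (eqVneq x 0) => [->|x0]; first by rewrite mulr0.
  have sQ : (1 < size Q)%N.
    rewrite ltnNge; apply: contraNN Q0 => sQ; move: Qx.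
    by rewrite (size1_polyC sQ) hornerC => ->; rewrite polyC0.
  move: Qx; rewrite horner_coef; case sQE: (size Q) sQ => [|[|d]] // _.
  rewrite big_ord_recr /= => /eqP; rewrite addrC addr_eq0 => /eqP lx.
  (* Here 1/x is in [O]. Dividing Q(x) = 0, of degree d + 1, by x^d expresses the product through
     nonnegative powers of 1/x with coefficients in [O]. *)
  have -> : lead_coef Q * x = - \sum_(j < d.+1) Q`_j * x^-1 ^+ (d - j).
    have xd : x ^+ d != 0 by rewrite expf_neq0.
    apply: (mulIf xd); rewrite lead_coefE sQE /= -mulrA -exprS lx mulNr mulr_suml.
    congr (- _); apply: eq_bigr => j _; rewrite -mulrA; congr (_ * _).
    have jd : (j <= d)%N by rewrite -ltnS ltn_ord.
    by rewrite -[in x ^+ d](subnK jd) exprD mulrA -exprMn mulVf // expr1n mul1r.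
  have OX k : O (x^-1 ^+ k).
    by elim: k => [|k IH]; rewrite ?expr0 // exprS; case: (Oring _ _ Ox IH).
  have OQX (j : 'I_d.+1) : O (Q`_j * x^-1 ^+ (d - j)).
    by case: (Oring _ _ (QO j) (OX (d - j)%N)).
  by apply: ON; elim/big_ind: _.
exists (Subr (QA (size Q).-1)), (Subr lcA); split=> /=; last by rewrite mulrC lead_coefE.
apply: contraNneq Q0 => /(congr1 val) /= l0.
by rewrite -lead_coef_eq0 lead_coefE l0.
Qed.
End FractionField.

(** * The embedding of T_(p) *)

Lemma to_quo_eq0 (A : comNzRingType) (p : prime_idealr A) n a :
  in_ipow p n a -> to_quo p n a = 0.
Proof.
move=> pa; rewrite -(rmorph0 (to_quo p n)); apply/eqP.
by rewrite /to_quo -Quotient.idealrBE subr0; apply/asboolP.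
Qed.

Section Representation.
Variables (X : curve) (Y : coefficients X) (Z : tate Y).
Variables (p : prime_idealr (AA X)) (W : loc_maps Z p) (D : completions Z p).
Local Notation PC := (pC D).
Local Notation Fq := (Fq X).

Definition TTC : {rmorphism TT Z -> pZ PC} := TTpC D \o to_loc _ p.

Lemma ALTl a : ALT Z (AL_l Z a) = ACT Z (AC_l Z a).
Proof. by have := ALTE Z a (1 : LL Y); rewrite !rmorph1 !mulr1. Qed.

Lemma tauTl a : tauT Z (ACT Z (AC_l Z a)) = ACT Z (AC_l Z a).
Proof. by have := tauTE Z a (1 : CC Y); rewrite expr1n !rmorph1 !mulr1. Qed.

Lemma AL_is_tensor : is_tensor (@FqA X) (@FqL X Y) (AL_l Z) (AL_r Z).
Proof. exact: AL_tensor. Qed.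

Lemma AC_is_tensor : is_tensor (@FqA X) (@FqC X Y) (AC_l Z) (AC_r Z).
Proof. have := AC_tensor Z. exact. Qed.

Lemma tauT_ALT x : tauT Z (ALT Z x) = ALT Z (tauAL Z x).
Proof.
elim/(tensor_ind AL_is_tensor): x => [a l|x y ex ey]; last by rewrite !rmorphD ex ey.
by rewrite tauALE !ALTE tauTE (rmorphXn (LC Y)).
Qed.

Lemma TTC_pure n a c :
  pZ_pr PC n (TTC (ACT Z (AC_l Z a * AC_r Z c))) =
  pT_l PC n (to_quo p n a) * pT_r PC n c.
Proof. exact: TTpCE. Qed.

Lemma gauss_PC n : exists N : pT PC n -> RR Y,
  is_gauss_norm (FqQuo p n) (@absC X Y) (pT_l PC n) (pT_r PC n) N.
Proof. by have [N [NP _]] := TTpC_continuous D n; exists N. Qed.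

(** On A (x) C_oo, reduction keeps the coefficients and can only destroy the independence of the
    family, so [gauss_le] applies. The bound passes to T by density, continuity and the ultrametric
    inequality. *)
Lemma TTC_le n : exists2 N : pT PC n -> RR Y,
  is_gauss_norm (FqQuo p n) (@absC X Y) (pT_l PC n) (pT_r PC n) N &
  forall t, N (pZ_pr PC n (TTC t)) <= normT t.
Proof.
have [N [NP Ncont]] := TTpC_continuous D n; exists N => //.
have NP' : is_gauss_norm (FqQuo p n) (@absC X Y) (pT_l PC n) (pT_r PC n) N by [].
have [[normT_ge0 _ normTB _] normACT dense _] := TT_completion Z.
have leAC x : N (pZ_pr PC n (TTC (ACT Z x))) <= normAC x.
  have [m [e [c [eI ->]]]] := gauss_rep1 AC_is_tensor x.
  rewrite (gaussE (@normAC_gauss _ _ Z)) // !rmorph_sum.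
  under eq_bigr do rewrite TTC_pure.
  apply: (gauss_le (pT_is_tensor PC n) (absC_abs Y) NP') => [|k].
    exact: bigmax_ge_id.
  exact: le_bigmax.
move=> t; rewrite leNgt; apply/negP => lt.
set e := N _ in lt.
have e0 : 0 < e by apply: le_lt_trans lt.
have [d d0 dP] := Ncont t e e0.
(* Within d, the images of x and t differ by less than e; within e > |t|, x has norm less than e,
   and so has its image. Together these give e < e. *)
have [x xP] := dense t (Num.min d e) (ltac:(by rewrite lt_min d0 e0)).
move: xP; rewrite lt_min => /andP[xd xe].
have normT0 : normT (0 : TT Z) = 0.
  by rewrite -(rmorph0 (ACT Z)) normACT (gauss0 (@normAC_gauss _ _ Z)).
have normTN (u : TT Z) : normT (- u) <= normT u.
  have := normTB 0 u; rewrite sub0r normT0 => le; apply: le_trans le _.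
  by rewrite ge_max normT_ge0 lexx.
have lt1 : N (pZ_pr PC n (TTC (ACT Z x)) - pZ_pr PC n (TTC t)) < e.
  by apply: dP; rewrite -opprB; apply: le_lt_trans (normTN _) xd.
have lt2 : N (pZ_pr PC n (TTC (ACT Z x))) < e.
  apply: le_lt_trans (leAC x) _; rewrite -normACT.
  have -> : ACT Z x = t - (t - ACT Z x) by rewrite opprB addrC subrK.
  by apply: le_lt_trans (normTB _ _) _; rewrite gt_max lt.
suff : e < e by rewrite ltxx.
rewrite {1}/e -[pZ_pr PC n (TTC t)](subKr (pZ_pr PC n (TTC (ACT Z x)))).
apply: le_lt_trans (gaussB (pT_is_tensor PC n) (absC_abs Y) NP' _ _) _.
by rewrite gt_max lt2 lt1.
Qed.

(** The Frobenius of C_oo acts on every (A/p^(n+1)) (x) C_oo and agrees with tau on A (x) C_oo.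
    Agreement on T follows by approximation: N(g z) <= N(z)^q controls one side, continuity of tau
    the other. *)
Lemma tauC_exists : exists2 tauC : {rmorphism pZ PC -> pZ PC},
  padic_induced (fun c => c ^+ q X) tauC &
  forall t, tauC (TTC t) = TTC (tauT Z t).
Proof.
have [s sE] := frobenius (@FqC X Y).
have [c|tauC tauCP] := padic_lift PC PC (s := s).
  by rewrite sE -rmorphXn expf_card.
have ind : padic_induced (fun c => c ^+ q X) tauC.
  by move=> n; have [g [gE gP]] := tauCP n; exists g; split=> // b x; rewrite gE sE.
exists tauC => // t; apply: (invlim_eq (pZ_lim PC)) => n.
have [N NP Nle] := TTC_le n.
have [g [gE gP]] := ind n.
have Ng z : N (g z) <= N z ^+ q X.
  have [m [e [c [eI ->]]]] := gauss_rep1 (pT_is_tensor PC n) z.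
  rewrite rmorph_sum; under eq_bigr do rewrite gE.
  rewrite [X in _ <= X ^+ _](gaussE NP) //.
  apply: (gauss_le (pT_is_tensor PC n) (absC_abs Y) NP) => [|k].
    by rewrite exprn_ge0 // bigmax_ge_id.
  rewrite (absX (absC_abs Y)) lerXn2r ?nnegrE ?(abs_ge0 (absC_abs Y)) ?bigmax_ge_id //.
  exact: le_bigmax.
have tauAC x : tauC (TTC (ACT Z x)) = TTC (tauT Z (ACT Z x)).
  apply: (invlim_eq (pZ_lim PC)) => n'; have [g' [gE' gP']] := ind n'.
  elim/(tensor_ind AC_is_tensor): x => [a c|x y ex ey]; last by rewrite !rmorphD ex ey.
  by rewrite gP' TTC_pure gE' tauTE TTC_pure.
have [[normT_ge0 _ _ _] _ dense _] := TT_completion Z.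
apply/subr0_eq/(gauss_eq0 (pT_is_tensor PC n) (absC_abs Y) NP).
apply/eqP; rewrite eq_le (gauss_ge0 (pT_is_tensor PC n) NP) andbT.
rewrite leNgt; apply/negP => lt; set e := N _ in lt.
have [d d0 dP] := tauT_continuous (t : TT Z) lt.
(* The bound 1 makes N(u)^q at most N(u) for the error u = t - x. *)
have [x xP] := dense t (Num.min d (Num.min e 1)) (ltac:(by rewrite !lt_min d0 lt ltr01)).
move: xP; rewrite !lt_min => /and3P[xd xe x1].
pose u := t - ACT Z x.
have tu : t = ACT Z x + u by rewrite addrC subrK.
suff : e < e by rewrite ltxx.
have {1}-> : e = N (pZ_pr PC n (tauC (TTC u)) - pZ_pr PC n (TTC (tauT Z u))).
  by rewrite /e tu !rmorphD tauAC /= opprD addrACA subrr add0r.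
apply: le_lt_trans (gaussB (pT_is_tensor PC n) (absC_abs Y) NP _ _) _.
rewrite gt_max gP; apply/andP; split.
  apply: le_lt_trans (Ng _) _.
  have Nu := Nle u; have N0 := gauss_ge0 (pT_is_tensor PC n) NP (pZ_pr PC n (TTC u)).
  apply: le_lt_trans (_ : normT u < e) => //.
  have q1 : (0 < q X)%N by apply: ltnW (card_finRing_gt1 Fq).
  rewrite -(prednK q1) exprS; apply: le_trans (_ : N (pZ_pr PC n (TTC u)) <= _) => //.
  by rewrite ler_piMr // exprn_ile1 // (le_trans Nu) // ltW.
apply: le_lt_trans (Nle _) _.
have -> : tauT Z u = tauT Z (t + u) - tauT Z t by rewrite rmorphD addrAC subrr add0r.
by apply: dP; rewrite addrAC subrr add0r.
Qed.

Lemma ipow_ext_TTC n x : ipow_ext (ACT Z \o AC_l Z) p n x -> pZ_pr PC n (TTC x) = 0.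
Proof.
move=> [s [sp ->]]; rewrite !rmorph_sum big_seq big1 // => u /sp /to_quo_eq0 u0.
rewrite !rmorphM /=.
have := TTC_pure n u.1 1; rewrite rmorph1 mulr1 u0 rmorph0 mul0r.
by rewrite /TTC /= => ->; rewrite mul0r.
Qed.

Lemma ipow_ext_tauT n x : ipow_ext (ACT Z \o AC_l Z) p n x ->
  ipow_ext (ACT Z \o AC_l Z) p n (tauT Z x).
Proof.
move=> [s [sp ->]]; exists [seq (u.1, tauT Z u.2) | u <- s]; split.
  by move=> _ /mapP[u /sp ? ->].
by rewrite big_map rmorph_sum; apply: eq_bigr => u _; rewrite rmorphM /= tauTl.
Qed.

Lemma ipow_ext_ALT n x : ipow_ext (AL_l Z) p n x ->
  ipow_ext (ACT Z \o AC_l Z) p n (ALT Z x).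
Proof.
move=> [s [sp ->]]; exists [seq (u.1, ALT Z u.2) | u <- s]; split.
  by move=> _ /mapP[u /sp ? ->].
by rewrite big_map rmorph_sum; apply: eq_bigr => u _; rewrite rmorphM /= ALTl.
Qed.

Lemma to_locM (A : comNzRingType) (S : idomainType) (i : A -> S)
    (p' : prime_idealr A) (y z : S)
    (f : loc i p') : tofrac y * val f = tofrac z ->
  to_loc i p' y * f = to_loc i p' z.
Proof. by move=> yz; apply: val_inj. Qed.

Lemma pr_unit n y : ipow_ext (ACT Z \o AC_l Z) p n (y - 1) -> pZ_pr PC n (TTC y) = 1.
Proof.
move=> /ipow_ext_TTC; rewrite !rmorphB !rmorph1 => /eqP.
by rewrite subr_eq0 => /eqP.
Qed.

(** Modulo p^(n+1), [f] may be replaced by its numerator, its denominator y being 1 there; tau(y) is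
    1 there as well, because tau fixes A. *)
Lemma tauC_TTpC (tauC : {rmorphism pZ PC -> pZ PC}) :
    (forall t, tauC (TTC t) = TTC (tauT Z t)) ->
    padic_induced (fun c => c ^+ q X) tauC ->
  forall f : TTp Z p, tauC (TTpC D f) = TTpC D (tauTTp W f).
Proof.
move=> tauE ind f; apply: (invlim_eq (pZ_lim PC)) => n.
have [y [z [/to_locM yz y1]]] := loc_approx n f.
have /(congr1 (pZ_pr PC n \o tauC \o TTpC D)) := yz.
have /(congr1 (pZ_pr PC n \o TTpC D \o tauTTp W)) := yz.
have tauy1 : pZ_pr PC n (TTC (tauT Z y)) = 1.
  by apply: pr_unit; rewrite -(rmorph1 (tauT Z)) -rmorphB; apply: ipow_ext_tauT.
rewrite /= !rmorphM !tauTTpE -!/(TTC _) !tauE tauy1 !mul1r => E1.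
by move=> ->; rewrite E1.
Qed.

Lemma rational_ALT x : rational (PC := PC) (LC Y) (TTC (ALT Z x)).
Proof.
move=> n; have [s ->] := tensor_span AL_is_tensor x.
exists [seq (to_quo p n u.1, u.2) | u <- s]; rewrite big_map !rmorph_sum.
by apply: eq_bigr => u _; rewrite ALTE TTC_pure.
Qed.

Lemma rational_ALp x : rational (PC := PC) (LC Y) (TTpC D (ALpTTp W x)).
Proof.
move=> n; have [y [z [/to_locM yz y1]]] := loc_approx n x.
have [u uP] := rational_ALT z n; exists u; rewrite -uP.
have /(congr1 (pZ_pr PC n \o TTpC D \o ALpTTp W)) := yz.
rewrite /= !rmorphM !ALpTTpE -!/(TTC _) => <-.
rewrite pr_unit ?mul1r // -(rmorph1 (ALT Z)) -rmorphB.
exact: ipow_ext_ALT.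
Qed.
End Representation.

(** * Descent *)

Section Descent.
Variables (X : curve) (Y : coefficients X) (Z : tate Y).
Variables (p : prime_idealr (AA X)) (D : completions Z p).
Local Notation PC := (pC D).
Local Notation Fq := (Fq X).

Let absP := absC_abs Y.
Let PN := gauss_PC D.

Lemma Lsep_root (z : CC Y) (P : {poly LL Y}) : separable_poly P ->
  root (map_poly (LC Y) P) z -> exists x, LsepC Y x = z.
Proof. by move=> Ps Pz; apply/Lsep_separable; exists P. Qed.

(** At level n, write z_s = sum_k b_k (x) x_sk with [b] independent over Fq. Expanding the b_k and
    the products b_k beta_a on one independent family [e] and comparing coefficients gives P x = (an
    L-linear combination of the x^q), with [P] over Fq. As [b] is independent, [P] has a one-sided
    inverse, whence x = B x^(q) with B over L, and [sep_solutions] applies. *)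
Lemma rational_descent (tauC : {rmorphism pZ PC -> pZ PC}) (I : finType)
    (z : I -> pZ PC) (theta : I -> I -> pZ PC) :
    padic_induced (fun c => c ^+ q X) tauC ->
    (forall s t, rational (LC Y) (theta s t)) ->
    (forall s, z s = \sum_t tauC (z t) * theta s t) ->
  forall s, rational (LsepC Y) (z s).
Proof.
move=> ind thr zE s n; have [g [gE gP]] := ind n.
have /choice[u uE] := fun s => tensor_span (pT_is_tensor PC n) (pZ_pr PC n (z s)).
have [m [b [x [bI _ bx]]]] := joint_coord (pT_compat PC n) u [::].
have /choice[w wE] := fun st : I * I => thr st.1 st.2 n.
have compatL c : pT_l PC n (FqQuo p n c) = (pT_r PC n \o LC Y) (@FqL X Y c).
  by rewrite pT_compat /= LC_KL.
have [m' [beta [l [_ _ bl]]]] := joint_coord compatL w [::].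
pose Dl := [seq b k | k <- enum 'I_m] ++
  [seq b ka.1 * beta ka.2 | ka <- enum {: 'I_m * 'I_m'}].
have [M [e [eI eD]]] := indep_span (FqQuo p n) Dl.
have /choice[P PE] : forall k, in_span (FqQuo p n) e (b k).
  by move=> k; apply: eD; rewrite mem_cat map_f // mem_enum.
have /choice[y yE] : forall ka : 'I_m * 'I_m', in_span (FqQuo p n) e (b ka.1 * beta ka.2).
  move=> ka; apply: eD; rewrite mem_cat; apply/orP; right.
  by apply: (map_f (fun ka : 'I_m * 'I_m' => b ka.1 * beta ka.2)); rewrite mem_enum.
have zx s' : pZ_pr PC n (z s') = \sum_k pT_l PC n (b k) * pT_r PC n (x s' k).
  by rewrite uE bx.
have thx s' t : pZ_pr PC n (theta s' t) =
    \sum_a pT_l PC n (beta a) * pT_r PC n (LC Y (l (s', t) a)).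
  by rewrite (wE (s', t)) (bl (s', t)).
have gzx t : pZ_pr PC n (tauC (z t)) =
    \sum_k pT_l PC n (b k) * pT_r PC n (x t k ^+ q X).
  by rewrite gP zx rmorph_sum; apply: eq_bigr => k _; rewrite gE.
have zL s' : pZ_pr PC n (z s') =
    \sum_i pT_l PC n (e i) * pT_r PC n (\sum_k @FqC X Y (P k i) * x s' k).
  rewrite zx; under [RHS]eq_bigr do rewrite rmorph_sum mulr_sumr.
  rewrite exchange_big; apply: eq_bigr => k _; rewrite /= {1}PE rmorph_sum mulr_suml.
  by apply: eq_bigr => i _; rewrite !rmorphM pT_compat /=; ring.
have zR s' : pZ_pr PC n (z s') = \sum_i pT_l PC n (e i) * pT_r PC n
    (\sum_tka @FqC X Y (y tka.2 i) * x tka.1 tka.2.1 ^+ q X *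
       LC Y (l (s', tka.1) tka.2.2)).
  under [RHS]eq_bigr do rewrite rmorph_sum mulr_sumr.
  rewrite exchange_big zE rmorph_sum /=.
  rewrite -(pair_bigA _ (fun t (ka : 'I_m * 'I_m') => \sum_i pT_l PC n (e i) *
    pT_r PC n (@FqC X Y (y ka i) * x t ka.1 ^+ q X * LC Y (l (s', t) ka.2)))) /=.
  apply: eq_bigr => t _; rewrite rmorphM gzx thx.
  rewrite big_distrlr pair_bigA; apply: eq_bigr => ka _ /=.
  rewrite mulrACA -rmorphM yE rmorph_sum mulr_suml; apply: eq_bigr => i _.
  by rewrite !rmorphM pT_compat /=; ring.
have coordE s' i : \sum_k @FqC X Y (P k i) * x s' k =
    \sum_tka @FqC X Y (y tka.2 i) * x tka.1 tka.2.1 ^+ q X *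
       LC Y (l (s', tka.1) tka.2.2).
  apply/subr0_eq; move: i; apply: (pT_indep0 absP PN eI).
  under eq_bigr do rewrite rmorphB mulrBr.
  by rewrite sumrB -zL -zR subrr.
pose Pm : 'M[Fq]_(m, M) := \matrix_(k, i) P k i.
have /row_freeP[P' PP'] : row_free Pm.
  apply: inj_row_free => v vP; apply/rowP => k; rewrite mxE.
  apply: (bI (fun k => v 0 k)); under eq_bigr do rewrite PE mulr_sumr.
  rewrite exchange_big big1 // => i _ /=.
  under eq_bigr do rewrite mulrA -(rmorphM (FqQuo p n)).
  rewrite -mulr_suml -(rmorph_sum (FqQuo p n)).
  suff -> : \sum_k v 0 k * P k i = 0 by rewrite (rmorph0 (FqQuo p n)) mul0r.
  have /rowP/(_ i) := vP; rewrite !mxE => h; rewrite -[RHS]h.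
  by apply: eq_bigr => k' _; rewrite mxE.
have PP'E k k' : \sum_i P k i * P' i k' = (k == k')%:R.
  have /matrixP/(_ k k') := PP'; rewrite !mxE => <-.
  by apply: eq_bigr => i _; rewrite mxE.
pose B (sk tk : I * 'I_m) : LL Y :=
  \sum_i \sum_a @FqL X Y (P' i sk.2) * @FqL X Y (y (tk.2, a) i) * l (sk.1, tk.1) a.
have FLC c : LC Y (@FqL X Y c) = @FqC X Y c by rewrite /FqL /FqC LC_KL.
have xB sk : x sk.1 sk.2 = \sum_tk LC Y (B sk tk) * x tk.1 tk.2 ^+ #|Fq|.
  have -> : x sk.1 sk.2 = \sum_i @FqC X Y (P' i sk.2) * \sum_k @FqC X Y (P k i) * x sk.1 k.
    under [RHS]eq_bigr do rewrite mulr_sumr.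
    have inner k : \sum_i @FqC X Y (P' i sk.2) * (@FqC X Y (P k i) * x sk.1 k) =
        (k == sk.2)%:R * x sk.1 k.
      rewrite -(rmorph_nat (@FqC X Y)) -PP'E rmorph_sum mulr_suml.
      by apply: eq_bigr => i _; rewrite rmorphM; ring.
    rewrite exchange_big; under [RHS]eq_bigr do rewrite inner.
    rewrite (bigD1 sk.2) //= eqxx mul1r big1 ?addr0 // => k /negbTE ->.
    by rewrite mul0r.
  under eq_bigr do rewrite coordE mulr_sumr.
  rewrite exchange_big.
  rewrite -(pair_bigA _ (fun t (ka : 'I_m * 'I_m') => \sum_i @FqC X Y (P' i sk.2) *
    (@FqC X Y (y ka i) * x t ka.1 ^+ q X * LC Y (l (sk.1, t) ka.2)))) /=.
  rewrite -(pair_bigA _ (fun t k => LC Y (B sk (t, k)) * x t k ^+ #|Fq|)) /=.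
  apply: eq_bigr => t _.
  transitivity (\sum_k \sum_a \sum_i @FqC X Y (P' i sk.2) *
    (@FqC X Y (y (k, a) i) * x t k ^+ q X * LC Y (l (sk.1, t) a))).
    by rewrite [RHS]pair_bigA; apply: eq_bigr => -[k a].
  apply: eq_bigr => k _; rewrite exchange_big /B /= rmorph_sum mulr_suml.
  apply: eq_bigr => i _; rewrite rmorph_sum mulr_suml; apply: eq_bigr => a _.
  by rewrite !rmorphM !FLC /q; ring.
have /choice[v vE] := sep_solutions (@FqL X Y) (@LsepC_LLsep X Y) Lsep_root
  (x := fun sk => x sk.1 sk.2) xB.
exists [seq (b k, v (s, k)) | k <- enum 'I_m]; rewrite zx big_map big_enum.
by apply: eq_bigr => k _; rewrite vE.
Qed.

(** At each level, being an inverse of z is a linear system over [F] for the coefficients on a fixed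
    family. It is solvable over C_oo, hence over [F], and inverses are unique. *)
Lemma rational_inverse (F : fieldType) (f : {rmorphism Fq -> F})
    (s : {rmorphism F -> CC Y}) (z z' : pZ PC) :
    (forall c, s (f c) = @FqC X Y c) -> rational s z -> z * z' = 1 ->
  rational s z'.
Proof.
move=> sf zr zz' n; have [u uE] := zr n.
have [u' uE'] := tensor_span (pT_is_tensor PC n) (pZ_pr PC n z').
have compatF c : pT_l PC n (FqQuo p n c) = (pT_r PC n \o s) (f c).
  by rewrite pT_compat /= sf.
have [m [b [x [_ _ /(_ tt) bx]]]] := joint_coord compatF (fun _ : unit => u) [::].
have [m' [b' [x' [_ _ /(_ tt) bx']]]] :=
  joint_coord (pT_compat PC n) (fun _ : unit => u') [::].
pose Dl := 1 :: [seq b kl.1 * b' kl.2 | kl <- enum {: 'I_m * 'I_m'}].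
have [M [e [eI eD]]] := indep_span (FqQuo p n) Dl.
have [o oE] : in_span (FqQuo p n) e 1 by apply: eD; rewrite mem_head.
have /choice[y yE] : forall kl : 'I_m * 'I_m', in_span (FqQuo p n) e (b kl.1 * b' kl.2).
  move=> kl; apply: eD; rewrite inE; apply/orP; right.
  by apply: (map_f (fun kl : 'I_m * 'I_m' => b kl.1 * b' kl.2)); rewrite mem_enum.
pose A : 'M[F]_(m', M) := \matrix_(l, i) \sum_k f (y (k, l) i) * x tt k.
have prodE (c : 'I_m' -> CC Y) :
    pZ_pr PC n z * (\sum_l pT_l PC n (b' l) * pT_r PC n (c l)) =
    \sum_i pT_l PC n (e i) * pT_r PC n (\sum_l c l * s (A l i)).
  rewrite uE bx big_distrlr exchange_big /=.
  under [RHS]eq_bigr do rewrite rmorph_sum mulr_sumr.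
  rewrite [RHS]exchange_big; apply: eq_bigr => l _ /=.
  transitivity (\sum_k \sum_i pT_l PC n (e i) *
      (pT_r PC n (@FqC X Y (y (k, l) i)) * pT_r PC n (s (x tt k)) * pT_r PC n (c l))).
    apply: eq_bigr => k _; rewrite mulrACA -rmorphM (yE (k, l)) rmorph_sum mulr_suml.
    by apply: eq_bigr => i _; rewrite rmorphM pT_compat; ring.
  rewrite exchange_big; apply: eq_bigr => i _ /=.
  rewrite -mulr_sumr mxE; congr (_ * _).
  rewrite rmorphM (rmorph_sum s) rmorph_sum mulr_sumr.
  by apply: eq_bigr => k _; rewrite !rmorphM sf; ring.
have oneE : 1 = \sum_i pT_l PC n (e i) * pT_r PC n (@FqC X Y (o i)).
  rewrite -(rmorph1 (pT_l PC n)) oE rmorph_sum; apply: eq_bigr => i _.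
  by rewrite rmorphM pT_compat mulrC.
have solE (c : 'I_m' -> CC Y) :
    pZ_pr PC n z * (\sum_l pT_l PC n (b' l) * pT_r PC n (c l)) = 1 <->
    (forall i, \sum_l c l * s (A l i) = @FqC X Y (o i)).
  rewrite prodE; split=> [e1 i|e1]; last by under eq_bigr do rewrite e1; rewrite -oneE.
  apply/subr0_eq; move: i; apply: (pT_indep0 absP PN eI).
  by under eq_bigr do rewrite rmorphB mulrBr; rewrite sumrB e1 -oneE subrr.
have /solE sol : pZ_pr PC n z * (\sum_l pT_l PC n (b' l) * pT_r PC n (x' tt l)) = 1.
  by rewrite -bx' -uE' -rmorphM zz' rmorph1.
have /submxP[c cE] : ((\row_i f (o i)) <= A)%MS.
  rewrite -(map_submx s); apply/submxP; exists (\row_l x' tt l).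
  apply/rowP => i; rewrite !mxE sf -sol; apply: eq_bigr => l _; by rewrite !mxE.
exists [seq (b' l, c 0 l) | l <- enum 'I_m']; rewrite big_map big_enum /=.
have e1 : pZ_pr PC n z * (\sum_l pT_l PC n (b' l) * pT_r PC n (s (c 0 l))) = 1.
  apply/solE => i; have /rowP/(_ i) := cE; rewrite !mxE => ci.
  by rewrite -sf ci rmorph_sum; apply: eq_bigr => l _; rewrite rmorphM.
rewrite -[LHS]mulr1 -e1 mulrA -rmorphM [z' * z]mulrC zz' rmorph1 mul1r.
by [].
Qed.

Lemma ApC_inj : injective (ApC D).
Proof.
move=> a b ab; apply: (invlim_eq (Ap_lim D)) => n.
by apply: (pT_l_inj absP PN); rewrite -!ApCE ab.
Qed.

Lemma rational_ApC (F : fieldType) (s : {rmorphism F -> CC Y}) a :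
  rational s (ApC D a).
Proof.
move=> n; exists [:: (Ap_pr D n a, 1)].
by rewrite big_seq1 rmorph1 rmorph1 mulr1 ApCE.
Qed.

(** On an independent family of A/p^(n+1) the coefficients satisfy x^q = x, so they lie in Fq and
    move into the first factor. *)
Lemma tau_fixed_Ap (tauC : {rmorphism pZ PC -> pZ PC}) z :
  padic_induced (fun c => c ^+ q X) tauC -> tauC z = z -> exists a, ApC D a = z.
Proof.
move=> ind zfix.
have ex n : exists b, pT_l PC n b = pZ_pr PC n z.
  have [N NP] := PN n; have [g [gE gP]] := ind n.
  have [m [e [x [eI xE]]]] := gauss_rep1 (pT_is_tensor PC n) (pZ_pr PC n z).
  have xq k : x k ^+ #|Fq| = x k.
    apply/subr0_eq; move: k; apply: (pT_indep0 absP PN eI).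
    under eq_bigr do rewrite rmorphB mulrBr.
    rewrite sumrB -xE -zfix gP xE rmorph_sum.
    by under [X in _ - X]eq_bigr do rewrite gE; rewrite subrr.
  have /choice[y yE] := fun k => frob_fixed (@FqC X Y) (xq k).
  exists (\sum_k FqQuo p n (y k) * e k); rewrite xE rmorph_sum.
  by apply: eq_bigr => k _; rewrite rmorphM pT_compat -yE mulrC.
pose b n := projT1 (cid (ex n)).
have bE n : pT_l PC n (b n) = pZ_pr PC n z by rewrite /b; case: cid.
have [_ /(_ b)[|a [aP _]]] := Ap_lim D.
  move=> n; apply: (pT_l_inj absP PN); rewrite bE.
  have [<- _] := pZ_lim PC; rewrite -bE.
  have [a ->] := to_quo_surj (b n.+1); rewrite Ap_trE.
  by have := pT_trE PC n a 1; rewrite !rmorph1 !mulr1.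
by exists a; apply: (invlim_eq (pZ_lim PC)) => n; rewrite ApCE aP bE.
Qed.
End Descent.

(** * Linear disjointness of T_(p) and A_p *)

Lemma frac_repr (R : idomainType) (x : {fraction R}) :
  exists n d, d != 0 /\ x * tofrac d = tofrac n.
Proof.
elim/quotW: x => r; exists \n_r, \d_r; split; first exact: denom_ratioP.
rewrite !piE; apply/eqmodP; rewrite /= FracField.equivfE /FracField.mulf.
rewrite !numden_Ratio ?oner_neq0 ?mulf_neq0 ?denom_ratioP ?oner_neq0 //.
by rewrite !mulr1 mulrC.
Qed.

Lemma frac_common (R : idomainType) (I : finType) (x : I -> {fraction R}) :
  exists d (n : I -> R), d != 0 /\ forall k, tofrac d * x k = tofrac (n k).
Proof.
have /choice[n /choice[d nd]] := fun k => frac_repr (x k).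
exists (\prod_k d k), (fun k => (\prod_(l | l != k) d l) * n k); split=> [|k].
  by apply/prodf_neq0 => k _; case: (nd k).
have [_ ndk] := nd k.
by rewrite (bigD1 k) //= !tofracM mulrC mulrA ndk mulrC.
Qed.

(* Subtracting multiples of a relation [sum a_k v_k = 0] eliminates the term [l]. *)
Lemma eliminate (S : comNzRingType) n (a u v : 'I_n.+1 -> S) l :
  \sum_k a k * v k = 0 ->
  \sum_k (a l * u (lift l k) - a (lift l k) * u l) * v (lift l k) =
  a l * \sum_k u k * v k.
Proof.
move=> av0; have E (w : 'I_n.+1 -> S) : \sum_k w k = w l + \sum_k w (lift l k).
  rewrite (bigD1 l) //=; congr (_ + _).
  rewrite (reindex_omap (lift l) (unlift l)) /=; last first.
    by move=> k; case: unliftP => [k' ->|->] //; rewrite eqxx.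
  by apply: eq_bigl => k; rewrite liftK eqxx eq_sym neq_lift.
under eq_bigr do rewrite mulrBl.
have al : \sum_k a (lift l k) * v (lift l k) = - (a l * v l).
  by apply/eqP; rewrite -addr_eq0 addrC -(E (fun k => a k * v k)) av0.
rewrite sumrB (E (fun k => u k * v k)).
have -> : \sum_k a l * u (lift l k) * v (lift l k) =
    a l * \sum_k u (lift l k) * v (lift l k).
  by rewrite mulr_sumr; apply: eq_bigr => k _; rewrite mulrA.
have -> : \sum_k a (lift l k) * u l * v (lift l k) = - (a l * v l) * u l.
  by rewrite -al mulr_suml; apply: eq_bigr => k _; rewrite mulrAC.
by rewrite mulrDr; ring.
Qed.

Section Transcendence.
Variables (X : curve) (Y : coefficients X) (Z : tate Y).
Variables (p : prime_idealr (AA X)) (D : completions Z p).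
Local Notation PC := (pC D).
Local Notation Fq := (Fq X).

Let absP := absC_abs Y.

Lemma ApC_AAp a : ApC D (AAp D a) = TTC D (ACT Z (AC_l Z a)).
Proof.
apply: (invlim_eq (pZ_lim PC)) => n; rewrite ApCE AApE.
by have := TTC_pure D n a 1; rewrite !rmorph1 !mulr1.
Qed.

Lemma normT_distC (x y : TT Z) : normT (x - y) <= normT (y - x).
Proof.
have [[normT_ge0 normT_eq0 normTB _] _ _ _] := TT_completion Z.
have normT0 : normT (0 : TT Z) = 0 by apply/normT_eq0.
have := normTB 0 (y - x); rewrite sub0r opprB normT0 => le.
by apply: le_trans le _; rewrite ge_max normT_ge0 lexx.
Qed.

Lemma level_indep (I : finType) (w : I -> Ap D) :
    (forall y : I -> Fq, \sum_k AAp D (FqA X (y k)) * w k = 0 -> forall k, y k = 0) ->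
  exists n, indep (FqQuo p n) (fun k => Ap_pr D n (w k)).
Proof.
move=> wI; pose sm (y : {ffun I -> Fq}) := \sum_k AAp D (FqA X (y k)) * w k.
have ex (y : {ffun I -> Fq}) : exists n, sm y != 0 -> Ap_pr D n (sm y) != 0.
  apply: contrapT => nex; have sm0 : sm y = 0.
    apply: (invlim_eq (Ap_lim D)) => n; rewrite rmorph0; apply/eqP.
    by apply: contrapT => /negP H; apply: nex; exists n.
  by apply: nex; exists 0%N; rewrite sm0 eqxx.
have [l lP] := choice ex; pose n := (\max_y l y)%N.
exists n => x x0 k; pose y := [ffun k => x k].
have sy0 : Ap_pr D n (sm y) = 0.
  rewrite rmorph_sum -[RHS]x0; apply: eq_bigr => k' _.
  by rewrite rmorphM AApE ffunE.
have : sm y = 0.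
  apply/eqP; apply: contraT => /lP /eqP[].
  by apply: (invlim_le0 (Ap_lim D) (leq_bigmax y)).
by move/wI/(_ k); rewrite ffunE.
Qed.

(* The Gauss norm of [sum_i f_i c_i] modulo a high power of [p] is the maximum of
   the norms of the [f_i]: approximate the [f_i] by [sum_k a_k (x) x_ik], the
   [a_k] being independent over [Fq]; so are the [a_k c_i], even modulo a power
   of [p] since there are finitely many [Fq]-combinations of them. *)
Lemma TTC_indep n (f : 'I_n -> TT Z) (c : 'I_n -> Ap D) :
    (forall a : 'I_n -> AA X, \sum_k AAp D (a k) * c k = 0 -> forall k, a k = 0) ->
  \sum_k TTC D (f k) * ApC D (c k) = 0 -> forall k, f k = 0.
Proof.
move=> cI fc0 k0; apply/eqP; apply: contraT => fk0.
have [[normT_ge0 normT_eq0 normTB _] normACT dense _] := TT_completion Z.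
pose e := normT (f k0).
have e0 : 0 < e.
  by rewrite lt_neqAle normT_ge0 andbT eq_sym; apply: contraNneq fk0 => /normT_eq0 ->.
have /choice[g gP] := fun k => dense (f k) e e0.
have [m [a [x [aI gE]]]] := gauss_rep (AC_is_tensor Z) g.
pose w (ik : 'I_n * 'I_m) := AAp D (a ik.2) * c ik.1.
have wI (y : 'I_n * 'I_m -> Fq) : \sum_ik AAp D (FqA X (y ik)) * w ik = 0 ->
    forall ik, y ik = 0.
  move=> y0 [i k]; apply: (aI (fun k => y (i, k))); move: i.
  apply: cI; rewrite -[RHS]y0.
  transitivity (\sum_i \sum_l AAp D (FqA X (y (i, l))) * w (i, l)).
    apply: eq_bigr => i _; rewrite rmorph_sum mulr_suml; apply: eq_bigr => l _.
    by rewrite rmorphM /w mulrA.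
  by rewrite pair_bigA; apply: eq_bigr => -[i l].
have [s wsI] := level_indep wI.
have [N NP Nle] := TTC_le D s.
have Tt := pT_is_tensor PC s.
(* Subtracting the relation sum_i f_i c_i = 0 replaces g_i by g_i - f_i, of norm less than e. But
   the w_ik are independent modulo p^(s+1), so the same sum has norm at least |g_k0|, which is not
   less than e. *)
have e1 : N (\sum_ik pT_l PC s (Ap_pr D s (w ik)) * pT_r PC s (x ik.1 ik.2)) < e.
  have -> : \sum_ik pT_l PC s (Ap_pr D s (w ik)) * pT_r PC s (x ik.1 ik.2) =
      \sum_i pT_l PC s (Ap_pr D s (c i)) * pZ_pr PC s (TTC D (ACT Z (g i) - f i)).
    transitivity (\sum_i pT_l PC s (Ap_pr D s (c i)) * pZ_pr PC s (TTC D (ACT Z (g i)))).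
      transitivity (\sum_i \sum_l pT_l PC s (Ap_pr D s (w (i, l))) * pT_r PC s (x i l)).
        by rewrite pair_bigA; apply: eq_bigr => -[i l].
      apply: eq_bigr => i _; rewrite gE !rmorph_sum mulr_sumr; apply: eq_bigr => l _.
      by rewrite TTC_pure /w /= rmorphM AApE rmorphM; ring.
    under [RHS]eq_bigr do rewrite rmorphB rmorphB mulrBr.
    rewrite sumrB [X in _ - X](_ : _ = 0) ?subr0 //.
    have := congr1 (pZ_pr PC s) fc0; rewrite rmorph_sum rmorph0 => h.
    by rewrite -[RHS]h; apply: eq_bigr => i _; rewrite rmorphM ApCE mulrC.
  apply: le_lt_trans (_ : \big[Num.max/0]_i normT (ACT Z (g i) - f i) < e).
    apply: (gauss_sum Tt absP NP) => [|i]; first exact: bigmax_ge_id.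
    apply: le_trans (gaussMl Tt absP NP _ _) _; apply: le_trans (Nle _) _.
    exact: le_bigmax.
  by apply/bigmax_ltP; split=> // i _; apply: le_lt_trans (normT_distC _ _) (gP i).
move: e1; rewrite (gaussE NP) // ltNge => /negP[].
apply: (le_trans (_ : e <= normT (ACT Z (g k0)))).
  rewrite leNgt; apply/negP => lt; suff : e < e by rewrite ltxx.
  rewrite {1}/e -(subKr (ACT Z (g k0)) (f k0)).
  apply: le_lt_trans (normTB _ _) _; rewrite gt_max lt.
  exact: le_lt_trans (normT_distC _ _) (gP k0).
rewrite normACT gE (gaussE (@normAC_gauss _ _ Z)) //.
apply/bigmax_leP; split=> [|l _]; first exact: bigmax_ge_id.
exact: (le_bigmax _ _ (k0, l)).
Qed.
End Transcendence.

(** * Automorphisms of P (x)_K K_p *)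

Section Automorphism.
Variables (X : curve) (Y : coefficients X) (Z : tate Y) (r : nat).
Variables (p : prime_idealr (AA X)) (D : completions Z p).
Local Notation PC := (pC D).
Variables (Ups Psi : 'M[TTp Z p]_r).
Hypotheses (UP : Ups *m Psi = 1%:M) (PU : Psi *m Ups = 1%:M).
Let Psi0 : 'M[{fraction TT Z}]_r := map_mx val Psi.
Local Notation P := (PV Psi0).
Variables (T : comNzRingType) (i : {rmorphism P -> T})
  (j : {rmorphism {fraction Ap D} -> T}).
Hypothesis Tt : is_tensor (QPV Psi0 \o KQ Z) (KKp D) i j.

Lemma PV_eq (x y : P) : val x = val y -> x = y.
Proof. exact: val_inj. Qed.

Lemma iQ_AA a : i (QPV Psi0 (tofrac (AL_l Z a))) = j (tofrac (AAp D a)).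
Proof. by case: Tt => /(_ (val a)) + _; rewrite /= KQE KKpE. Qed.

Lemma iQ_unit x (t : T) : x != 0 -> t * i (QPV Psi0 x) = 0 -> t = 0.
Proof.
move=> x0 tx; rewrite -[t]mulr1 -(rmorph1 i) -(rmorph1 (QPV Psi0)) -(mulfV x0).
by rewrite !rmorphM mulrA tx mul0r.
Qed.

Lemma val_QPV_AA a : val (QPV Psi0 (tofrac (AL_l Z a))) =
  val (to_loc (ACT Z \o AC_l Z) p (ACT Z (AC_l Z a))).
Proof. by rewrite /= ALTFE ALTl. Qed.

(** The x_k and f_k are the same elements, seen in [P] and in T_(p). If the c_k are independent over
    A, [TTC_indep] kills the f_k once denominators are cleared. Otherwise a relation sum_k a_k c_k =
    0 holds on both sides and eliminates a term with a_l nonzero; the factor a_l is then divided out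
    in [T], where it is invertible as an element of Q. *)
Lemma mult_inj n (x : 'I_n -> P) (f : 'I_n -> TTp Z p) (c : 'I_n -> Ap D) :
    (forall k, val (x k) = val (f k)) ->
    \sum_k TTpC D (f k) * ApC D (c k) = 0 ->
  \sum_k i (x k) * j (tofrac (c k)) = 0.
Proof.
elim: n x f c => [|n IH] x f c xf fc0; first by rewrite big_ord0.
case: (pselect (forall a : 'I_n.+1 -> AA X,
    \sum_k AAp D (a k) * c k = 0 -> forall k, a k = 0)) => [cI|].
  have [d [g [d0 gE]]] := frac_common (fun k => val (f k)).
  have gE' k : to_loc _ p d * f k = to_loc _ p (g k) by apply: val_inj; apply: gE.
  have g0 : forall k, g k = 0.
    apply: (TTC_indep cI); transitivity (TTC D d * \sum_k TTpC D (f k) * ApC D (c k)).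
      rewrite mulr_sumr; apply: eq_bigr => k _.
      by rewrite mulrA; congr (_ * _); rewrite /= -rmorphM gE'.
    by rewrite fc0 mulr0.
  rewrite big1 // => k _; suff -> : x k = 0 by rewrite rmorph0 mul0r.
  apply: PV_eq; rewrite xf; apply: (mulfI (x := tofrac d)).
    by rewrite tofrac_eq0.
  by rewrite gE g0 tofrac0 /= mulr0.
move/existsNP => [a /not_implyP[ac0 /existsNP[l /eqP al0]]].
have acC : \sum_k TTC D (ACT Z (AC_l Z (a k))) * ApC D (c k) = 0.
  have := congr1 (ApC D) ac0; rewrite rmorph_sum rmorph0 => h; rewrite -[RHS]h.
  by apply: eq_bigr => k _; rewrite rmorphM ApC_AAp.
have acT : \sum_k i (QPV Psi0 (tofrac (AL_l Z (a k)))) * j (tofrac (c k)) = 0.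
  have := congr1 (j \o @FracField.tofrac _) ac0.
  rewrite /= rmorph_sum /= rmorph_sum !rmorph0 => h; rewrite -[RHS]h.
  by apply: eq_bigr => k _; rewrite iQ_AA -rmorphM -tofracM.
have lnz : tofrac (AL_l Z (a l)) != 0.
  rewrite -KQE fmorph_eq0; apply: contraNneq al0 => al0; apply/eqP.
  exact: val_inj.
apply: (iQ_unit lnz); rewrite mulrC -(eliminate (fun k => i (x k)) l acT).
pose aL k : TTp Z p := to_loc _ p (ACT Z (AC_l Z (a k))).
pose aP k : P := QPV Psi0 (tofrac (AL_l Z (a k))).
have aPL k : val (aP k) = val (aL k) by apply: val_QPV_AA.
have := IH (fun k => aP l * x (lift l k) - aP (lift l k) * x l)
  (fun k => aL l * f (lift l k) - aL (lift l k) * f l) (fun k => c (lift l k)).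
move=> H; rewrite -[RHS]H => [|k|].
- by apply: eq_bigr => k _; rewrite rmorphB !rmorphM.
- transitivity (val (aP l) * val (x (lift l k)) - val (aP (lift l k)) * val (x l)) => //.
  by rewrite !xf !aPL.
- under eq_bigr do rewrite rmorphB !rmorphM.
  by rewrite (eliminate (fun k => TTpC D (f k)) l acC) fc0 mulr0.
Qed.

(** Graph of the multiplication map, on the part of [T] spanned by x (x) c with x in [P] and in
    T_(p), and c in A_p. Each triple carries x twice, once in each ring. *)
Definition mult_rel (t : T) (z : pZ PC) : Prop :=
  exists s : seq (P * TTp Z p * Ap D),
    [/\ forall u, u \in s -> val u.1.1 = val u.1.2,
        t = \sum_(u <- s) i u.1.1 * j (tofrac u.2) &
        z = \sum_(u <- s) TTpC D u.1.2 * ApC D u.2].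

Lemma mult_rel0 t : mult_rel t 0 -> t = 0.
Proof.
move=> [s [sv -> /esym]]; rewrite !(big_nth (0, 0, 0)) !big_mkord => s0.
apply: (mult_inj (x := fun k => (nth (0, 0, 0) s k).1.1)
  (f := fun k => (nth (0, 0, 0) s k).1.2)) => // k.
by apply: sv; rewrite mem_nth.
Qed.

Lemma mult_rel_pure (x : P) f c : val x = val f ->
  mult_rel (i x * j (tofrac c)) (TTpC D f * ApC D c).
Proof.
move=> xf; exists [:: (x, f, c)]; rewrite !big_seq1; split=> // u.
by rewrite inE => /eqP ->.
Qed.

Lemma mult_relP (x : P) f : val x = val f -> mult_rel (i x) (TTpC D f).
Proof.
by move=> /(mult_rel_pure 1); rewrite tofrac1 !rmorph1 !mulr1.
Qed.

Lemma mult_relB t z t' z' : mult_rel t z -> mult_rel t' z' ->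
  mult_rel (t - t') (z - z').
Proof.
move=> [s [sv -> ->]] [s' [sv' -> ->]].
exists (s ++ [seq (u.1.1, u.1.2, - u.2) | u <- s']); split.
- by move=> u; rewrite mem_cat => /orP[/sv //|/mapP[v /sv' ? ->]].
- rewrite big_cat big_map -sumrN; congr (_ + _); apply: eq_bigr => u _.
  by rewrite /= tofracN rmorphN mulrN.
- rewrite big_cat big_map -sumrN; congr (_ + _); apply: eq_bigr => u _.
  by rewrite /= rmorphN mulrN.
Qed.

Lemma mult_relM t z t' z' : mult_rel t z -> mult_rel t' z' ->
  mult_rel (t * t') (z * z').
Proof.
move=> [s [sv -> ->]] [s' [sv' -> ->]].
exists [seq (u.1.1 * v.1.1, u.1.2 * v.1.2, u.2 * v.2) | u <- s, v <- s']; split.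
- move=> w /allpairsP[[u v] [/= us vs ->]] /=.
  by have /= -> := sv u us; have /= -> := sv' v vs.
- rewrite big_allpairs_dep mulr_suml; apply: eq_bigr => u _; rewrite mulr_sumr.
  by apply: eq_bigr => v _; rewrite /= tofracM !rmorphM mulrACA.
- rewrite big_allpairs_dep mulr_suml; apply: eq_bigr => u _; rewrite mulr_sumr.
  by apply: eq_bigr => v _; rewrite /= !rmorphM mulrACA.
Qed.

Lemma mult_rel_0 : mult_rel 0 0.
Proof. by exists [::]; rewrite !big_nil. Qed.

Lemma mult_relD t z t' z' : mult_rel t z -> mult_rel t' z' ->
  mult_rel (t + t') (z + z').
Proof.
move=> r1 r2; have := mult_relB r1 (mult_relB mult_rel_0 r2).
by rewrite !sub0r !opprK.
Qed.

Lemma mult_rel_sum (I : finType) (t : I -> T) (z : I -> pZ PC) :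
  (forall k, mult_rel (t k) (z k)) -> mult_rel (\sum_k t k) (\sum_k z k).
Proof.
move=> tz; elim/big_rec2: _ => [|k z' t' _ tz']; first exact: mult_rel_0.
exact: mult_relD.
Qed.

(* [g1] and [g2] stand for the embedding of [(A (x) Lsep)_p] and for its
   composition with an element of the Galois group, in either order. *)
Variables (g1 g2 : {rmorphism pZ (pLsep D) -> pZ PC}).
Hypothesis g1_inj : injective g1.
Hypothesis g12_AL : forall d : AL Z, exists ds,
  g1 ds = TTC D (ALT Z d) /\ g2 ds = TTC D (ALT Z d).
Variables (C C' : 'M[Ap D]_r) (Us Psis : 'M[pZ (pLsep D)]_r).
Hypothesis CC' : C *m C' = 1%:M.
Hypotheses (UPs : Us *m Psis = 1%:M).
Hypothesis g1_Psis : map_mx g1 Psis = map_mx (TTpC D) Psi.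
Hypothesis g2_Psis : map_mx g2 Psis = map_mx (TTpC D) Psi *m map_mx (ApC D) C.

(** Read t = alpha(x). A denominator [d] in A (x) L, on which g1 and g2 agree, brings x into T_(p);
    [xis] lifts the numerator, and g2 gives its conjugate. The denominator is there because [P]
    contains all of Q, which T_(p) need not. *)
Definition gal_rel (x : P) (t : T) : Prop := exists (d : AL Z) (xi : TTp Z p) xis,
  [/\ d != 0, val x * ALTF Z (tofrac d) = val xi, TTpC D xi = g1 xis &
      mult_rel (t * i (QPV Psi0 (tofrac d))) (g2 xis)].

(** Here the relations satisfied by Psi are carried over to Psi C: the numerator 0 lifts to 0 by
    injectivity of g1, its conjugate is 0, and [mult_rel0] brings this back to [T]. *)
Lemma gal_rel0 t : gal_rel 0 t -> t = 0.
Proof.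
move=> [d [xi [xis [d0 xiE xis1 rel]]]].
have xi0 : xi = 0 by apply: val_inj; rewrite -xiE mul0r.
have xis0 : xis = 0 by apply: g1_inj; rewrite rmorph0 -xis1 xi0 rmorph0.
move: rel; rewrite xis0 rmorph0 => /mult_rel0/iQ_unit; apply.
by rewrite tofrac_eq0.
Qed.

Lemma mult_rel_AL (d : AL Z) : mult_rel (i (QPV Psi0 (tofrac d))) (TTC D (ALT Z d)).
Proof. by apply: mult_relP; rewrite /= ALTFE. Qed.

Lemma gal_rel_B x t x' t' : gal_rel x t -> gal_rel x' t' ->
  gal_rel (x - x') (t - t').
Proof.
move=> [d [xi [xis [d0 xiE xis1 rel]]]] [d' [xi' [xis' [d'0 xiE' xis1' rel']]]].
have [ds [ds1 ds2]] := g12_AL d; have [ds' [ds1' ds2']] := g12_AL d'.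
exists (d * d'), (xi * to_loc _ p (ALT Z d') - xi' * to_loc _ p (ALT Z d)),
  (xis * ds' - xis' * ds); split.
- by rewrite mulf_neq0.
- transitivity (val xi * tofrac (ALT Z d') - val xi' * tofrac (ALT Z d)) => //.
  rewrite -xiE -xiE' -!ALTFE tofracM rmorphM.
  transitivity ((val x - val x') * (ALTF Z (tofrac d) * ALTF Z (tofrac d'))) => //.
  by ring.
- by rewrite !rmorphB !rmorphM xis1 xis1' ds1 ds1'.
- rewrite !rmorphB !rmorphM ds2 ds2'.
  have := mult_relB (mult_relM rel (mult_rel_AL d')) (mult_relM rel' (mult_rel_AL d)).
  by congr mult_rel; ring.
Qed.

Lemma gal_rel_M x t x' t' : gal_rel x t -> gal_rel x' t' ->
  gal_rel (x * x') (t * t').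
Proof.
move=> [d [xi [xis [d0 xiE xis1 rel]]]] [d' [xi' [xis' [d'0 xiE' xis1' rel']]]].
exists (d * d'), (xi * xi'), (xis * xis'); split.
- by rewrite mulf_neq0.
- transitivity (val xi * val xi') => //.
  rewrite -xiE -xiE' tofracM rmorphM.
  by transitivity (val x * val x' * (ALTF Z (tofrac d) * ALTF Z (tofrac d'))); ring.
- by rewrite !rmorphM xis1 xis1'.
- rewrite !rmorphM.
  by have := mult_relM rel rel'; congr mult_rel; ring.
Qed.

Lemma gal_rel_TTp (x : P) f fs t : val x = val f -> TTpC D f = g1 fs ->
  mult_rel t (g2 fs) -> gal_rel x t.
Proof.
move=> xf fs1 rel; exists 1, f, fs; rewrite oner_neq0 tofrac1 !rmorph1 !mulr1.
by split.
Qed.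

Lemma gal_rel_Q x : gal_rel (QPV Psi0 x) (i (QPV Psi0 x)).
Proof.
have [n [d [d0 nd]]] := frac_repr x.
have [ns [n1 n2]] := g12_AL n.
exists d, (to_loc _ p (ALT Z n)), ns; split=> //.
- by rewrite /= -rmorphM nd ALTFE.
- by rewrite n2 -!rmorphM nd; apply: mult_rel_AL.
Qed.

Let C0 : 'M[{fraction Ap D}]_r := map_mx (@FracField.tofrac (Ap D)) C.
Let Psi_T := map_mx i (PsiPV Psi0) *m map_mx j C0.

Lemma gal_rel_Psi k l : gal_rel (PsiPV Psi0 k l) (Psi_T k l).
Proof.
apply: (gal_rel_TTp (f := Psi k l) (fs := Psis k l)).
- by rewrite mxE /= mxE.
- by have /matrixP/(_ k l) := g1_Psis; rewrite !mxE.
have /matrixP/(_ k l) := g2_Psis; rewrite !mxE => ->.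
apply: mult_rel_sum => k'.
rewrite [map_mx i _ _ _]mxE [map_mx j _ _ _]mxE [C0 _ _]mxE.
rewrite [map_mx (TTpC D) _ _ _]mxE [map_mx (ApC D) _ _ _]mxE.
by apply: mult_rel_pure; rewrite mxE /= mxE.
Qed.

Let val_TTp : {rmorphism TTp Z p -> {fraction TT Z}} := val.

(** This element is det Ups, which lies in T_(p) and lifts to det Us; as g2(Us) = C' Ups, its
    conjugate is det C' det Ups. *)
Lemma gal_rel_detV (x : P) : val x = (\det Psi0)^-1 -> exists t, gal_rel x t.
Proof.
move=> xE; exists (i x * j (tofrac (\det C'))).
have valdet : val x = val (\det Ups).
  have dd : val_TTp (\det Ups) * \det Psi0 = 1.
    have -> : Psi0 = map_mx val_TTp Psi by [].
    by rewrite det_map_mx -rmorphM -det_mulmx UP det1 rmorph1.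
  have dn0 : \det Psi0 != 0.
    by apply: contra_eq_neq dd => ->; rewrite mulr0 eq_sym oner_neq0.
  by rewrite xE -[LHS]mul1r -dd mulfK.
have UPC : map_mx (TTpC D) Ups *m map_mx (TTpC D) Psi = 1%:M.
  by rewrite -map_mxM UP map_mx1.
have CCC : map_mx (ApC D) C *m map_mx (ApC D) C' = 1%:M.
  by rewrite -map_mxM CC' map_mx1.
have Us1 : map_mx g1 Us = map_mx (TTpC D) Ups.
  rewrite -[RHS]mul1mx -(map_mx1 g1) -UPs map_mxM g1_Psis -mulmxA -map_mxM PU.
  by rewrite map_mx1 mulmx1.
have Us2 : map_mx g2 Us = map_mx (ApC D) C' *m map_mx (TTpC D) Ups.
  have : map_mx g2 Us *m map_mx g2 Psis = 1%:M by rewrite -map_mxM UPs map_mx1.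
  rewrite g2_Psis => /(congr1 (mulmx^~ (map_mx (ApC D) C' *m map_mx (TTpC D) Ups))).
  rewrite mul1mx => <-; rewrite -!mulmxA (mulmxA (map_mx _ C)) CCC mul1mx.
  by rewrite -map_mxM PU map_mx1 mulmx1.
apply: (gal_rel_TTp (f := \det Ups) (fs := \det Us)) => //.
  by rewrite -!det_map_mx Us1.
rewrite -[g2 _]det_map_mx Us2 det_mulmx !det_map_mx [X in mult_rel _ X]mulrC.
exact: mult_rel_pure.
Qed.

Lemma gal_rel_total x : exists t, gal_rel x t.
Proof.
(* [gen_ind] runs over elements of Quot(T), so membership in [P] is carried along as an
   existential. *)
suff : exists2 x' : P, val x' = val x & exists t, gal_rel x' t.
  by move=> [x' /PV_eq ->].
have := valP x.
apply: (gen_ind (P := fun y => exists2 x' : P, val x' = y & exists t, gal_rel x' t)).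
- exists 1 => //; exists (i (QPV Psi0 1)).
  by have := gal_rel_Q 1; rewrite (rmorph1 (QPV Psi0)).
- move=> _ _ [y <- [t yt]] [y' <- [t' yt']]; exists (y - y') => //.
  by exists (t - t'); apply: gal_rel_B.
- move=> _ _ [y <- [t yt]] [y' <- [t' yt']]; exists (y * y') => //.
  by exists (t * t'); apply: gal_rel_M.
- move=> y [[z ->]|[k [l ->]]|yE].
  + by exists (QPV Psi0 z) => //; exists (i (QPV Psi0 z)); apply: gal_rel_Q.
  + exists (PsiPV Psi0 k l); first by rewrite mxE.
    by exists (Psi_T k l); apply: gal_rel_Psi.
  + have yP : y \in gen_pred (PV_gen Psi0) by apply: gen_predP; apply: Or33.
    by exists (Subr yP) => //; apply: gal_rel_detV.
Qed.

Lemma gal_morphism : exists alpha : {rmorphism T -> T},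
  [/\ forall x, alpha (i (QPV Psi0 x)) = i (QPV Psi0 x),
      forall c, alpha (j c) = j c &
      map_mx (alpha \o i) (PsiPV Psi0) = Psi_T].
Proof.
have rel1 : gal_rel 1 1.
  by have := gal_rel_Q 1; rewrite (rmorph1 (QPV Psi0)) rmorph1.
have [a0 a0P] := rmorph_of_rel gal_rel_total gal_rel0 rel1 gal_rel_B gal_rel_M.
have a0Q x : a0 (QPV Psi0 x) = i (QPV Psi0 x) by apply/a0P/gal_rel_Q.
have [c|alpha [ai aj]] := tensor_liftE Tt (u := a0) (v := j).
  by rewrite /= a0Q; case: Tt => /(_ c).
exists alpha; split=> [x|c|]; rewrite ?ai ?aj //.
by apply/matrixP => k l; rewrite mxE /= ai; apply/a0P/gal_rel_Psi.
Qed.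
End Automorphism.

(** * Frobenius on the Picard-Vessiot ring *)

Section FrobeniusOnPV.
Variables (X : curve) (Y : coefficients X) (Z : tate Y) (r : nat).
Variables (p : prime_idealr (AA X)) (W : loc_maps Z p).
Hypothesis KK_frac_AA : forall x : KK X, exists b c : AA X,
  b != 0 /\ x * val b = val c.

(** A morphism on S_(p) is prescribed only on S; clearing a denominator, whose image in the field
    Quot(T) is nonzero, determines it on fractions. *)
Lemma val_ALpTTp x : val (ALpTTp W x) = ALTF Z (val x).
Proof.
have [n [d [d0 nd]]] := frac_repr (val x).
have /(congr1 (val \o ALpTTp W)) : to_loc (AL_l Z) p d * x = to_loc (AL_l Z) p n.
  by apply: to_locM; rewrite mulrC.
rewrite /= rmorphM !ALpTTpE /= => e.
have Ad0 : tofrac (ALT Z d) != 0 by rewrite -ALTFE fmorph_eq0 tofrac_eq0.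
by apply: (mulfI Ad0); rewrite e -!ALTFE -nd rmorphM mulrC.
Qed.

Lemma val_tauTTp x : val (tauTTp W x) = tauTF Z (val x).
Proof.
have [n [d [d0 nd]]] := frac_repr (val x).
have /(congr1 (val \o tauTTp W)) : to_loc (ACT Z \o AC_l Z) p d * x = to_loc _ p n.
  by apply: to_locM; rewrite mulrC.
rewrite /= rmorphM !tauTTpE /= => e.
have Ad0 : tofrac (tauT Z d) != 0 by rewrite -tauTFE fmorph_eq0 tofrac_eq0.
by apply: (mulfI Ad0); rewrite e -!tauTFE -nd rmorphM mulrC.
Qed.

Lemma tauTF_ALTF x : exists y, tauTF Z (ALTF Z x) = ALTF Z y.
Proof.
have [n [d [d0 nd]]] := frac_repr x.
exists (tofrac (tauAL Z n) / tofrac (tauAL Z d)).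
rewrite fmorph_div !ALTFE -!tauT_ALT -!tauTFE -!ALTFE -nd !rmorphM mulfK //.
by rewrite !fmorph_eq0 tofrac_eq0.
Qed.

Lemma tauTF_KQ k : tauTF Z (ALTF Z (KQ Z k)) = ALTF Z (KQ Z k).
Proof.
have [b [c [b0 bc]]] := KK_frac_AA k.
have fixA (a : AA X) : tauTF Z (ALTF Z (KQ Z (val a))) = ALTF Z (KQ Z (val a)).
  by rewrite KQE ALTFE tauTFE ALTl tauTl.
have B0 : ALTF Z (KQ Z (val b)) != 0.
  by rewrite !fmorph_eq0; apply: contraNneq b0 => b0; apply/eqP/val_inj.
apply: (mulIf B0); rewrite -{1}fixA -!rmorphM bc; exact: fixA.
Qed.

Variables (Theta : 'M[ALp Z p]_r) (Ups Psi : 'M[TTp Z p]_r).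
Hypotheses (UP : Ups *m Psi = 1%:M) (PU : Psi *m Ups = 1%:M).
Hypothesis tauUps : map_mx (tauTTp W) Ups *m map_mx (ALpTTp W) Theta = Ups.
Let Psi0 : 'M[{fraction TT Z}]_r := map_mx val Psi.
Local Notation P := (PV Psi0).
Let ThetaQ : 'M[{fraction AL Z}]_r := map_mx val Theta.

Lemma tauTF_Psi : map_mx (tauTF Z) Psi0 = map_mx (ALTF Z) ThetaQ *m Psi0.
Proof.
have e : map_mx (tauTTp W) Psi = map_mx (ALpTTp W) Theta *m Psi.
  rewrite -[LHS]mulmx1 -UP -{1}tauUps !mulmxA -map_mxM PU.
  by rewrite map_mx1 mul1mx.
pose v : {rmorphism TTp Z p -> {fraction TT Z}} := val.
have -> : Psi0 = map_mx v Psi by [].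
transitivity (map_mx v (map_mx (tauTTp W) Psi)).
  by apply/matrixP => k l; rewrite !mxE; apply/esym/val_tauTTp.
rewrite e map_mxM; congr (_ *m _).
by apply/matrixP => k l; rewrite !mxE; apply: val_ALpTTp.
Qed.

Lemma tauTF_PV x : x \in gen_pred (PV_gen Psi0) -> tauTF Z x \in gen_pred (PV_gen Psi0).
Proof.
move: x; apply: (gen_ind (P := fun y => tauTF Z y \in gen_pred (PV_gen Psi0))).
- by rewrite rmorph1 rpred1.
- by move=> x y Px Py; rewrite rmorphB rpredB.
- by move=> x y Px Py; rewrite rmorphM rpredM.
- move=> x [[y ->]|[k [l ->]]|->].
  + by have [z ->] := tauTF_ALTF y; apply: ALTF_PV.
  + have /matrixP/(_ k l) := tauTF_Psi; rewrite [LHS]mxE [RHS]mxE => ->.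
    by apply: rpred_sum => m _; rewrite rpredM ?Psi_PV // mxE ALTF_PV.
  + rewrite fmorphV -det_map_mx tauTF_Psi det_mulmx invfM det_map_mx -fmorphV.
    by rewrite rpredM ?ALTF_PV //; apply: gen_predP; apply: Or33.
Qed.

Lemma tauPV_exists : exists tauP : {rmorphism P -> P},
  forall x, val (tauP x) = tauTF Z (val x).
Proof.
pose v : {rmorphism P -> {fraction TT Z}} := val.
have h (x : P) : (tauTF Z \o v) x \in gen_pred (PV_gen Psi0).
  by apply: tauTF_PV; apply: valP.
by exists (subr_lift h).
Qed.

(** Agreement at (det Psi)^-1 is forced by agreement at det Psi, inverses being unique. *)
Lemma PV_hom_eq (S : comNzRingType) (u v : {rmorphism P -> S}) :
  (forall x, u (QPV Psi0 x) = v (QPV Psi0 x)) ->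
  (forall k l, u (PsiPV Psi0 k l) = v (PsiPV Psi0 k l)) -> u =1 v.
Proof.
move=> uvQ uvPsi x.
suff : exists2 x' : P, val x' = val x & u x' = v x'.
  by move=> [x' xx']; have -> : x' = x by apply: val_inj.
have := valP x; apply: (gen_ind (P := fun y => exists2 x' : P, val x' = y & u x' = v x')).
- by exists 1 => //; rewrite !rmorph1.
- by move=> _ _ [y <- uy] [z <- uz]; exists (y - z) => //; rewrite !rmorphB uy uz.
- by move=> _ _ [y <- uy] [z <- uz]; exists (y * z) => //; rewrite !rmorphM uy uz.
- move=> y [[z ->]|[k [l ->]]|yE].
  + by exists (QPV Psi0 z).
  + by exists (PsiPV Psi0 k l) => //; rewrite mxE.
  + have yP : y \in gen_pred (PV_gen Psi0) by apply: gen_predP; apply: Or33.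
    exists (Subr yP) => //.
    pose w : {rmorphism P -> {fraction TT Z}} := val.
    have yd : (Subr yP : P) * \det (PsiPV Psi0) = 1.
      apply: val_inj; change (y * w (\det (PsiPV Psi0)) = 1); rewrite -det_map_mx.
      have -> : map_mx w (PsiPV Psi0) = Psi0 by apply/matrixP => k l; rewrite !mxE.
      pose vT : {rmorphism TTp Z p -> {fraction TT Z}} := val.
      have dd : vT (\det Ups) * \det Psi0 = 1.
        have -> : Psi0 = map_mx vT Psi by [].
        by rewrite det_map_mx -rmorphM -det_mulmx UP det1 rmorph1.
      by rewrite yE mulVf //; apply: contra_eq_neq dd => ->; rewrite mulr0 eq_sym oner_neq0.
    have uvd : u (\det (PsiPV Psi0)) = v (\det (PsiPV Psi0)).
      rewrite -!det_map_mx; congr (\det _); apply/matrixP => k l.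
      by rewrite [LHS]mxE [RHS]mxE.
    have ud := congr1 u yd; have vd := congr1 v yd.
    rewrite !rmorphM !rmorph1 in ud vd.
    by rewrite -[LHS]mulr1 -vd [v _ * _]mulrC mulrA -uvd ud mul1r.
Qed.

Variables (D : completions Z p) (T : comNzRingType) (i : {rmorphism P -> T})
  (j : {rmorphism {fraction Ap D} -> T}).
Hypothesis Tt : is_tensor (QPV Psi0 \o KQ Z) (KKp D) i j.

Lemma T_hom_eq (S : comNzRingType) (u v : {rmorphism T -> S}) :
  (forall x, u (i (QPV Psi0 x)) = v (i (QPV Psi0 x))) ->
  (forall c, u (j c) = v (j c)) ->
  map_mx u (map_mx i (PsiPV Psi0)) = map_mx v (map_mx i (PsiPV Psi0)) -> u =1 v.
Proof.
move=> uvQ uvj uvPsi; apply: (tensor_hom_eq Tt) => //.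
apply: (@PV_hom_eq S (u \o i) (v \o i)) => [x|k l] /=; first exact: uvQ.
by have /matrixP/(_ k l) := uvPsi;
  rewrite [map_mx u _ k l]mxE [map_mx v _ k l]mxE [map_mx i _ k l]mxE.
Qed.

(** Morphisms out of [T] are determined on Q, K_p and Psi. On Psi, the composites of alpha and beta
    give Psi C C' or Psi C' C, and the two composites of alpha and tau both give Theta Psi C, since
    tau fixes [C] and alpha fixes [Theta]. *)
Lemma in_Gamma_conditions (C C' : 'M[Ap D]_r) (alpha beta : {rmorphism T -> T}) :
    C *m C' = 1%:M -> C' *m C = 1%:M ->
    (forall x, alpha (i (QPV Psi0 x)) = i (QPV Psi0 x)) ->
    (forall c, alpha (j c) = j c) ->
    map_mx (alpha \o i) (PsiPV Psi0) =
      map_mx i (PsiPV Psi0) *m map_mx j (map_mx (@FracField.tofrac (Ap D)) C) ->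
    (forall x, beta (i (QPV Psi0 x)) = i (QPV Psi0 x)) ->
    (forall c, beta (j c) = j c) ->
    map_mx (beta \o i) (PsiPV Psi0) =
      map_mx i (PsiPV Psi0) *m map_mx j (map_mx (@FracField.tofrac (Ap D)) C') ->
  exists (tauP : {rmorphism P -> P}) (tauPS : {rmorphism T -> T}),
    [/\ forall x, val (tauP x) = tauTF Z (val x),
        forall x c, tauPS (i x * j c) = i (tauP x) * j c,
        bijective alpha &
        forall t, tauPS (alpha t) = alpha (tauPS t)].
Proof.
move=> CC' C'C aQ aj aPsi bQ bj bPsi.
have [tauP tauPE] := tauPV_exists.
have tauQ x : exists y, tauP (QPV Psi0 x) = QPV Psi0 y.
  have [y yE] := tauTF_ALTF x; exists y; apply: val_inj; by rewrite tauPE.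
(* The map tau (x) id is defined on a tensor product over K because tau fixes K. *)
have [k|tauPS tauPSE] := tensor_lift Tt (u := i \o tauP) (v := j).
  rewrite /= -(Tt.1 k) /=; congr (i _); apply: val_inj; rewrite tauPE; exact: tauTF_KQ.
have tauPSi x : tauPS (i x) = i (tauP x).
  by have := tauPSE x 1; rewrite !rmorph1 !mulr1.
have tauPSj c : tauPS (j c) = j c.
  by have := tauPSE 1 c; rewrite !rmorph1 !mul1r.
have mapE (u v : {rmorphism T -> T}) (A : 'M[{fraction Ap D}]_r) :
    (forall c, u (j c) = j c) ->
    map_mx (v \o i) (PsiPV Psi0) = map_mx i (PsiPV Psi0) *m map_mx j A ->
    map_mx u (map_mx v (map_mx i (PsiPV Psi0))) =
    map_mx u (map_mx i (PsiPV Psi0)) *m map_mx j A.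
  move=> uj vPsi; rewrite -[map_mx v (map_mx i _)]map_mx_comp vPsi map_mxM; congr (_ *m _).
  by apply/matrixP => k l; rewrite !mxE uj.
have canc (u v : {rmorphism T -> T}) (A B : 'M[Ap D]_r) : A *m B = 1%:M ->
    (forall x, u (i (QPV Psi0 x)) = i (QPV Psi0 x)) -> (forall c, u (j c) = j c) ->
    map_mx (u \o i) (PsiPV Psi0) =
      map_mx i (PsiPV Psi0) *m map_mx j (map_mx (@FracField.tofrac (Ap D)) A) ->
    (forall x, v (i (QPV Psi0 x)) = i (QPV Psi0 x)) -> (forall c, v (j c) = j c) ->
    map_mx (v \o i) (PsiPV Psi0) =
      map_mx i (PsiPV Psi0) *m map_mx j (map_mx (@FracField.tofrac (Ap D)) B) ->
    cancel v u.
  move=> AB uQ uj uPsi vQ vj vPsi.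
  apply: (@T_hom_eq T (u \o v) idfun) => [x|c|] /=; rewrite ?vQ ?uQ ?vj ?uj //.
  rewrite map_mx_comp (mapE u v _ uj vPsi) -map_mx_comp uPsi -mulmxA -!map_mxM AB.
  by rewrite !map_mx1 mulmx1 map_mx_id.
exists tauP, tauPS; split=> //.
  by exists beta; [apply: canc C'C _ _ _ _ _ _ | apply: canc CC' _ _ _ _ _ _].
apply: (@T_hom_eq T (tauPS \o alpha) (alpha \o tauPS)) => [x|c|] /=.
- by rewrite aQ tauPSi; have [y ->] := tauQ x; rewrite aQ.
- by rewrite aj tauPSj aj.
have tauPsi : map_mx tauP (PsiPV Psi0) = map_mx (QPV Psi0) ThetaQ *m PsiPV Psi0.
  pose w : {rmorphism P -> {fraction TT Z}} := val.
  have w_inj (A B : 'M[P]_r) : map_mx w A = map_mx w B -> A = B.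
    move=> AB; apply/matrixP => k l; apply: val_inj.
    by have /matrixP/(_ k l) := AB; rewrite !mxE.
  have wPsi : map_mx w (PsiPV Psi0) = Psi0 by apply/matrixP => k l; rewrite !mxE.
  apply: w_inj; rewrite map_mxM wPsi.
  transitivity (map_mx (tauTF Z) Psi0).
    apply/matrixP => k l; rewrite [LHS]mxE [map_mx tauP _ _ _]mxE [RHS]mxE.
    have e : val (PsiPV Psi0 k l) = Psi0 k l by rewrite mxE.
    exact: etrans (tauPE _) (congr1 (tauTF Z) e).
  by rewrite tauTF_Psi; congr (_ *m _); apply/matrixP => k l; rewrite !mxE.
have itauPsi : map_mx tauPS (map_mx i (PsiPV Psi0)) =
    map_mx i (map_mx (QPV Psi0) ThetaQ) *m map_mx i (PsiPV Psi0).
  rewrite -map_mxM -tauPsi -!map_mx_comp.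
  by apply/matrixP => k l; rewrite [LHS]mxE [RHS]mxE /= tauPSi.
have compE (u v : {rmorphism T -> T}) :
    map_mx (u \o v) (map_mx i (PsiPV Psi0)) = map_mx u (map_mx v (map_mx i (PsiPV Psi0))).
  by apply/matrixP => k l; rewrite [LHS]mxE [RHS]mxE [map_mx v _ _ _]mxE.
rewrite (compE tauPS alpha) (compE alpha tauPS) (mapE tauPS alpha _ tauPSj aPsi).
rewrite itauPsi map_mxM -mulmxA.
have <- : map_mx (alpha \o i) (PsiPV Psi0) = map_mx alpha (map_mx i (PsiPV Psi0)).
  by apply/matrixP => k l; rewrite [LHS]mxE [RHS]mxE [map_mx i _ _ _]mxE.
rewrite aPsi; congr (_ *m _).
by apply/matrixP => k l; rewrite [RHS]mxE [map_mx i _ _ _]mxE [map_mx _ ThetaQ _ _]mxE aQ.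
Qed.
End FrobeniusOnPV.

(** * The cocycle *)

(** Coordinates on M_(p), mapped to T_(p), form a semilinear map to row vectors, so base change
    extends them to a linear [h] on T_(p) (x) M sending m_k to the k-th unit vector. Applying [h] to
    the invariance of Ups m compares coordinates. *)
Lemma frob_relation (X : curve) (Y : coefficients X) (Z : tate Y)
    (E : anderson_module Y) (M : motive Z E) (p : prime_idealr (AA X))
    (W : loc_maps Z p) (N : loc_motive W M) (r : nat) (m : 'I_r -> motp N)
    (Theta : 'M[ALp Z p]_r) (Ups : 'M[TTp Z p]_r) :
  is_basis m ->
  (forall i, tau_motp (m i) = \sum_j Theta i j *: m j) ->
  (forall i, tau_motT (\sum_j Ups i j *: to_motT (m j)) =
     \sum_j Ups i j *: to_motT (m j)) ->
  map_mx (tauTTp W) Ups *m map_mx (ALpTTp W) Theta = Ups.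
Proof.
move=> hm hTheta hUps.
pose c x := projT1 (cid (hm x)).
have cP x (d : 'I_r -> ALp Z p) : x = \sum_i d i *: m i -> forall i, c x i = d i.
  move=> xd i; rewrite /c; case: cid => c' [/= _ uniq].
  rewrite (uniq [ffun k => d k]) ?ffunE //.
  by rewrite xd; apply: eq_bigr => k _; rewrite ffunE.
have cE x : x = \sum_i c x i *: m i by rewrite /c; case: cid => c' [].
pose g x : 'rV[TTp Z p]_r := \row_j ALpTTp W (c x j).
have gE x (d : 'I_r -> ALp Z p) : x = \sum_i d i *: m i ->
    g x = \row_j ALpTTp W (d j).
  by move=> /cP xd; apply/rowP => k; rewrite !mxE xd.
have [_ /(_ 'rV[TTp Z p]_r g)[|[h hg] _]] := motT_base_change N.
  split=> [x y|a x].
    rewrite (gE (x + y) (fun k => c x k + c y k)).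
      by apply/rowP => k; rewrite !mxE rmorphD.
    rewrite {1}(cE x) {1}(cE y) -big_split; apply: eq_bigr => k _.
    by rewrite scalerDl.
  rewrite (gE (a *: x) (fun k => a * c x k)).
    by apply/rowP => k; rewrite !mxE rmorphM.
  rewrite {1}(cE x) scaler_sumr; apply: eq_bigr => k _; exact: scalerA.
have gm k : g (m k) = delta_mx 0 k.
  rewrite (gE (m k) (fun l => (l == k)%:R)).
    by apply/rowP => l; rewrite !mxE eqxx rmorph_nat.
  rewrite (bigD1 k) //= eqxx scale1r big1 ?addr0 // => l /negbTE ->.
  by rewrite scale0r.
have tau0 : tau_motT (0 : motT N) = 0.
  by apply: (addrI (tau_motT (0 : motT N))); rewrite -tau_motTD !addr0.
apply/row_matrixP => k.
have := congr1 h (hUps k).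
rewrite (big_morph _ (@tau_motTD _ _ _ _ _ _ _ N) tau0) !linear_sum /= => e.
transitivity (\sum_j h (tau_motT (Ups k j *: to_motT (m j)))).
  rewrite row_mul mulmx_sum_row; apply: eq_bigr => j _.
  rewrite tau_motTZ tau_motTE linearZ /= hg (gE _ _ (hTheta j)) !mxE.
  by congr (_ *: _); apply/rowP => l; rewrite !mxE.
rewrite e [RHS]row_sum_delta; apply: eq_bigr => j _.
by rewrite linearZ /= hg gm mxE.
Qed.

Section Assembly.
Variables (X : curve) (Y : coefficients X) (Z : tate Y).
Variables (p : prime_idealr (AA X)) (W : loc_maps Z p) (D : completions Z p).
Local Notation PC := (pC D).
Local Notation PL := (pLsep D).

Let absP := absC_abs Y.
Let PN := gauss_PC D.

Lemma pLsepC_inj : injective (pLsepC D).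
Proof. exact: (padic_inj absP PN (pLsepC_induced D)). Qed.

Lemma rational_pLsepC z : rational (LsepC Y) (pLsepC D z).
Proof.
move=> n; have [g [gE gP]] := pLsepC_induced D n.
have [u uE] := tensor_span (pT_is_tensor PL n) (pZ_pr PL n z).
by exists u; rewrite gP uE rmorph_sum; apply: eq_bigr => v _; rewrite gE.
Qed.

Lemma rational_LC_lift z : rational (PC := PC) (LC Y) z ->
  exists w, pLsepC D w = z.
Proof.
move=> zr; apply: (rational_lift absP PN (pLsepC_induced D)) => n.
have [u uE] := zr n; exists [seq (v.1, LLsep Y v.2) | v <- u].
by rewrite uE big_map; apply: eq_bigr => v _; rewrite LsepC_LLsep.
Qed.

Variables (gamma : {rmorphism Lsep Y -> Lsep Y}) (g : {rmorphism pZ PL -> pZ PL}).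
Hypotheses (gammaL : forall x, gamma (LLsep Y x) = LLsep Y x).
Hypothesis gP : padic_induced gamma g.

Lemma rational_LC_fixed z : rational (LC Y) (pLsepC D z) -> g z = z.
Proof.
move=> zr.
apply: (rational_fixed absP PN (l := LLsep Y) (pLsepC_induced D) gP gammaL) => n.
have [u uE] := zr n; exists u; rewrite uE.
by apply: eq_bigr => v _; rewrite /= LsepC_LLsep.
Qed.

Lemma pLsepC_g_inj : injective (pLsepC D \o g).
Proof.
by apply: (padic_inj absP PN (s := LsepC Y \o gamma));
  apply: padic_induced_comp gP (pLsepC_induced D).
Qed.

(** Both compatibilities of tau on (A (x) Lsep)_p, with the embedding and with [g], hold because the
    q-th power map commutes with every ring morphism. *)
Lemma tau_pLsep : exists tauC : {rmorphism pZ PC -> pZ PC},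
  exists tauS : {rmorphism pZ PL -> pZ PL},
  [/\ padic_induced (fun c => c ^+ q X) tauC,
      forall f : TTp Z p, tauC (TTpC D f) = TTpC D (tauTTp W f),
      forall z, pLsepC D (tauS z) = tauC (pLsepC D z) &
      forall z, g (tauS z) = tauS (g z)].
Proof.
have [tauC tauCP tauCE] := tauC_exists D.
have [s sE] := frobenius (@FqLsep X Y).
have [c|tauS tauSP] := padic_lift PL PL (s := s).
  by rewrite sE -rmorphXn expf_card.
exists tauC, tauS; split=> // [f|z|z].
- exact: tauC_TTpC.
- apply: (padic_induced_eq _ (padic_induced_comp tauSP (pLsepC_induced D))
    (padic_induced_comp (pLsepC_induced D) tauCP)) => x /=.
  by rewrite sE rmorphXn.
- apply: (padic_induced_eq _ (padic_induced_comp tauSP gP)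
    (padic_induced_comp gP tauSP)) => x /=.
  by rewrite !sE rmorphXn.
Qed.

Variables (r : nat) (Theta : 'M[ALp Z p]_r) (Ups Psi : 'M[TTp Z p]_r).
Hypotheses (UP : Ups *m Psi = 1%:M) (PU : Psi *m Ups = 1%:M).
Hypothesis tauUps : map_mx (tauTTp W) Ups *m map_mx (ALpTTp W) Theta = Ups.
Variable Us : 'M[pZ PL]_r.
Hypotheses (Us_unit : Us \in unitmx) (UsE : map_mx (pLsepC D) Us = map_mx (TTpC D) Ups).

Lemma map_pLsepC_inj (A B : 'M[pZ PL]_r) :
  map_mx (pLsepC D) A = map_mx (pLsepC D) B -> A = B.
Proof.
move=> AB; apply/matrixP => k l; apply: pLsepC_inj.
by have /matrixP/(_ k l) := AB; rewrite !mxE.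
Qed.

Lemma gUs_unit : map_mx g Us \in unitmx.
Proof. by rewrite unitmxE det_map_mx rmorph_unit // -unitmxE. Qed.

(** Theta descends to a matrix [Th] fixed by [g], being defined over L. So Us and g(Us) both satisfy
    tau(U) Th = U; the quotient of two invertible solutions, in either order, is fixed by tau, and
    [tau_fixed_Ap] applies to its entries. *)
Lemma cocycle_Ap : exists C C' : 'M[Ap D]_r,
  [/\ map_mx (ApC D) C = map_mx (pLsepC D) (Us *m invmx (map_mx g Us)),
      map_mx (ApC D) C' = map_mx (pLsepC D) (map_mx g Us *m invmx Us),
      C *m C' = 1%:M & C' *m C = 1%:M].
Proof.
have [tauC [tauS [tauCP tauCE tauSC gtauS]]] := tau_pLsep.
have /choice[th0 th0E] : forall kl : 'I_r * 'I_r, exists w,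
    pLsepC D w = TTpC D (ALpTTp W (Theta kl.1 kl.2)).
  by move=> kl; apply: rational_LC_lift; apply: rational_ALp.
pose Th : 'M[pZ PL]_r := \matrix_(k, l) th0 (k, l).
have ThE : map_mx (pLsepC D) Th = map_mx (TTpC D) (map_mx (ALpTTp W) Theta).
  by apply/matrixP => k l; rewrite !mxE th0E.
have gTh : map_mx g Th = Th.
  apply/matrixP => k l; rewrite !mxE; apply: rational_LC_fixed.
  rewrite th0E; exact: rational_ALp.
have tauUs : map_mx tauS Us *m Th = Us.
  apply: map_pLsepC_inj; rewrite map_mxM ThE UsE -[in RHS]tauUps map_mxM.
  congr (_ *m _); apply/matrixP => k l.
  have h : pLsepC D (Us k l) = TTpC D (Ups k l).
    by have /matrixP/(_ k l) := UsE; rewrite !mxE.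
  rewrite [LHS]mxE [map_mx tauS _ _ _]mxE [RHS]mxE [map_mx (tauTTp W) _ _ _]mxE.
  by rewrite tauSC h tauCE.
pose G := map_mx g Us.
have tauG : map_mx tauS G *m Th = G.
  rewrite [in RHS]/G -[in RHS]tauUs map_mxM gTh; congr (_ *m _).
  by apply/matrixP => k l; rewrite !mxE gtauS.
have Gu : G \in unitmx := gUs_unit.
have fixed (A B : 'M[pZ PL]_r) : B \in unitmx ->
    map_mx tauS A *m Th = A -> map_mx tauS B *m Th = B ->
    exists C : 'M[Ap D]_r, map_mx (ApC D) C = map_mx (pLsepC D) (A *m invmx B).
  move=> Bu tA tB; pose C := A *m invmx B.
  have CB : C *m B = A by rewrite mulmxKV.
  have tC : map_mx tauS C = C.
    have : map_mx tauS C *m B = C *m B.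
      by rewrite -{1}tB mulmxA -map_mxM CB tA.
    by move/(congr1 (mulmx^~ (invmx B))); rewrite !mulmxK.
  have /choice[a aE] : forall kl : 'I_r * 'I_r, exists a, ApC D a = pLsepC D (C kl.1 kl.2).
    move=> kl; apply: tau_fixed_Ap tauCP _.
    by rewrite -tauSC; have /matrixP/(_ kl.1 kl.2) := tC; rewrite mxE => ->.
  exists (\matrix_(k, l) a (k, l)); apply/matrixP => k l.
  by rewrite [LHS]mxE [RHS]mxE [(\matrix_(_, _) _) _ _]mxE aE.
have [C CE] := fixed Us G Gu tauUs tauG.
have [C' CE'] := fixed G Us Us_unit tauG tauUs.
have ApC1 (A : 'M[Ap D]_r) : map_mx (ApC D) A = 1%:M -> A = 1%:M.
  move=> A1; apply/matrixP => k l; apply: (@ApC_inj _ _ _ _ D).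
  by have /matrixP/(_ k l) := A1; rewrite !mxE rmorph_nat.
exists C, C'; split=> //; apply: ApC1.
  by rewrite map_mxM CE CE' -map_mxM mulmxA mulmxKV // mulmxV // map_mx1.
by rewrite map_mxM CE CE' -map_mxM mulmxA mulmxKV // mulmxV // map_mx1.
Qed.

Hypothesis KK_frac_AA : forall x : KK X, exists b c : AA X,
  b != 0 /\ x * val b = val c.

Lemma cocycle_in_Gamma (C C' : 'M[Ap D]_r) :
    map_mx (ApC D) C = map_mx (pLsepC D) (Us *m invmx (map_mx g Us)) ->
    map_mx (ApC D) C' = map_mx (pLsepC D) (map_mx g Us *m invmx Us) ->
    C *m C' = 1%:M -> C' *m C = 1%:M ->
  in_Gamma (map_mx val Psi) (KKp D) (map_mx (@FracField.tofrac (Ap D)) C).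
Proof.
move=> CE CE' CC' C'C; split.
  have C0C : map_mx (@FracField.tofrac (Ap D)) C *m map_mx (@FracField.tofrac _) C' = 1%:M.
    by rewrite -map_mxM CC' map_mx1.
  by have [] := mulmx1_unit C0C.
move=> T i j Tt.
have Gu := gUs_unit.
pose Psis := invmx Us.
have PsisE : map_mx (pLsepC D) Psis = map_mx (TTpC D) Psi.
  rewrite -[LHS]mulmx1 -(map_mx1 (TTpC D)) -UP map_mxM -UsE mulmxA -map_mxM.
  by rewrite mulVmx // map_mx1 mul1mx.
have g12 (d : AL Z) : exists ds, pLsepC D ds = TTC D (ALT Z d) /\
    (pLsepC D \o g) ds = TTC D (ALT Z d).
  have [ds dsE] := rational_LC_lift (rational_ALT D d); exists ds; split=> //=.
  by rewrite rational_LC_fixed dsE //; apply: rational_ALT.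
have g21 (d : AL Z) : exists ds, (pLsepC D \o g) ds = TTC D (ALT Z d) /\
    pLsepC D ds = TTC D (ALT Z d).
  by have [ds []] := g12 d; exists ds.
have gV (A : 'M[pZ PL]_r) : A \in unitmx -> map_mx g A *m map_mx g (invmx A) = 1%:M.
  by move=> Au; rewrite -map_mxM mulmxV // map_mx1.
have gVus : map_mx g (invmx Us) = invmx (map_mx g Us).
  by rewrite -[RHS]mulmx1 -(gV _ Us_unit) mulmxA mulVmx // mul1mx.
have gPsis : map_mx (pLsepC D \o g) Psis = map_mx (TTpC D) Psi *m map_mx (ApC D) C.
  rewrite map_mx_comp gVus CE -PsisE -map_mxM; congr (map_mx _ _).
  by rewrite mulmxA mulVmx // mul1mx.
have [alpha [aQ aj aPsi]] := gal_morphism UP PU Tt pLsepC_inj g12 CC'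
  (mulmxV Us_unit) PsisE gPsis.
(* With g1 and g2 exchanged, [Psis] must be replaced by a matrix that [g] followed by the embedding
   sends to Psi. As [Cs] comes from A_p it is fixed by [g], and g(Us^-1 Cs) = g(Us)^-1 g(Us) Us^-1 =
   Us^-1. *)
pose Cs := map_mx g Us *m invmx Us.
have gCs : map_mx g Cs = Cs.
  apply/matrixP => k l; rewrite [LHS]mxE; apply: rational_LC_fixed.
  have -> : pLsepC D (Cs k l) = ApC D (C' k l).
    by have /matrixP/(_ k l) := CE'; rewrite [LHS]mxE [RHS]mxE.
  exact: rational_ApC.
pose Psis' := Psis *m Cs.
have gPsis'1 : map_mx (pLsepC D \o g) Psis' = map_mx (TTpC D) Psi.
  rewrite map_mx_comp -PsisE; congr (map_mx _ _).
  by rewrite /Psis' map_mxM gCs gVus /Cs mulmxA mulVmx // mul1mx.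
have gPsis'2 : map_mx (pLsepC D) Psis' = map_mx (TTpC D) Psi *m map_mx (ApC D) C'.
  by rewrite map_mxM PsisE CE'.
have UPs' : (Us *m invmx (map_mx g Us) *m Us) *m Psis' = 1%:M.
  by rewrite /Psis' /Psis /Cs !mulmxA mulmxK // mulmxKV // mulmxV.
have [beta [bQ bj bPsi]] := gal_morphism UP PU Tt (g1 := pLsepC D \o g)
  (g2 := pLsepC D) pLsepC_g_inj g21 C'C UPs' gPsis'1 gPsis'2.
have [tauP [tauPS [tP tPS abij comm]]] := in_Gamma_conditions KK_frac_AA UP PU tauUps
  Tt CC' C'C aQ aj aPsi bQ bj bPsi.
by exists tauP, tauPS, alpha.
Qed.
End Assembly.

(** Each row of Ups solves a Frobenius system with coefficients Theta defined over L, so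
    [rational_descent] applies. Invertibility is checked on the determinant: its inverse in (A (x)
    C_oo)_p is det Psi, which descends by [rational_inverse]. *)
Lemma trivialization_lift (X : curve) (Y : coefficients X) (Z : tate Y)
    (p : prime_idealr (AA X)) (W : loc_maps Z p) (D : completions Z p) (r : nat)
    (Theta : 'M[ALp Z p]_r) (Ups Psi : 'M[TTp Z p]_r) :
  Ups *m Psi = 1%:M ->
  map_mx (tauTTp W) Ups *m map_mx (ALpTTp W) Theta = Ups ->
  exists2 Us : 'M[pZ (pLsep D)]_r, Us \in unitmx &
    map_mx (pLsepC D) Us = map_mx (TTpC D) Ups.
Proof.
move=> UP tauUps; have [tauC tauCP tauCE] := tauC_exists D.
have rat k l : rational (LsepC Y) (TTpC D (Ups k l)).
  apply: (rational_descent (z := fun l => TTpC D (Ups k l))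
    (theta := fun l l' => TTpC D (ALpTTp W (Theta l' l))) tauCP) => [s t|s].
    exact: rational_ALp.
  have /matrixP/(_ k s) := tauUps; rewrite mxE => <-; rewrite rmorph_sum.
  apply: eq_bigr => t _; rewrite rmorphM; congr (_ * _); last by rewrite mxE.
  by rewrite (tauC_TTpC W tauCE tauCP) mxE.
have lift := rational_lift (absC_abs Y) (gauss_PC D) (pLsepC_induced D).
have /choice[u uE] : forall kl : 'I_r * 'I_r, exists w,
    pLsepC D w = TTpC D (Ups kl.1 kl.2) by move=> kl; apply: lift.
pose Us : 'M[pZ (pLsep D)]_r := \matrix_(k, l) u (k, l).
have UsE : map_mx (pLsepC D) Us = map_mx (TTpC D) Ups.
  by apply/matrixP => k l; rewrite [LHS]mxE [RHS]mxE [Us _ _]mxE uE.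
exists Us => //.
have detUP : pLsepC D (\det Us) * TTpC D (\det Psi) = 1.
  rewrite -det_map_mx UsE -[TTpC D _]det_map_mx -det_mulmx -map_mxM UP.
  by rewrite map_mx1 det1.
have LsepF c : LsepC Y (@FqLsep X Y c) = @FqC X Y c.
  by rewrite /FqLsep LsepC_LLsep /FqL LC_KL.
have [v vE] := lift _ (rational_inverse LsepF (rational_pLsepC _) detUP).
rewrite unitmxE; apply/unitrP; exists v.
have e : \det Us * v = 1.
  by apply: (@pLsepC_inj _ _ _ _ D); rewrite rmorphM vE detUP rmorph1.
by split; rewrite // mulrC.
Qed.

Theorem theorem9p10
  (X : curve) (Y : coefficients X) (Z : tate Y)
  (E : anderson_module Y) (hE : uniformizable E)
  (M : motive Z E) (r : nat) (hr : has_rank (mot M) r)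
  (p : prime_idealr (AA X)) (hp : exists2 a, a \in p & a != 0)
  (W : loc_maps Z p) (N : loc_motive W M) (hfree : free_fg (motp N))
  (m : 'I_r -> motp N) (hm : is_basis m)
  (Theta : 'M[ALp Z p]_r)
  (hTheta : forall i, tau_motp (m i) = \sum_j Theta i j *: m j)
  (Ups Psi : 'M[TTp Z p]_r)
  (hUpsPsi : Ups *m Psi = 1%:M) (hPsiUps : Psi *m Ups = 1%:M)
  (hUps : forall i,
     tau_motT (\sum_j Ups i j *: to_motT (m j)) =
     \sum_j Ups i j *: to_motT (m j))
  (D : completions Z p) :
  exists Us : 'M[pZ (pLsep D)]_r,
    [/\ Us \in unitmx,
        map_mx (pLsepC D) Us = map_mx (TTpC D) Ups &
        forall gamma : {rmorphism Lsep Y -> Lsep Y}, in_Gal gamma ->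
        forall g : {rmorphism pZ (pLsep D) -> pZ (pLsep D)},
          padic_induced gamma g ->
        exists C : 'M[Ap D]_r,
          [/\ C \in unitmx,
              map_mx (ApC D) C =
                map_mx (TTpC D) Ups *m
                invmx (map_mx (pLsepC D) (map_mx g Us)) &
              in_Gamma (map_mx val Psi) (KKp D)
                (map_mx (@FracField.tofrac (Ap D)) C)]].
Proof.
have tauUps := frob_relation hm hTheta hUps.
have KK_frac_AA x : exists b c : AA X, b != 0 /\ x * val b = val c.
  (* A nonzero constant is a unit, and p contains none, so a nonzero element of p is nonconstant. *)
  have [a pa a0] := hp; apply: (@KK_frac X a) => c; apply/negP => /eqP ac.
  have c0 : c != 0 by apply: contraNneq a0 => c0; rewrite ac c0 rmorph0.
  have : FqA X c^-1 * a \in p by apply: idealMr.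
  by rewrite ac -rmorphM mulVf // rmorph1 idealr1.
have [Us Us_unit UsE] := trivialization_lift D hUpsPsi tauUps.
exists Us; split=> // gamma [_ gammaL] g gP.
have [C [C' [CE CE' CC' C'C]]] := cocycle_Ap gammaL gP tauUps Us_unit UsE.
exists C; split.
- by have [] := mulmx1_unit CC'.
- rewrite CE map_mxM UsE; congr (_ *m _).
  have Gu := gUs_unit g Us_unit.
  rewrite -[RHS]mul1mx -(map_mx1 (pLsepC D)) -(mulVmx Gu) map_mxM.
  rewrite mulmxK // unitmxE det_map_mx rmorph_unit //.
- exact: (cocycle_in_Gamma gammaL gP hUpsPsi hPsiUps tauUps Us_unit UsE
    KK_frac_AA CE CE' CC' C'C).
Qed.
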